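(* Of the $192$ formally distinct local solutions $U_g$, $g\in G_{\rm asym}(4)\cong\mathcal{D}_4$, of the Heun equation, $24$ (including $\mathit{Hl}$ itself) are equivalent expressions for the local Heun function $\mathit{Hl}(a,q;\alpha,\beta,\gamma,\delta;x)$, and the resulting order-$24$ group of transformations of $\mathit{Hl}$ is isomorphic to the symmetric group $S_4$.
   Context: **Heun equation.** For $a\in\mathbb{C}\setminus\{0,1\}$, $q,\alpha,\beta,\gamma,\delta\in\mathbb{C}$ and $\epsilon=\alpha+\beta-\gamma-\delta+1$, it is $$u''+\Bigl[\frac{\gamma}{x}+\frac{\delta}{x-1}+\frac{\epsilon}{x-a}\Bigr]u'+\frac{\alpha\beta x-q}{x(x-1)(x-a)}u=0,$$ with singular points $0,1,a,\infty$ and exponents $0,\rho_0=1-\gamma$; $0,\rho_1=1-\delta$; $0,\rho_a=1-\epsilon$; and the ordered pair $(\rho^{(\infty)},\hat\rho^{(\infty)})=(\alpha,\beta)$ at $\infty$. Put $p=(a,q;\alpha,\beta,\gamma,\delta)$. The parameters are assumed generic: none of $1-\gamma,1-\delta,1-\epsilon,\alpha-\beta$ is an integer. **Local Heun function.** $\mathit{Hl}(a,q;\alpha,\beta,\gamma,\delta;x)$ (defined when $\gamma$ is not a nonpositive integer) is the solution analytic at $x=0$ with value $1$ there. **The group $G_{\rm asym}(4)$.** It acts on parameter tuples $p$, with product given by composition, and consists of pairs $g=(h,\sigma)$, $\sigma$ applied first. (1) $\sigma$ is a permutation of the labels $\{0,1,\infty,a\}$. Let $P_\sigma$ be the Möbius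 transformation taking the points labeled $\sigma^{-1}(0),\sigma^{-1}(1),\sigma^{-1}(\infty)$ to $0,1,\infty$. The image of the point labeled $d$ gets the label $\sigma(d)$, and $x'=P_\sigma x$. If $\sigma(\infty)\neq\infty$, the dependent variable is also multiplied by $(x'-P_\sigma(\infty))^{-\rho^{(\infty)}}$. New exponents: $\rho'_e=\rho_{\sigma^{-1}(e)}$ for finite $e\ne\sigma(\infty)$; $\rho'_{\sigma(\infty)}=\hat\rho^{(\infty)}-\rho^{(\infty)}$ if $\sigma(\infty)\neq\infty$; the pair at $\infty$ is unchanged if $\sigma(\infty)=\infty$, and is $(\rho^{(\infty)},\rho_c+\rho^{(\infty)})$ if $\sigma(c)=\infty$, $c\ne\infty$. (2) $h$ is a product over a subset of the finite labels $d\in\{0,1,a\}$ of the commuting involutions $\iota_d$ that multiply the dependent variable by $(x-d)^{-\rho_d}$ and send $\rho_d\mapsto-\rho_d$, $(\rho^{(\infty)},\hat\rho^{(\infty)})\mapsto(\rho_d+\hat\rho^{(\infty)},\rho_d+\rho^{(\infty)})$. In both cases the new $q$ is that of the transformed equation, which is again a Heun equation. $\mathcal{D}_n$ denotes the group of even-signed permutations of an $n$-set (signed permutations with an even number of negative signs). **The 192 solutions.** For $g=(h,\sigma)$ let $g\cdot p=(a',q';\alpha',\beta',\gamma',\delta')$ be the transformed parameters. Pulling back to the variable $x$ the function $\mathit{Hl}(g\cdot p;x')$, a solution of the transformed equation, gives a local solution of the original Heun equation $$U_g(x)=A_g(x)\,\mathit{Hl}(a',q';\alpha',\beta',\gamma',\delta';P_\sigma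 x),$$ with $A_g$ a constant times a product of powers of $x,x-1,x-a$. The constant is chosen so that $U_g$ is normalized; in particular solutions that are analytic and nonzero at $x=0$ are normalized to equal $1$ there. Expressions are formally distinct if they are distinct as formal expressions in the parameters, with the order of the two exponents at infinity taken into account. **Transformation group of $\mathit{Hl}$.** ''Equivalent expression for $\mathit{Hl}$'' means $U_g(x)=\mathit{Hl}(a,q;\alpha,\beta,\gamma,\delta;x)$ near $x=0$. Each such $g$ gives a transformation formula rewriting $\mathit{Hl}(p;x)$ as $A_g(x)\mathit{Hl}(g\cdot p;P_\sigma x)$. These transformations are composed by successive application. *)

(* Defs.v *)
From HB Require Import structures.
From mathcomp Require Import all_boot all_order all_algebra all_fingroup.
From mathcomp Require Import complex.
From mathcomp Require Import all_classical all_reals all_analysis.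
Set Implicit Arguments.
Unset Strict Implicit.
Unset Printing Implicit Defensive.
Import Order.TTheory GRing.Theory Num.Theory.
Import numFieldNormedType.Exports.
Local Open Scope classical_set_scope.
Local Open Scope ring_scope.
Local Open Scope complex_scope.

(* The field of complex numbers is R[i], for R : realType; it is given the
   topology and norm of R[i]^o, so that [derivable] and [derive1] at functions
   R[i] -> R[i] are complex differentiability and the complex derivative. *)
HB.instance Definition _ (R : realType) := NormedModule.copy R[i] R[i]^o.

Section ComplexPower.
Variable R : realType.
Implicit Types z w c : R[i].

Definition cexp z : R[i] :=
  (expR (complex.Re z) * cos (complex.Im z)) +i* (expR (complex.Re z) * sin (complex.Im z)).

(* Principal argument, with values in (-pi, pi]; off the closed negative
   half-line it is given by the half-angle formula.  carg 0 = 0. *)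
Definition carg w : R :=
  if w < 0 then pi
  else 2 * atan (complex.Im w / (Normc.normc w + complex.Re w)).

Definition clog w : R[i] := ln (Normc.normc w) +i* carg w.

(* Principal branch of w ^ c.  Note that cpow w 0 = 1 for all w. *)
Definition cpow w c : R[i] := cexp (c * clog w).

End ComplexPower.

(* Labels of the singular points: Some l0, Some l1, Some la are the finite
   labels 0, 1, a, and None is the label infinity. *)
Definition flabel := 'I_3.
Definition label := option flabel.
Definition l0 : flabel := @Ordinal 3 0 isT.
Definition l1 : flabel := @Ordinal 3 1 isT.
Definition la : flabel := @Ordinal 3 2 isT.

Record heun (R : realType) := Heun {
  he_a : R[i]; he_q : R[i];
  he_alpha : R[i]; he_beta : R[i]; he_gamma : R[i]; he_delta : R[i] }.

Section Heun.
Variable R : realType.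
Implicit Types (p : heun R) (u : R[i] -> R[i]) (x : R[i]).

Definition he_epsilon p : R[i] :=
  he_alpha p + he_beta p - he_gamma p - he_delta p + 1.

(* The nonzero exponent rho_d at the finite singular point labelled d. *)
Definition rho p (d : flabel) : R[i] :=
  [:: 1 - he_gamma p; 1 - he_delta p; 1 - he_epsilon p]`_d.

Definition generic p : Prop :=
  [/\ he_a p != 0, he_a p != 1 &
      forall n : int,
        [/\ 1 - he_gamma p != n%:~R, 1 - he_delta p != n%:~R,
            1 - he_epsilon p != n%:~R &
            he_alpha p - he_beta p != n%:~R]].

Definition solves_at p u x : Prop :=
  [/\ derivable u x 1, derivable (derive1 u) x 1 &
      derive1 (derive1 u) x
      + (he_gamma p / x + he_delta p / (x - 1) + he_epsilon p / (x - he_a p))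
        * derive1 u x
      + (he_alpha p * he_beta p * x - he_q p) / (x * (x - 1) * (x - he_a p))
        * u x = 0].

Definition is_Hl p u : Prop :=
  [/\ \forall x \near (0 : R[i]), derivable u x 1,
      u 0 = 1 &
      \forall x \near (0 : R[i])^', solves_at p u x].

(* The local Heun function.  Only its germ at 0 is meaningful. *)
Definition Hl p : R[i] -> R[i] := xget (fun=> 0) [set u | is_Hl p u].

(* Points of the Riemann sphere in homogeneous coordinates: x is (x, 1) and
   infinity is (1, 0). *)
Definition bracket (X Y : R[i] * R[i]) : R[i] := X.1 * Y.2 - X.2 * Y.1.

Definition fpoint (a : R[i]) (d : flabel) : R[i] := [:: 0; 1; a]`_d.

Definition point (a : R[i]) (l : label) : R[i] * R[i] :=
  if l is Some d then (fpoint a d, 1) else (1, 0).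

(* The (finite) value at X of the Moebius transformation P_s taking the points
   labelled s^-1 0, s^-1 1, s^-1 infinity to 0, 1, infinity. *)
Definition mobius (a : R[i]) (s : {perm label}) (X : R[i] * R[i]) : R[i] :=
  let z0 := point a (s^-1%g (Some l0)) in
  let z1 := point a (s^-1%g (Some l1)) in
  let zi := point a (s^-1%g None) in
  (bracket X z0 * bracket z1 zi) / (bracket X zi * bracket z1 z0).

Definition Pmap (s : {perm label}) p x : R[i] := mobius (he_a p) s (x, 1).

(* With x' = phi x and a new dependent variable v such that u = A * (v \o phi),
   the equation p for u is the equation p' for v.  The factor A is multivalued;
   A x0 is its branch near x0 that equals 1 at x0, and v is likewise known near
   phi x0 only. *)
Definition transforms p p' (phi : R[i] -> R[i]) (A : R[i] -> R[i] -> R[i]) :=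
  forall x0 : R[i], x0 != 0 -> x0 != 1 -> x0 != he_a p ->
  forall v : R[i] -> R[i],
    (\forall y \near phi x0, solves_at p' v y) <->
    (\forall x \near x0, solves_at p (fun t => A x0 t * v (phi t)) x).

Definition with_q p (q : R[i]) : heun R :=
  Heun (he_a p) q (he_alpha p) (he_beta p) (he_gamma p) (he_delta p).

(* Replaces the accessory parameter of p' by that of the transformed
   equation. *)
Definition set_q p p' phi A : heun R :=
  with_q p' (xget 0 [set q | transforms p (with_q p' q) phi A]).

(* The action of s on everything but q, which is set to 0. *)
Definition perm_exponents (s : {perm label}) p : heun R :=
  let r := rho p in
  let r' (e : flabel) :=
    if s^-1%g (Some e) is Some d then r d else he_beta p - he_alpha p in
  Heun (mobius (he_a p) s (point (he_a p) (s^-1%g (Some la)))) 0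
       (he_alpha p)
       (if s^-1%g None is Some c then r c + he_alpha p else he_beta p)
       (1 - r' l0) (1 - r' l1).

(* u = (x' - P_s infinity) ^ alpha * v if s moves infinity, and u = v
   otherwise. *)
Definition perm_factor (s : {perm label}) p (x0 x : R[i]) : R[i] :=
  if s None == None then 1
  else let w := mobius (he_a p) s (1, 0) in
       cpow ((Pmap s p x - w) / (Pmap s p x0 - w)) (he_alpha p).

Definition perm_act (s : {perm label}) p : heun R :=
  set_q p (perm_exponents s p) (Pmap s p) (perm_factor s p).

Definition iota_exponents (d : flabel) p : heun R :=
  let r e := if e == d then - rho p e else rho p e in
  Heun (he_a p) 0 (rho p d + he_beta p) (rho p d + he_alpha p)
       (1 - r l0) (1 - r l1).

(* u = (x - d) ^ rho_d * v. *)
Definition iota_factor (d : flabel) p (x0 x : R[i]) : R[i] :=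
  cpow ((x - fpoint (he_a p) d) / (x0 - fpoint (he_a p) d)) (rho p d).

Definition iota_act (d : flabel) p : heun R :=
  set_q p (iota_exponents d p) id (iota_factor d p).

End Heun.

(* Elements (h, s) of G_asym(4). *)
Definition gasym := ({set flabel} * {perm label})%type.
HB.instance Definition _ := Finite.on gasym.

Definition gasym1 : gasym := (finset.set0, 1%g).

Section Solutions.
Variable R : realType.
Implicit Types (g : gasym) (p : heun R) (x : R[i]).

Definition act g p : heun R := foldr (@iota_act R) (perm_act g.2 p) (enum g.1).

(* Exponent of x - d in
     A_g = const * (x' - P_s infinity) ^ alpha
                 * prod_(e in h) (x' - e') ^ rho'_e,   x' = P_s x,
   where e' and rho'_e are the point labelled e and its exponent after s.
   Up to constants, x' - e' is (x - s^-1 e) / (x - s^-1 infinity), with the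
   factor at infinity, if any, omitted, and x' - P_s infinity is
   1 / (x - s^-1 infinity). *)
Definition expo g p (d : flabel) : R[i] :=
  let p' := perm_act g.2 p in
  match g.2 (Some d) with
  | Some e => if e \in g.1 then rho p' e else 0
  | None => - (he_alpha p + \sum_(e in g.1) rho p' e)
  end.

(* U_g is a local solution at the point labelled s^-1 0; base_chart g p t is
   the point x with local coordinate t there: t = x - z if that point is the
   finite point z, and t = 1 / x if it is infinity. *)
Definition base_chart g p (t : R[i]) : R[i] :=
  if (g.2)^-1%g (Some l0) is Some b then fpoint (he_a p) b + t else t^-1.

(* A_g, normalized to be (t ^ c) * (1 + O(t)) at the base point. *)
Definition prefactor g p x : R[i] :=
  let z := fpoint (he_a p) in
  let c := expo g p in
  match (g.2)^-1%g (Some l0) with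
  | Some b => cpow (x - z b) (c b)
              * \prod_(d | d != b) cpow ((x - z d) / (z b - z d)) (c d)
  | None => cpow x^-1 (- \sum_d c d) * \prod_d cpow (1 - z d / x) (c d)
  end.

Definition U g p x : R[i] := prefactor g p x * Hl (act g p) (Pmap g.2 p x).

(* U_g solves the equation p near its base point, off the branch cut t <= 0
   (which, in the order of R[i], means that t is real and nonpositive). *)
Definition local_solution g p : Prop :=
  is_Hl (act g p) (Hl (act g p)) /\
  \forall t \near (0 : R[i])^',
    ~~ (t <= 0) -> solves_at p (U g p) (base_chart g p t).

(* The expression for U_g, as a function of the parameters: the exponents in
   A_g, the parameter tuple g . p (which records alpha', beta' in order), and
   the new independent variable P_s. *)
Definition expression g p : (flabel -> R[i]) * heun R * (R[i] -> R[i]) :=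
  (expo g p, act g p, Pmap g.2 p).

(* U_g = Hl near x = 0.  The germ U_g is a germ at 0 only when its base point,
   the point labelled s^-1 0, is the point labelled 0. *)
Definition equivalent g p : Prop :=
  (g.2)^-1%g (Some l0) = Some l0 /\
  \forall x \near (0 : R[i]), U g p x = Hl p x.

End Solutions.

(* g is the product g1 g2, given by composition of the actions on tuples; the
   equivalence makes it the only element acting as the composite. *)
Definition is_product (R : realType) (g1 g2 g : gasym) : Prop :=
  forall k : gasym,
    (forall p : heun R, generic p -> act k p = act g1 (act g2 p)) <-> k = g.

(* g is the transformation of Hl obtained by rewriting Hl(p; x) by g1 and then
   the resulting Hl(g1 . p; P x) by g2. *)
Definition is_successive (R : realType) (g1 g2 g : gasym) : Prop :=
  forall k : gasym,
    (forall p : heun R, generic p ->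
       act k p = act g2 (act g1 p) /\
       \forall x \near (0 : R[i]),
         Pmap k.2 p x = Pmap g2.2 (act g1 p) (Pmap g1.2 p x) /\
         prefactor k p x
         = prefactor g1 p x * prefactor g2 (act g1 p) (Pmap g1.2 p x))
    <-> k = g.

(* phi is an isomorphism from D onto E with the composition law prod. *)
Definition is_iso (gT : finGroupType) (T : finType) (D : {set gT})
    (E : {set T}) (prod : T -> T -> T -> Prop) (phi : gT -> T) : Prop :=
  [/\ {in D &, injective phi}, (phi @: D)%SET = E &
      {in D &, forall s t, prod (phi s) (phi t) (phi (s * t)%g)}].

(* Even-signed permutations of T, as permutations of T * bool commuting with
   the change of sign ((x, true) is +x and (x, false) is -x). *)
Definition even_signed (T : finType) : {set {perm T * bool}} :=
  [set s : {perm T * bool} |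
     [forall x, forall b,
        s (x, ~~ b) == ((s (x, b)).1, ~~ (s (x, b)).2)] &&
     ~~ odd #|[set x | ~~ (s (x, true)).2]%SET| ]%SET.

(* Main.v *)
Require Import Defs.
From HB Require Import structures.
From mathcomp Require Import all_boot all_order all_algebra all_fingroup.
From mathcomp Require Import complex.
From mathcomp Require Import all_classical all_reals all_analysis.
From mathcomp Require Import ring lra.
Set Implicit Arguments.
Unset Strict Implicit.
Unset Printing Implicit Defensive.
Import Order.TTheory GRing.Theory Num.Theory.
Import numFieldNormedType.Exports.
Local Open Scope classical_set_scope.
Local Open Scope ring_scope.
Local Open Scope complex_scope.

(* For a generic equation put v_d = rho_d (d finite) and v_oo = beta - alpha.
   Together with a and q these four exponent differences determine the
   equation, a permutation of the singular points permutes them, and iota_d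
   changes the signs of v_d and v_oo; this is the action of the even-signed
   permutations of four objects.  The accessory parameter is controlled by the
   invariant I = Q - P'/2 - P^2/4 of u'' + P u' + Q u = 0, which ignores factors
   multiplying u and transforms like a quadratic differential under Moebius
   maps.

   The local Heun function exists by Frobenius' recurrence, and it is unique
   because the Wronskian of two candidates is x^(-gamma) times an analytic
   function while also being single-valued near 0.  Hence U_g is Hl as soon as it
   is based at 0 and belongs to the exponent 0 there, that is, when sigma fixes
   the label 0 and h does not contain it.  It is not Hl when h contains 0, since
   x^(1 - gamma) has no limit 1 at 0.  The resulting group permutes faithfully
   the four even sets of labels not containing 0, and 24 = 4!. *)

(** * Complex differentiability, exponential and logarithm *)

(** The definitions give the new accessory parameter only as a chosen value for which solutions
    correspond, so each action first needs the existence and uniqueness of such a value. For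
    existence, a product of powers enters only through its logarithmic derivative; Fuchs' relation
    matches the coefficients of u', and equality of the invariants then forces those of u to match.
    Uniqueness needs an actual nonvanishing solution, which the local Heun function supplies; hence
    its existence precedes the group theory. For composites no accessory parameter is computed: two
    transformed equations agree once a, the exponent differences and the conjugating Moebius map
    agree. Likewise prefactors are compared by dividing two expressions for Hl by a nonvanishing Hl,
    without tracking branches. A single equation with exponent differences 1/2, 1/3, 1/4, 1/5
    separates all 192 elements, which settles formal distinctness and the uniqueness built into both
    composition laws. The order-24 group is the affine group of a plane over F_2: signs are
    translations, permutations of 1, a, infinity are linear maps. *)

Section ComplexBasics.
Variable R : realType.
Local Notation C := R[i].
Local Notation N := (@Normc.normc R).
Implicit Types (f g : C -> C) (x y z w c : C).

Lemma normcE z : `|z| = (N z)%:C. Proof. by []. Qed.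

Lemma normc_ge0 z : 0 <= N z.
Proof. by rewrite -lecR -normcE normr_ge0. Qed.

Lemma normc_gt0 z : (0 < N z) = (z != 0).
Proof. by rewrite -ltcR -normcE normr_gt0. Qed.

Lemma ler_normcD z w : N (z + w) <= N z + N w.
Proof. by rewrite -lecR rmorphD /= -!normcE ler_normD. Qed.

Lemma normcDl z w : N z - N w <= N (z + w).
Proof. by rewrite -lecR rmorphB /= -!normcE lerB_normD. Qed.

Lemma normcNr z : N (- z) = N z.
Proof. by apply: complexI; rewrite -!normcE normrN. Qed.

Lemma normcX z n : N (z ^+ n) = N z ^+ n.
Proof. by apply: complexI; rewrite rmorphXn /= -!normcE normrX. Qed.

Lemma normc_real (r : R) : N (r%:C) = `|r|.
Proof. by rewrite /= expr0n /= addr0 sqrtr_sqr. Qed.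

Lemma Re_normc z : `|complex.Re z| <= N z.
Proof.
case: z => a b /=; rewrite -sqrtr_sqr ler_sqrt ?addr_ge0 ?sqr_ge0//.
by rewrite lerDl sqr_ge0.
Qed.

Lemma Im_normc z : `|complex.Im z| <= N z.
Proof.
case: z => a b /=; rewrite -sqrtr_sqr ler_sqrt ?addr_ge0 ?sqr_ge0//.
by rewrite lerDr sqr_ge0.
Qed.

Lemma normc_ReIm z : N z <= `|complex.Re z| + `|complex.Im z|.
Proof.
case: z => a b /=; rewrite -[leRHS]ger0_norm ?addr_ge0// -sqrtr_sqr.
rewrite ler_sqrt ?sqr_ge0// sqrrD !real_normK ?num_real//.
by rewrite -addrA [X in _ <= _ + X]addrC addrA lerDl mulrn_wge0// mulr_ge0.
Qed.

Lemma gt0_complexP z : 0 < z -> exists2 r : R, 0 < r & z = r%:C.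
Proof.
case: z => a b; rewrite ltcE /= => /andP[/eqP-> a0]; by exists a.
Qed.

(** Neighbourhoods are restated with a real radius and an increment [h], so that the later estimates
    are inequalities between real numbers. *)
Lemma near_normcP (P : set C) x :
  (\forall y \near x, P y) <->
  exists2 r : R, 0 < r & forall h, N h < r -> P (x + h).
Proof.
split=> [/nbhs_ballP[e /= /gt0_complexP[r r0 ->] H]|[r r0 H]].
  exists r => // h hr; apply: H; rewrite /ball /=.
  by rewrite opprD addrA subrr sub0r normrN normcE ltcR.
apply/nbhs_ballP; exists r%:C => [|y]; first by rewrite /= ltcR.
rewrite /ball /= normcE ltcR -normcNr opprB => h.
rewrite (_ : y = x + (y - x)); last by rewrite addrC subrK.
exact: H.
Qed.

Lemma dnear_normcP (P : set C) x :
  (\forall y \near x^', P y) <->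
  exists2 r : R, 0 < r & forall h, N h < r -> h != 0 -> P (x + h).
Proof.
have E h : (x + h != x) = (h != 0) by rewrite -subr_eq0 addrAC subrr add0r.
rewrite /dnbhs near_withinE; split.
  move=> /near_normcP[r r0 H]; exists r => // h hr h0; apply: H => //=.
  by rewrite E.
move=> [r r0 H]; apply/near_normcP; exists r => // h hr /=.
by rewrite E; apply: H.
Qed.

Lemma near0_normcP (P : set C) : (\forall y \near (0 : C), P y) <->
  exists2 r : R, 0 < r & forall x, N x < r -> P x.
Proof.
split=> [/near_normcP[r r0 H]|[r r0 H]].
  by exists r => // h /H; rewrite add0r.
by apply/near_normcP; exists r => // h hr; rewrite add0r; exact: H.
Qed.

Lemma dnear0_normcP (P : set C) : (\forall y \near (0 : C)^', P y) <->
  exists2 r : R, 0 < r & forall x, N x < r -> x != 0 -> P x.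
Proof.
split=> [/dnear_normcP[r r0 H]|[r r0 H]].
  by exists r => // h hr h0; have := H h hr h0; rewrite add0r.
by apply/dnear_normcP; exists r => // h hr h0; rewrite add0r; exact: H.
Qed.

Lemma nearC_all (P : set C) x : (forall y, P y) -> \forall y \near x, P y.
Proof. by move=> H; apply/near_normcP; exists 1. Qed.

Lemma nearC_imp (P Q : set C) x : (forall y, P y -> Q y) ->
  (\forall y \near x, P y) -> \forall y \near x, Q y.
Proof.
move=> PQ /near_normcP[r r0 H]; apply/near_normcP; exists r => // h hr.
exact/PQ/H.
Qed.

Lemma nearC_and (P Q : set C) x : (\forall y \near x, P y) ->
  (\forall y \near x, Q y) -> \forall y \near x, P y /\ Q y.
Proof.
move=> /near_normcP[r r0 H] /near_normcP[d d0 H']; apply/near_normcP.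
exists (Num.min r d) => [|h]; first by rewrite lt_min r0.
by rewrite lt_min => /andP[h1 h2]; split; [exact: H|exact: H'].
Qed.

Lemma continuous_normcP (f : C -> C) x : {for x, continuous f} <->
  forall e : R, 0 < e -> \forall y \near x, N (f y - f x) < e.
Proof.
split.
  move=> /cvgrPdist_lt H e e0; have e1 : 0 < e%:C by rewrite ltcR.
  have : \forall y \near x, `|f x - f y| < e%:C := H _ e1.
  move=> /near_normcP[r r0 H1]; apply/near_normcP; exists r => // h hr.
  by rewrite -ltcR -normcE -normrN opprB; exact: H1.
move=> H; apply/(@cvgrPdist_lt _ C _ (nbhs x) _ f) => e /gt0_complexP[r r0 ->].
have : \forall y \near x, N (f y - f x) < r := H r r0.
move=> /near_normcP[d d0 H1]; apply/near_normcP; exists d => // h hr.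
by rewrite -normrN opprB normcE ltcR; exact: H1.
Qed.

(** Clearing the denominator of the difference quotient removes the exclusion of [h = 0], so the
    chain rule needs no case distinction on vanishing increments. *)
Lemma is_derive_normcP f x a : is_derive x 1 f a <->
  forall e : R, 0 < e -> exists2 r : R, 0 < r &
    forall h, N h < r -> N (f (x + h) - f x - h * a) <= e * N h.
Proof.
have E h : h != 0 ->
   h^-1 *: (f (h *: 1 + x) - f x) - a = h^-1 * (f (x + h) - f x - h * a).
  by move=> h0; rewrite [RHS]mulrBr mulKf// /GRing.scale /= mulr1 [h + x]addrC.
split.
  move=> [fd fa] e e0.
  have : h^-1 *: (f (h *: 1 + x) - f x) @[h --> 0^'] --> a by rewrite -fa.
  move=> /cvgrPdist_lt H0; move: (H0 e%:C); rewrite ltcR => /(_ e0).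
  move=> /dnear_normcP[r r0 H]; exists r => // h hr.
  have [->|h0] := eqVneq h 0.
    by rewrite addr0 subrr mul0r subrr Normc.normc0 mulr0.
  have := H h hr h0; rewrite add0r -normrN opprB /= => /ltW H1.
  have : `|h^-1 *: (f (h *: 1 + x) - f x) - a| <= e%:C by exact: H1.
  rewrite E// normrM -ler_pdivlMl ?invr_gt0 ?normr_gt0 ?invr_eq0//.
  by rewrite normfV invrK [_ * e%:C]mulrC -lecR rmorphM.
move=> H.
suff h : h^-1 *: (f (h *: 1 + x) - f x) @[h --> 0^'] --> a.
  apply: DeriveDef; first by apply/cvg_ex; exists a.
  exact: cvg_lim h.
apply/cvgrPdist_lt => e /gt0_complexP[r r0 ->].
have [d d0 Hd] := H (r / 2) (divr_gt0 r0 (ltr0Sn _ 1)).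
apply/dnear_normcP; exists d => // h hd h0; rewrite add0r -normrN opprB.
suff : `|h^-1 *: (f (h *: 1 + x) - f x) - a| < r%:C by [].
rewrite E// normrM normfV -ltr_pdivlMl ?invr_gt0 ?normr_gt0 ?invr_eq0// invrK.
apply: (@le_lt_trans _ _ ((r / 2)%:C * `|h|)).
  by rewrite !normcE -rmorphM lecR; exact: Hd.
rewrite mulrC ltr_pM2l ?normr_gt0// ltcR; lra.
Qed.

Lemma is_derive_quadratic f x a (K r : R) : 0 < r ->
  (forall h, N h < r -> N (f (x + h) - f x - h * a) <= K * N h ^+ 2) ->
  is_derive x 1 f a.
Proof.
move=> r0 H; apply/is_derive_normcP => e e0.
have K1 : 0 < `|K| + 1 by rewrite ltr_wpDl.
exists (Num.min r (e / (`|K| + 1))); first by rewrite lt_min r0 divr_gt0.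
move=> h; rewrite lt_min => /andP[hr he]; apply: le_trans (H h hr) _.
rewrite expr2 mulrA ler_wpM2r ?normc_ge0//.
apply: (@le_trans _ _ ((`|K| + 1) * N h)).
  rewrite ler_wpM2r ?normc_ge0// (le_trans (ler_norm _))//; lra.
by rewrite mulrC -ler_pdivlMr// ltW.
Qed.

Lemma is_derive_compC f g x a b :
  is_derive (g x) 1 f a -> is_derive x 1 g b ->
  is_derive x 1 (fun t => f (g t)) (a * b).
Proof.
move=> /is_derive_normcP F /is_derive_normcP G; apply/is_derive_normcP => e e0.
have Na : 0 < N a + 1 by rewrite ltr_wpDl ?normc_ge0.
have Nb : 0 < N b + 1 by rewrite ltr_wpDl ?normc_ge0.
have [|r1 r10 H1] := F (e / 2 / (N b + 1)); first by rewrite !divr_gt0.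
(* The cap 1 bounds the increment [k] of [g] by [(N b + 1) * N h]; the other bound makes [a] times
   the remainder of [g] at most half of the allowed error. *)
have [|r2 r20 H2] := G (Num.min 1 (e / 2 / (N a + 1))).
  by rewrite lt_min ltr01 !divr_gt0.
exists (Num.min r2 (r1 / (N b + 1))) => [|h].
  by rewrite lt_min r20 divr_gt0.
rewrite lt_min ltr_pdivlMr// => /andP[h2 h1].
have nh := normc_ge0 h; have k2 := H2 h h2.
set k := g (x + h) - g x in k2; set m := Num.min _ _ in k2.
have m1 : m <= 1 by rewrite ge_min lexx.
have m2 : m <= e / 2 / (N a + 1) by rewrite ge_min lexx orbT.
have kb : N k <= (N b + 1) * N h.
  rewrite -[k](subrK (h * b)); apply: le_trans (ler_normcD _ _) _.
  rewrite Normc.normcM; apply: le_trans (lerD k2 (lexx _)) _.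
  rewrite mulrDl mul1r addrC [N h * _]mulrC lerD2l -[leRHS]mul1r.
  exact: ler_wpM2r.
have k1 := H1 k (le_lt_trans kb _).
rewrite (_ : f (g (x + h)) - _ - _ =
    (f (g x + k) - f (g x) - k * a) + a * (k - h * b)); last first.
  by rewrite /k [g x + _]addrC subrK; ring.
apply: le_trans (ler_normcD _ _) _; rewrite Normc.normcM [leRHS](_ : _ = e / 2 * N h + e / 2 * N h); last by field.
apply: lerD.
  apply: le_trans (k1 _) _; first by rewrite mulrC.
  by rewrite -[_ / (N b + 1) * _]mulrA ler_pM2l ?divr_gt0// ler_pdivrMl.
apply: (@le_trans _ _ (N a * (m * N h))); first exact: ler_wpM2l (normc_ge0 _) _ _ k2.
rewrite mulrA ler_wpM2r//.
apply: (@le_trans _ _ ((N a + 1) * m)).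
  by rewrite ler_wpM2r ?lerDl// le_min ler01/= ltW// !divr_gt0.
by rewrite -ler_pdivlMl// mulrC.
Qed.

Lemma is_deriveVC f x a : f x != 0 -> is_derive x 1 f a ->
  is_derive x 1 (fun t => (f t)^-1) (- a / f x ^+ 2).
Proof.
move=> fx0 [df <-]; apply: DeriveDef; first exact: derivableV.
by rewrite deriveV// /GRing.scale /= mulNr mulNr mulrC.
Qed.

Lemma is_deriveMC f g x a b : is_derive x 1 f a -> is_derive x 1 g b ->
  is_derive x 1 (fun t => f t * g t) (f x * b + a * g x).
Proof. by move=> fa gb; rewrite [a * _]mulrC; exact: (is_deriveM fa gb). Qed.

Lemma is_derive_near f g x a : (\forall y \near x, f y = g y) ->
  is_derive x 1 f a -> is_derive x 1 g a.
Proof.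
move=> fg /is_derive_normcP H; apply/is_derive_normcP => e e0.
have [r r0 Hr] := H e e0; have /near_normcP[d d0 Hd] := fg.
exists (Num.min r d) => [|h]; first by rewrite lt_min r0.
rewrite lt_min => /andP[hr hd]; rewrite -Hd// -[X in _ - g X - _]addr0 -Hd ?addr0//.
  exact: Hr.
by rewrite Normc.normc0.
Qed.

Lemma is_derive_derive1 f x a : is_derive x 1 f a -> derive1 f x = a.
Proof. by move=> [_ <-]; rewrite derive1E. Qed.

Lemma is_derive_cont f x a : is_derive x 1 f a -> {for x, continuous f}.
Proof.
by move=> [h _]; apply: differentiable_continuous; apply/derivable1_diffP.
Qed.

Lemma derivable_derive1 f x : derivable f x 1 -> is_derive x 1 f (derive1 f x).
Proof. by move=> h; rewrite derive1E; exact: derivableP. Qed.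

Lemma near_nearby (P : set C) x : (\forall y \near x, P y) ->
  \forall y \near x, \forall z \near y, P z.
Proof. by move=> /nbhs_interior. Qed.

End ComplexBasics.

(** * The complex exponential *)

Section ComplexExp.
Variable R : realType.
Local Notation C := R[i].
Local Notation N := (@Normc.normc R).
Implicit Types (x y z w c : C).

Lemma half_mulr2n (t : R) : t / 2 *+ 2 = t.
Proof. by rewrite -mulr_natr divfK. Qed.

Lemma cexpD z w : cexp (z + w) = cexp z * cexp w.
Proof.
case: z w => a b [a' b']; rewrite /cexp /= expRD cosD sinD.
by apply/eqP; rewrite eq_complex /=; apply/andP; split; apply/eqP; ring.
Qed.

Lemma cexp0 : cexp (0 : C) = 1.
Proof. by rewrite /cexp /= expR0 cos0 sin0 mulr0 mulr1. Qed.

Lemma normc_cexp z : N (cexp z) = expR (complex.Re z).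
Proof.
rewrite /cexp /= !exprMn -mulrDr cos2Dsin2 mulr1 sqrtr_sqr ger0_norm//.
Qed.

Lemma cexp_neq0 z : cexp z != 0.
Proof. by rewrite -normc_gt0 normc_cexp expR_gt0. Qed.

Lemma cexpN z : cexp (- z) = (cexp z)^-1.
Proof.
apply: (mulfI (cexp_neq0 z)).
by rewrite divff ?cexp_neq0// -cexpD subrr cexp0.
Qed.

Lemma cexpB z w : cexp (z - w) = cexp z / cexp w.
Proof. by rewrite cexpD cexpN. Qed.

Lemma norm_sinDpi (t : R) (n : int) : `|sin (t + n%:~R * pi)| = `|sin t|.
Proof.
have P (u : R) (k : nat) : `|sin (u + k%:R * pi)| = `|sin u|.
  elim: k => [|k IH]; first by rewrite mul0r addr0.
  by rewrite -natr1 mulrDl mul1r addrA sinDpi normrN.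
case: n => k; first exact: P.
by rewrite NegzE mulrNz mulNr -(P _ k.+1) subrK.
Qed.

(** Removing [floor (t / pi)] multiples of [pi] brings [t] into [0, pi), where the sine is positive
    except at 0. *)
Lemma sin_eq0_pi (t : R) : sin t = 0 -> exists n : int, t = n%:~R * pi.
Proof.
move=> st; have pi0 := pi_gt0 R; set n := Num.Def.floor (t / pi); exists n.
have /andP[n1 n2] := floor_itv (t / pi); rewrite -/n in n1 n2.
apply/eqP; rewrite -subr_eq0.
have := norm_sinDpi t (- n); rewrite mulrNz mulNr st normr0 => /eqP.
rewrite normr_eq0 => /eqP s0; set u := t - _ in s0 *.
apply/negPn/negP => u0; have : 0 < sin u.
  apply: sin_gt0_pi; rewrite lt_def u0 /u subr_ge0 ltrBlDl.
  rewrite -ler_pdivlMr// n1 /= -[X in _ + X]mul1r -mulrDl.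
  by rewrite -ltr_pdivrMr// -intrD1.
by rewrite s0 ltxx.
Qed.

Lemma cexp_eq1 z : cexp z = 1 -> exists n : int, z = 0 +i* (n%:~R * pi *+ 2).
Proof.
case: z => a b ez; have /eqP := congr1 N ez.
rewrite normc_cexp Normc.normc1 /= => /eqP /(congr1 (@ln R)).
rewrite expRK ln1 => a0.
move: ez; rewrite /cexp a0 /= expR0 !mul1r => -[cb _].
(* Halving the angle turns cos b = 1 into sin (b / 2) = 0, and so yields multiples of 2 pi rather
   than of pi. *)
have [|n bn] := @sin_eq0_pi (b / 2).
  have := cos_mulr2n (b / 2); have := cos2Dsin2 (b / 2).
  rewrite half_mulr2n cb => h1 h2; apply/eqP.
  by rewrite -sqrf_eq0; apply/eqP; lra.
by exists n; congr (_ +i* _); rewrite -bn half_mulr2n.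
Qed.

(** Two uses of the mean value theorem: the second one has derivative cos c - 1 = -2 sin(c/2)^2,
    which the first bound controls. *)
Lemma norm_sinB_le (t : R) : 0 <= t -> `|sin t| <= t /\ `|sin t - t| <= t ^+ 3.
Proof.
move=> t0.
have H (u : R) : 0 <= u -> `|sin u| <= u.
  move=> u0.
  have HC : {within `[0, u], continuous (@sin R)}.
    by apply: continuous_subspaceT => x; exact: continuous_sin.
  have [c _] := @MVT_segment R sin cos 0 u u0 (fun (x : R) _ => is_derive_sin x) HC.
  rewrite sin0 !subr0 => ->.
  by rewrite normrM (ger0_norm u0) ler_piMl// cos_max.
split; first exact: H.
have HC : {within `[0, t], continuous (fun x : R => sin x - x)}.
  apply: continuous_subspaceT => x; apply: continuousB => //.
  exact: continuous_sin.
have HD (x : R) : x \in `]0, t[ -> is_derive x 1 (fun x : R => sin x - x) (cos x - 1).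
  by move=> _; apply: is_deriveB.
have [c] := @MVT_segment R (fun x : R => sin x - x) (fun x : R => cos x - 1) 0 t t0 HD HC.
rewrite in_itv /= => /andP[c0 ct]; rewrite sin0 !subr0 => ->.
rewrite normrM (ger0_norm t0) exprSr ler_wpM2r//.
have h2 : c = (c / 2) *+ 2 by rewrite half_mulr2n.
have := H (c / 2) (divr_ge0 c0 (ler0n _ 2)); set s := sin _ => Hs.
have -> : cos c - 1 = - (s ^+ 2 *+ 2).
  rewrite [in LHS]h2 cos_mulr2n; have := cos2Dsin2 (c / 2); rewrite -/s => ?; lra.
rewrite normrN normrMn normrX.
have : `|s| ^+ 2 <= (c / 2) ^+ 2 by rewrite lerXn2r ?nnegrE// divr_ge0.
have : c ^+ 2 <= t ^+ 2 by rewrite lerXn2r ?nnegrE.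
have := sqr_ge0 c; rewrite expr_div_n; lra.
Qed.

Lemma norm_sin_le (t : R) : `|t| <= 1 ->
  [/\ `|sin t| <= `|t|, `|sin t - t| <= `|t| ^+ 2 & `|cos t - 1| <= `|t| ^+ 2].
Proof.
move=> t1.
have [s1 s2] : `|sin t| <= `|t| /\ `|sin t - t| <= `|t| ^+ 3.
  have [t0|t0] := leP 0 t; first by rewrite (ger0_norm t0); apply: norm_sinB_le.
  have := @norm_sinB_le (- t); rewrite oppr_ge0 sinN (ltW t0) opprK => /(_ isT).
  rewrite (ltr0_norm t0) normrN -[X in _ /\ X <= _ -> _]normrN.
  by rewrite opprD !opprK.
split => //.
  by apply: le_trans s2 _; rewrite exprS ler_piMl ?exprn_ge0.
have := cos_mulr2n (t / 2); rewrite half_mulr2n => ->.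
have [+ _] : `|sin (t / 2)| <= `|t / 2| /\ True.
  split => //; have [t0|t0] := leP 0 t.
    rewrite (ger0_norm (divr_ge0 t0 _))//; apply: (norm_sinB_le _).1.
    by rewrite divr_ge0.
  have := @norm_sinB_le (- (t / 2)); rewrite sinN normrN.
  rewrite oppr_ge0 pmulr_lle0// (ltW t0) => /(_ isT)[+ _].
  by rewrite (ltr0_norm (_ : t / 2 < 0))// pmulr_llt0.
move=> h; have := cos2Dsin2 (t / 2); set s := sin _ in h *; set d := cos _ => e.
have -> : d ^+ 2 *+ 2 - 1 - 1 = - (s ^+ 2 *+ 2) by lra.
rewrite normrN normrMn normrX.
have : `|s| ^+ 2 <= `|t / 2| ^+ 2 by rewrite lerXn2r ?nnegrE.
have -> : `|t / 2| ^+ 2 = `|t| ^+ 2 / 4.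
  by rewrite normf_div (@ger0_norm _ 2)//; field.
have := sqr_ge0 `|t|; lra.
Qed.

Lemma expR_quadratic (t : R) : `|t| <= 1 / 2 ->
  [/\ expR t <= 2, `|expR t - 1 - t| <= 2 * `|t| ^+ 2 & `|expR t - 1| <= 2 * `|t|].
Proof.
move=> ht; have := ht; rewrite ler_norml => /andP[t1 t2].
have e1 := expR_ge1Dx t; have e2 := expR_ge1Dx (- t).
have e0 := expR_gt0 t.
have e3 : expR t * (1 - t) <= 1.
  by rewrite -ler_pdivlMl// mulr1 -expRN.
have h2 : expR t <= 2.
  have : expR t * (1 / 2) <= expR t * (1 - t) by rewrite ler_pM2l//; lra.
  lra.
have q : `|expR t - 1 - t| <= 2 * `|t| ^+ 2.
  rewrite real_normK ?num_real// ger0_norm; last lra.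
  have := sqr_ge0 t; nra.
split => //; rewrite -[expR t - 1](subrK t); apply: le_trans (ler_normD _ _) _.
apply: le_trans (lerD q (lexx _)) _; have := normr_ge0 t; nra.
Qed.

(** The constant 20 is generous; the number 40 in the derivative of the logarithm is chosen against
    it. *)
Lemma cexp_quadratic z : N z < 1 / 2 -> N (cexp z - 1 - z) <= 20 * N z ^+ 2.
Proof.
move=> h; apply: le_trans (normc_ReIm _) _.
have := Re_normc z; have := Im_normc z; have := normc_ge0 z.
move: (N z) h => n h n0; case: z => a b /= hb ha.
have [|E1 E2 E3] := @expR_quadratic a; first lra.
have [|S1 S2 S3] := @norm_sin_le b; first lra.
have a0 := normr_ge0 a; have b0 := normr_ge0 b.
have a2 : `|a| ^+ 2 <= n ^+ 2 by rewrite lerXn2r ?nnegrE.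
have b2 : `|b| ^+ 2 <= n ^+ 2 by rewrite lerXn2r ?nnegrE.
have ab : `|a| * `|b| <= n ^+ 2 by rewrite expr2 ler_pM.
rewrite (_ : _ - 1 - a = expR a * (cos b - 1) + (expR a - 1 - a)); last by ring.
rewrite (_ : _ - 0 - b = (expR a - 1) * sin b + (sin b - b)); last by ring.
have := ler_normD (expR a * (cos b - 1)) (expR a - 1 - a).
have := ler_normD ((expR a - 1) * sin b) (sin b - b).
rewrite !normrM (ger0_norm (expR_ge0 a)).
have : expR a * `|cos b - 1| <= 2 * n ^+ 2.
  by rewrite ler_pM ?expR_ge0//; apply: le_trans S3 b2.
have : `|expR a - 1| * `|sin b| <= 2 * `|a| * `|b| by rewrite ler_pM.
rewrite -mulrA; have := sqr_ge0 n; lra.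
Qed.

Lemma is_derive_cexp z : is_derive z 1 (@cexp R) (cexp z).
Proof.
apply: (@is_derive_quadratic _ _ _ _ (20 * N (cexp z)) (1 / 2)) => // h hh.
rewrite cexpD (_ : _ - _ - _ = cexp z * (cexp h - 1 - h)); last by ring.
by rewrite Normc.normcM mulrAC mulrC ler_wpM2r ?normc_ge0// cexp_quadratic.
Qed.

End ComplexExp.

(** * The principal logarithm and powers on the slit plane *)

Section ComplexLog.
Variable R : realType.
Local Notation C := R[i].
Local Notation N := (@Normc.normc R).
Implicit Types (x y z w c : C).

(** Written with the order of [R[i]] so that it is literally the condition off the branch cut in
    [local_solution]. *)
Definition slit w : bool := ~~ (w <= 0).

(** The right-hand side is the denominator in the half-angle formula of [carg]; being a strict
    inequality between continuous functions, it also shows that the slit plane is open. *)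
Lemma slitE w : slit w = (0 < N w + complex.Re w).
Proof.
case: w => a b; rewrite /slit lecE /= negb_and -ltNge.
have := Re_normc (a +i* b); rewrite /= ler_norml => /andP[h _].
have [->|b0] := eqVneq b 0.
  rewrite /= expr0n addr0 sqrtr_sqr; case: ltrP => a0.
    by rewrite (gtr0_norm a0) addr_gt0.
  by rewrite (ler0_norm a0) addNr ltxx.
rewrite /=; apply/esym; rewrite -ltrBlDr sub0r lt_neqAle.
rewrite lerNl h andbT; apply/eqP => e.
have := congr1 (fun x : R => x ^+ 2) e; rewrite sqr_sqrtr ?addr_ge0 ?sqr_ge0//.
rewrite sqrrN => /eqP; rewrite eq_sym addrC -subr_eq0 addrK.
by rewrite sqrf_eq0 (negPf b0).
Qed.

Lemma slit_neq0 w : slit w -> w != 0.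
Proof. by apply: contraNneq => ->. Qed.

Lemma cargE w : slit w ->
  carg w = 2 * atan (complex.Im w / (N w + complex.Re w)).
Proof. by rewrite /slit /carg => h; case: ifP => // /ltW; rewrite (negPf h). Qed.

Lemma cexp_clog w : slit w -> cexp (clog w) = w.
Proof.
move=> sw; rewrite /cexp /clog /= cargE//.
have n0 : 0 < N w by rewrite normc_gt0 slit_neq0.
rewrite lnK ?posrE//; move: sw; rewrite slitE.
have e2 : N w ^+ 2 = complex.Re w ^+ 2 + complex.Im w ^+ 2.
  by case: (w) => a b /=; rewrite sqr_sqrtr// addr_ge0 ?sqr_ge0.
move: (N w) n0 e2; case: w => a b /= n n0 e2 na.
(* [t] is the tangent of half the argument; the double-angle formulas turn it back into a / n and b
   / n. *)
set t := b / (n + a).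
have ct : cos (atan t) ^+ 2 = (1 + t ^+ 2)^-1.
  by rewrite cos_atan exprVn sqr_sqrtr// addr_ge0 ?sqr_ge0.
have t1 : 1 + t ^+ 2 != 0 by rewrite gt_eqF// ltr_wpDr ?sqr_ge0.
have c0 : cos (atan t) != 0 by rewrite -sqrf_eq0 ct invr_eq0.
have st : sin (atan t) = t * cos (atan t).
  by rewrite -[X in X * _](atanK t) /tan divfK.
have -> : 2 * atan t = atan t *+ 2 by rewrite mulr_natl.
rewrite cos_mulr2n sin_mulr2n st mulrCA -expr2 ct.
have h1 : 1 + t ^+ 2 = 2 * n / (n + a).
  have hb : b ^+ 2 = n ^+ 2 - a ^+ 2 by rewrite e2; ring.
  by rewrite /t expr_div_n hb; field; rewrite gt_eqF.
have na0 : n + a != 0 by rewrite gt_eqF.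
have nn0 : n != 0 by rewrite gt_eqF.
rewrite h1 /t; congr (_ +i* _).
  field; by rewrite ?na0 ?nn0.
field; by rewrite ?na0 ?nn0.
Qed.

Lemma lipschitz_continuous (f : C -> R) w :
  (forall y, `|f y - f w| <= N (y - w)) -> {for w, continuous f}.
Proof.
move=> H; apply/(@cvgrPdist_lt _ _ _ (nbhs w) _ f) => e e0.
apply/near_normcP; exists e => // h he; rewrite -normrN opprB.
by apply: le_lt_trans (H _) _; rewrite addrAC subrr add0r.
Qed.

Lemma continuous_normc w : {for w, continuous N}.
Proof.
apply: lipschitz_continuous => y; rewrite ler_norml; apply/andP; split.
  have := ler_normcD y (w - y).
  by rewrite (addrC y) subrK -(normcNr (w - y)) opprB; lra.
by have := ler_normcD (y - w) w; rewrite subrK; lra.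
Qed.

Lemma continuous_Re w : {for w, continuous (@complex.Re R)}.
Proof.
by apply: lipschitz_continuous => y; rewrite -raddfB /=; exact: Re_normc.
Qed.

Lemma continuous_Im w : {for w, continuous (@complex.Im R)}.
Proof.
by apply: lipschitz_continuous => y; rewrite -raddfB /=; exact: Im_normc.
Qed.

Lemma slit_near w : slit w -> \forall y \near w, slit y.
Proof.
rewrite slitE => sw.
have : {for w, continuous (fun y => N y + complex.Re y)}.
  by apply: continuousD; [exact: continuous_normc|exact: continuous_Re].
move=> /(_ _ (lt_nbhsr sw)); rewrite /= => /near_normcP[r r0 H].
by apply/near_normcP; exists r => // h hr; rewrite slitE; exact: H.
Qed.

Lemma continuous_clog w : slit w -> {for w, continuous (@clog R)}.
Proof.
move=> sw; apply/continuous_normcP => e e0.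
have n0 : 0 < N w by rewrite normc_gt0 slit_neq0.
have sw' := sw; rewrite slitE in sw'.
have c1 : {for w, continuous (fun y => ln (N y))}.
  apply: continuous_comp; first exact: continuous_normc.
  exact: continuous_ln.
have c2 : {for w, continuous (fun y => 2 * atan (complex.Im y / (N y + complex.Re y)))}.
  apply: continuousM; first exact: cst_continuous.
  apply: continuous_comp; last exact: continuous_atan.
  apply: continuousM; first exact: continuous_Im.
  apply: continuousV; first by rewrite gt_eqF.
  by apply: continuousD; [exact: continuous_normc|exact: continuous_Re].
have e2 : 0 < e / 2 by rewrite divr_gt0.
have : \forall y \near w, `|ln (N w) - ln (N y)| < e / 2.
  exact: (@cvgrPdist_lt _ _ _ (nbhs w) _ _ _).1 c1 _ e2.
move=> /near_normcP[r1 r10 H1].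
have : \forall y \near w, `|2 * atan (complex.Im w / (N w + complex.Re w)) -
    2 * atan (complex.Im y / (N y + complex.Re y))| < e / 2.
  exact: (@cvgrPdist_lt _ _ _ (nbhs w) _ _ _).1 c2 _ e2.
move=> /near_normcP[r2 r20 H2].
have /near_normcP[r3 r30 H3] := slit_near sw.
apply/near_normcP; exists (Num.min r1 (Num.min r2 r3)).
  by rewrite !lt_min r10 r20.
move=> h; rewrite !lt_min => /and3P[h1 h2 h3].
apply: le_lt_trans (normc_ReIm _) _; rewrite !raddfB /= !cargE ?H3//.
have := H1 h h1; have := H2 h h2; rewrite /= -normrN opprB => ?.
rewrite -normrN opprB; lra.
Qed.

Lemma is_derive_clog w : slit w -> is_derive w 1 (@clog R) w^-1.
Proof.
move=> sw; have w0 := slit_neq0 sw; apply/is_derive_normcP => e e0.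
have nw : 0 < N w by rewrite normc_gt0.
(* With [k] the increment of the logarithm, [h / w] is exp k - 1. The bound 1/40 makes 20 |k|^2 at
   most |k| / 2, so that |k| is at most 2 |exp k - 1|; the bound [e * N w / 40] then makes the
   remainder at most [e * N h]. *)
pose d := Num.min (1 / 40) (e * N w / 40).
have d0 : 0 < d by rewrite lt_min !divr_gt0 ?mulr_gt0.
have /continuous_normcP/(_ d d0)/near_normcP[r1 r10 H1] := continuous_clog sw.
have /near_normcP[r2 r20 H2] := slit_near sw.
exists (Num.min r1 r2) => [|h]; first by rewrite lt_min r10.
rewrite lt_min => /andP[h1 h2].
set k := clog (w + h) - clog w.
have hk : h = w * (cexp k - 1).
  rewrite mulrBr mulr1 /k cexpB !cexp_clog ?H2//; field; exact: w0.
have kd : N k < d := H1 _ h1.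
have k1 : N k < 1 / 40 by apply: lt_le_trans kd _; rewrite ge_min lexx.
have k2 : N k <= e * N w / 40.
  by apply: ltW; apply: lt_le_trans kd _; rewrite ge_min lexx orbT.
have Q := @cexp_quadratic R k (lt_trans k1 _).
have {}Q : N (cexp k - 1 - k) <= 20 * N k ^+ 2 by apply: Q; lra.
have kn := normc_ge0 k.
have k3 : N k <= 2 * N (cexp k - 1).
  have := normcDl k (cexp k - 1 - k); rewrite (addrC k) subrK => ?.
  have : 20 * N k ^+ 2 <= N k / 2 by nra.
  lra.
rewrite {1}hk (_ : _ - _ = k - (cexp k - 1)); last by rewrite /k; field.
rewrite -normcNr opprB; apply: le_trans Q _.
rewrite hk Normc.normcM.
have : 20 * N k ^+ 2 <= 20 * (e * N w / 40) * N k by rewrite expr2 mulrA ler_wpM2r// ler_pM2l.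
move=> h3; apply: le_trans h3 _.
have : e * N w / 2 * N k <= e * N w / 2 * (2 * N (cexp k - 1)).
  by rewrite ler_wpM2l// divr_ge0// mulr_ge0// ltW.
lra.
Qed.

Lemma is_derive_cpow w c : slit w ->
  is_derive w 1 (fun z => cpow z c) (c / w * cpow w c).
Proof.
move=> sw; rewrite /cpow mulrC.
apply: (@is_derive_compC _ (@cexp R) (fun z => c * clog z)).
  exact: is_derive_cexp.
have := is_deriveZ c (is_derive_clog sw); apply.
Qed.

Lemma cpow_neq0 w c : cpow w c != 0.
Proof. exact: cexp_neq0. Qed.

Lemma cpow0r w : cpow w 0 = 1.
Proof. by rewrite /cpow mul0r cexp0. Qed.

Lemma clog1 : clog (1 : C) = 0.
Proof.
rewrite /clog Normc.normc1 ln1 cargE ?slitE ?Normc.normc1 ?addr_gt0//=.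
by rewrite mul0r atan0 mulr0.
Qed.

Lemma cpow1 c : cpow 1 c = 1.
Proof. by rewrite /cpow clog1 mulr0 cexp0. Qed.

Lemma slit1 : slit (1 : C).
Proof. by rewrite slitE Normc.normc1 addr_gt0. Qed.

End ComplexLog.

(** * Functions with zero derivative along a segment *)

Section SegmentConst.
Variable R : realType.
Local Notation C := R[i].
Local Notation N := (@Normc.normc R).
Implicit Types (x y z w : C) (f : C -> C).

Lemma is_derive0_real (g : R -> R) (t : R) :
  (forall e : R, 0 < e -> exists2 r : R, 0 < r &
    forall h, `|h| < r -> `|g (t + h) - g t| <= e * `|h|) ->
  is_derive t 1 g 0.
Proof.
move=> H.
suff h : h^-1 *: (g (h *: 1 + t) - g t) @[h --> 0^'] --> (0 : R).
  apply: DeriveDef; first by apply/cvg_ex; exists 0.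
  exact: cvg_lim h.
apply/(@cvgrPdist_lt _ R^o) => e e0.
have [d d0 Hd] := H (e / 2) (divr_gt0 e0 (ltr0Sn _ 1)).
rewrite /dnbhs near_withinE; apply/nbhs_ballP; exists d => // h /=.
rewrite /ball /= sub0r normrN => hd h0; rewrite sub0r normrN.
rewrite /GRing.scale /= mulr1 normrM normfV.
rewrite -ltr_pdivlMl ?invr_gt0 ?normr_gt0// invrK.
rewrite [h + t]addrC; apply: le_lt_trans (Hd h hd) _.
rewrite mulrC ltr_pM2l ?normr_gt0//; lra.
Qed.

(** The mean value theorem is about real functions, so it is applied after a 1-Lipschitz map [L],
    later the real and the imaginary part; the zero derivative survives because [L] does not enlarge
    increments. *)
Lemma segment_const_aux f (L : C -> R) x y :
  (forall z w, `|L z - L w| <= N (z - w)) ->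
  (forall t : R, 0 < t < 1 -> is_derive (x + t%:C * (y - x)) 1 f 0) ->
  {for x, continuous f} -> {for y, continuous f} -> L (f x) = L (f y).
Proof.
move=> HL Hd cx cy.
pose p (t : R) := x + t%:C * (y - x); pose g t := L (f (p t)).
have pB (s t : R) : p s = p t + (s - t)%:C * (y - x).
  by rewrite /p rmorphB /=; ring.
have D0 : 0 < N (y - x) + 1 by rewrite ltr_wpDl ?normc_ge0.
have gc (t : R) : {for p t, continuous f} -> {for t, continuous g}.
  move=> /continuous_normcP H; apply/(@cvgrPdist_lt _ R^o) => e e0.
  have /near_normcP[r r0 Hr] := H e e0.
  apply/nbhs_ballP; exists (r / (N (y - x) + 1)); first by rewrite /= divr_gt0.
  move=> s; rewrite /ball /= distrC ltr_pdivlMr// => hs.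
  rewrite distrC; apply: le_lt_trans (HL _ _) _; rewrite (pB s t); apply: Hr.
  rewrite Normc.normcM normc_real; apply: le_lt_trans hs.
  by rewrite ler_wpM2l// lerDl.
have gd (t : R) : t \in `]0, 1[%R -> is_derive t 1 g 0.
  rewrite in_itv /= => /Hd /is_derive_normcP H.
  apply: is_derive0_real => e e0.
  have [|r r0 Hr] := H (e / (N (y - x) + 1)); first by rewrite divr_gt0.
  exists (r / (N (y - x) + 1)); first by rewrite divr_gt0.
  move=> h; rewrite ltr_pdivlMr// => hh.
  apply: le_trans (HL _ _) _; rewrite (pB (t + h) t) [t + h]addrC addrK.
  have := Hr (h%:C * (y - x)); rewrite mulr0 subr0 Normc.normcM normc_real.
  move=> /(_ (le_lt_trans _ hh)) => H1; apply: le_trans (H1 _) _.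
    by rewrite ler_wpM2l// lerDl.
  rewrite mulrCA mulrC ler_wpM2r// -mulrA ler_piMr ?ltW//.
  by rewrite mulrC ltr_pdivrMr// mul1r ltrDl.
have gcc : {within `[0, 1], continuous g}.
  apply: continuous_in_subspaceT => t; rewrite inE /= in_itv /= => /andP[t0 t1].
  apply: gc; have [->|tn0] := eqVneq t 0; first by rewrite /p mul0r addr0; exact: cx.
  have [->|tn1] := eqVneq t 1; first by rewrite /p mul1r addrC subrK; exact: cy.
  by apply: is_derive_cont (Hd t _); rewrite lt_neqAle eq_sym tn0 t0 lt_neqAle tn1.
have [c _] := MVT_segment (ler01 : (0 : R) <= 1) gd gcc.
rewrite mul0r /g /p mul0r addr0 mul1r addrC => /eqP.
by rewrite (addrC x) subrK addrC subr_eq0 => /eqP.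
Qed.

(** Only continuity is asked at the endpoints, since one of them will be the singular point 0. *)
Lemma segment_const f x y :
  (forall t : R, 0 < t < 1 -> is_derive (x + t%:C * (y - x)) 1 f 0) ->
  {for x, continuous f} -> {for y, continuous f} -> f x = f y.
Proof.
move=> H cx cy; apply/eqP; rewrite eq_complex; apply/andP; split; apply/eqP.
  by apply: segment_const_aux cx cy => // z w; rewrite -raddfB; exact: Re_normc.
by apply: segment_const_aux cx cy => // z w; rewrite -raddfB; exact: Im_normc.
Qed.

End SegmentConst.

(** * Uniqueness and existence of the local Heun function *)

Section HlUnique.
Variable R : realType.
Local Notation C := R[i].
Local Notation N := (@Normc.normc R).
Implicit Types (p : heun R) (x y z w : C) (u : C -> C).

Lemma slit_1B z : N z < 1 -> slit (1 - z).
Proof.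
move=> z1; rewrite slitE; apply: ltr_wpDl; first exact: normc_ge0.
rewrite raddfB /= subr_gt0; apply: le_lt_trans z1.
by apply: le_trans (Re_normc z); exact: ler_norm.
Qed.

Lemma is_derive_affine (m n x : C) : is_derive x 1 (fun z => m * z + n) m.
Proof.
apply: (@is_derive_quadratic _ _ _ _ 0 1) => // h _.
by rewrite (_ : _ - _ - _ = 0) ?Normc.normc0 ?mul0r//; ring.
Qed.

Lemma is_derive_affine_eq (f : C -> C) (m n x : C) :
  (forall z, f z = m * z + n) -> is_derive x 1 f m.
Proof. by move=> h; rewrite (_ : f = (fun z => m * z + n)); [exact: is_derive_affine|apply/funext]. Qed.

Lemma eq_is_derive (f : C -> C) (x a b : C) :
  a = b -> is_derive x 1 f a -> is_derive x 1 f b.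
Proof. by move=> ->. Qed.

Lemma is_deriveBC (f g : C -> C) x a b : is_derive x 1 f a ->
  is_derive x 1 g b -> is_derive x 1 (fun t => f t - g t) (a - b).
Proof. exact: is_deriveB. Qed.

Lemma solve_leading (u2 u1 u0 P Q : C) :
  u2 + P * u1 + Q * u0 = 0 -> u2 = - P * u1 - Q * u0.
Proof.
by move=> h; apply/eqP; rewrite -subr_eq0; apply/eqP; rewrite -[RHS]h; ring.
Qed.

Definition heun_P p x : C :=
  he_gamma p / x + he_delta p / (x - 1) + he_epsilon p / (x - he_a p).

Definition heun_Q p x : C :=
  (he_alpha p * he_beta p * x - he_q p) / (x * (x - 1) * (x - he_a p)).

Definition solution p (u v w : C -> C) x : Prop :=
  [/\ is_derive x 1 u (v x), is_derive x 1 v (w x) &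
      w x + heun_P p x * v x + heun_Q p x * u x = 0].

Lemma solves_at_solution p u x :
  solves_at p u x -> solution p u (derive1 u) (derive1 (derive1 u)) x.
Proof.
by move=> [d1 d2 e]; split; [exact: derivable_derive1|exact: derivable_derive1|exact: e].
Qed.

Lemma solution_solves_at p (u v : C -> C) (w : C) x :
  (\forall y \near x, is_derive (y : C) 1 u (v y)) -> is_derive x 1 v w ->
  w + heun_P p x * v x + heun_Q p x * u x = 0 -> solves_at p u x.
Proof.
move=> H dv e.
have du := nbhs_singleton H.
have E : \forall y \near x, v y = derive1 u y.
  by apply: filterS H => y h; rewrite (is_derive_derive1 h).
have dv' := is_derive_near E dv.
split; [by case: du|by case: dv'|].
by rewrite (is_derive_derive1 dv') (is_derive_derive1 du); exact: e.
Qed.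

(* V = W (1 - x)^delta (1 - x/a)^epsilon, with W the Wronskian, satisfies
   x V' = - gamma V, so V (x e^z) e^(gamma z) is constant in z; comparing z = 0
   with z = 2 pi i gives V = 0, as gamma is not an integer. *)
Lemma Hl_unique_aux p (u1 v1 w1 u2 v2 w2 : C -> C) (r1 r2 s1 s2 : R) :
  (forall n : int, 1 - he_gamma p != n%:~R) -> he_a p != 0 ->
  0 < r1 -> 0 < s1 -> 0 < r2 -> 0 < s2 -> u1 0 = 1 -> u2 0 = 1 ->
  (forall x, N x < r1 -> is_derive x 1 u1 (v1 x)) ->
  (forall x, N x < s1 -> x != 0 -> solution p u1 v1 w1 x) ->
  (forall x, N x < r2 -> is_derive x 1 u2 (v2 x)) ->
  (forall x, N x < s2 -> x != 0 -> solution p u2 v2 w2 x) ->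
  \forall x \near (0 : C), u1 x = u2 x.
Proof.
case: p => a q al be ga de; set p := Heun _ _ _ _ _ _ => /= gint a0.
set ep := he_epsilon p; move=> r10 s10 r20 s20 u10 u20 D1 S1 D2 S2.
have c1 : {for 0, continuous u1}.
  apply: is_derive_cont (D1 0 _).
  by rewrite Normc.normc0.
have /continuous_normcP/(_ 1 ltr01)/near0_normcP[r3 r30 U1] := c1.
have na : 0 < N a by rewrite normc_gt0.
(* [r3] keeps [u1] away from 0; the radii 1 and [N a] keep 1 - x and 1 - x / a in the slit plane. *)
pose r := Num.min r1 (Num.min s1 (Num.min r2 (Num.min s2 (Num.min r3 (Num.min 1 (N a)))))).
have r0 : 0 < r by rewrite !lt_min r10 s10 r20 s20 r30 ltr01 na.
have rP x : N x < r -> [/\ is_derive x 1 u1 (v1 x), is_derive x 1 u2 (v2 x), u1 x != 0,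
     N x < 1 & N x < N a] /\ (x != 0 -> solution p u1 v1 w1 x /\ solution p u2 v2 w2 x).
  rewrite !lt_min => /and5P[h1 h2 h3 h4 /and3P[h5 h6 h7]].
  have := U1 x h5; rewrite u10 => ux; split; last first.
    by move=> x0; split; [exact: S1|exact: S2].
  split; [exact: D1|exact: D2| |exact: h6|exact: h7].
  by apply: contraTneq ux => ->; rewrite sub0r normcNr Normc.normc1 ltxx.
pose W x := u1 x * v2 x - v1 x * u2 x.
pose E x := cpow (1 - x) de * cpow (1 - x / a) ep.
pose V x := W x * E x.
have E0 x : E x != 0 by rewrite mulf_neq0 ?cpow_neq0.
have dV x : N x < r -> x != 0 -> is_derive x 1 V (- ga / x * V x).
  move=> xr x0; have [[d1 d2 _ x1 xa] /(_ x0)[[_ dd1 e1] [_ dd2 e2]]] := rP x xr.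
  have xa1 : N (x / a) < 1 by rewrite Normc.normcM Normc.normcV ltr_pdivrMr ?mul1r.
  have sl1 := slit_1B x1; have sl2 := slit_1B xa1.
  have y1 := slit_neq0 sl1; have y2 := slit_neq0 sl2.
  have x1' : x - 1 != 0 by rewrite -opprB oppr_eq0.
  have xa' : x - a != 0.
    by apply: contraNneq y2 => h; rewrite (subr0_eq h) divff// subrr.
  have A1 : is_derive x 1 (fun z => cpow (1 - z) de) (de / (1 - x) * cpow (1 - x) de * -1).
    apply: (@is_derive_compC _ (fun z => cpow z de) (fun z => 1 - z)).
      exact: is_derive_cpow.
    by apply: (@is_derive_affine_eq _ (-1) 1) => z; ring.
  have A2 : is_derive x 1 (fun z => cpow (1 - z / a) ep)
      (ep / (1 - x / a) * cpow (1 - x / a) ep * - a^-1).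
    apply: (@is_derive_compC _ (fun z => cpow z ep) (fun z => 1 - z / a)).
      exact: is_derive_cpow.
    by apply: (@is_derive_affine_eq _ (- a^-1) 1) => z; ring.
  have dE : is_derive x 1 E ((de / (x - 1) + ep / (x - a)) * E x).
    apply: eq_is_derive (is_deriveMC A1 A2); rewrite /E.
    have -> : de / (1 - x) = - (de / (x - 1)) by rewrite -opprB invrN mulrN.
    have -> : ep / (1 - x / a) = - (a * (ep / (x - a))).
      by field; rewrite a0 xa' -opprB oppr_eq0 xa'.
    move: (cpow _ de) (cpow _ ep) (de / _) (ep / _) => ? ? ? ?; field; exact: a0.
  have dW : is_derive x 1 W (u1 x * w2 x - w1 x * u2 x).
    apply: eq_is_derive (is_deriveBC (is_deriveMC d1 dd2) (is_deriveMC dd1 d2)).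
    ring.
  apply: eq_is_derive (is_deriveMC dW dE).
  rewrite /V /W (solve_leading e1) (solve_leading e2) /heun_P /= -/ep [- ga / x]mulNr.
  move: (E x) (de / _) (ep / _) (heun_Q _ _) (ga / x) => *; ring.
have W0 x : N x < r -> x != 0 -> W x = 0.
  move=> xr x0; pose G z := V (x * cexp z) * cexp (ga * z).
  have G1 : G 0 = G (0 +i* (pi *+ 2)).
    (* For imaginary [z] the point x e^z keeps the modulus of [x], hence stays in the punctured
       disc. *)
    have GD (t : R) : is_derive (0 +i* t) 1 G 0.
      have Ne : N (x * cexp (0 +i* t)) < r.
        by rewrite Normc.normcM normc_cexp /= expR0 mulr1.
      have e0 : x * cexp (0 +i* t) != 0 by rewrite mulf_neq0 ?cexp_neq0.
      have B1 : is_derive (0 +i* t) 1 (fun z => x * cexp z) (x * cexp (0 +i* t)).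
        apply: eq_is_derive (is_deriveMC (is_derive_cst x (0 +i* t) 1) (is_derive_cexp _)).
        by rewrite mul0r addr0.
      have B2 : is_derive (0 +i* t) 1 (fun z => cexp (ga * z)) (cexp (ga * (0 +i* t)) * ga).
        apply: (@is_derive_compC _ (@cexp R) (fun z => ga * z)).
          exact: is_derive_cexp.
        by apply: (@is_derive_affine_eq _ ga 0) => z; rewrite addr0.
      have B3 := @is_derive_compC _ V (fun z => x * cexp z) _ _ _ (dV _ Ne e0) B1.
      apply: eq_is_derive (is_deriveMC B3 B2).
      by field; rewrite cexp_neq0 x0.
    apply: segment_const.
    - move=> t _; rewrite (_ : _ + _ = 0 +i* (t * (pi *+ 2)))//.
      by rewrite add0r subr0; apply/eqP; rewrite eq_complex /=; apply/andP; split; apply/eqP; ring.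
    - exact: is_derive_cont (GD 0).
    - exact: is_derive_cont (GD _).
  have e2pi : cexp (0 +i* (pi *+ 2) : C) = 1.
    by rewrite /cexp /= expR0 cos2pi sin2pi !mul1r.
  move: G1; rewrite /G cexp0 e2pi mulr0 cexp0 !mulr1 => /eqP.
  rewrite -subr_eq0 -{1}[V x]mulr1 -mulrBr mulf_eq0 mulf_eq0 (negPf (E0 _)) orbF.
  case/orP=> [/eqP//|]; rewrite subr_eq0 eq_sym => /eqP/cexp_eq1[n].
  case: (ga) gint => g1 g2 gint [h1 h2]; exfalso.
  have pi0 : (pi *+ 2 : R) != 0 by rewrite mulrn_eq0 /= gt_eqF// pi_gt0.
  have g20 : g2 = 0 by move: h1 => /eqP; rewrite mulr0 sub0r oppr_eq0 mulf_eq0 (negPf pi0) orbF => /eqP.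
  have g1n : g1 = n%:~R by apply: (mulIf pi0); rewrite [RHS]mulrnAr -h2 mulr0 addr0.
  have /negP := gint (1 - n); apply; apply/eqP.
  by rewrite g20 g1n rmorphB /= -(rmorph_int (real_complex R) n).
apply/near0_normcP; exists r => // x xr.
have [->|x0] := eqVneq x 0; first by rewrite u10 u20.
(* The derivative of the quotient is [W] over the square of [u1], so it vanishes on the open segment
   from 0 to [x]. *)
suff h : u2 0 / u1 0 = u2 x / u1 x.
  have [[_ _ ux _ _] _] := rP x xr.
  by move: h; rewrite u10 u20 divr1 => /(congr1 (fun z => z * u1 x)); rewrite divfK// mul1r.
have Dq y : N y < r -> is_derive y 1 (fun z => u2 z / u1 z) (W y / u1 y ^+ 2).
  move=> yr; have [[d1 d2 uy _ _] _] := rP y yr.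
  apply: eq_is_derive (is_deriveMC d2 (is_deriveVC uy d1)).
  by rewrite /W; field.
apply: (@segment_const _ (fun z => u2 z / u1 z) 0 x).
- move=> t /andP[t0 t1]; rewrite add0r subr0.
  have tr : N (t%:C * x) < r.
    rewrite Normc.normcM normc_real (gtr0_norm t0); apply: le_lt_trans xr.
    by rewrite ler_piMl ?normc_ge0// ltW.
  apply: eq_is_derive (Dq _ tr); rewrite W0 ?mul0r// mulf_neq0//.
  by rewrite -normc_gt0 normc_real normr_gt0 gt_eqF.
- by apply: is_derive_cont (Dq 0 _); rewrite Normc.normc0.
- exact: is_derive_cont (Dq x xr).
Qed.

Lemma Hl_unique p u1 u2 :
  (forall n : int, 1 - he_gamma p != n%:~R) -> he_a p != 0 ->
  is_Hl p u1 -> is_Hl p u2 -> \forall x \near (0 : C), u1 x = u2 x.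
Proof.
move=> gint a0 [/near0_normcP[r1 r10 D1] u10 /dnear0_normcP[s1 s10 S1]].
move=> [/near0_normcP[r2 r20 D2] u20 /dnear0_normcP[s2 s20 S2]].
apply: (@Hl_unique_aux p u1 (derive1 u1) (derive1 (derive1 u1))
  u2 (derive1 u2) (derive1 (derive1 u2)) r1 r2 s1 s2 gint a0 r10 s10 r20 s20 u10 u20).
- by move=> x xr; apply: derivable_derive1; exact: D1.
- by move=> x xr x0; apply: solves_at_solution; exact: S1.
- by move=> x xr; apply: derivable_derive1; exact: D2.
- by move=> x xr x0; apply: solves_at_solution; exact: S2.
Qed.

End HlUnique.

(** * Power series with geometrically bounded coefficients *)

Section PowerSeries.
Variable R : realType.
Local Notation C := R[i].
Local Notation N := (@Normc.normc R).
Implicit Types (x y z w l m : C) (c s t : nat -> C).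

Definition clim s l : Prop :=
  forall e : R, 0 < e -> exists n0, forall n, (n0 <= n)%N -> N (s n - l) < e.

Lemma climD s t l m : clim s l -> clim t m -> clim (fun n => s n + t n) (l + m).
Proof.
move=> hs ht e e0; have e2 : 0 < e / 2 by rewrite divr_gt0.
have [n1 H1] := hs _ e2; have [n2 H2] := ht _ e2.
exists (maxn n1 n2) => n; rewrite geq_max => /andP[/H1 h1 /H2 h2].
rewrite opprD addrACA; apply: le_lt_trans (ler_normcD _ _) _; lra.
Qed.

Lemma climZ w s l : clim s l -> clim (fun n => w * s n) (w * l).
Proof.
move=> hs e e0; have w0 : 0 < N w + 1 by rewrite ltr_wpDl ?normc_ge0.
have [n1 H1] := hs _ (divr_gt0 e0 w0).
exists n1 => n /H1; rewrite ltr_pdivlMr// -mulrBr Normc.normcM => h.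
by apply: le_lt_trans h; rewrite mulrC ler_wpM2l ?normc_ge0// lerDl.
Qed.

Lemma clim_bound s l (B : R) : clim s l -> (forall n, N (s n) <= B) -> N l <= B.
Proof.
move=> hs H; apply/ler_addgt0Pr => e e0.
have [n /(_ _ (leqnn n)) h] := hs e e0.
rewrite -[l](subKr (s n)); apply: le_trans (ler_normcD _ _) _.
by rewrite normcNr; apply: lerD; [exact: H|exact: ltW].
Qed.

Lemma clim_shift s l k : clim s l -> clim (fun n => s (n + k)%N) l.
Proof.
move=> hs e e0; have [n1 H1] := hs _ e0.
by exists n1 => n h; apply: H1; rewrite (leq_trans h)// leq_addr.
Qed.

Lemma clim_eq0 l : (forall e : R, 0 < e -> N l <= e) -> l = 0.
Proof.
move=> H; apply/eqP/negPn/negP; rewrite -normc_gt0 => l0.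
by have := H (N l / 2) (divr_gt0 l0 (ltr0Sn _ 1)); lra.
Qed.

Lemma clim_unique s l m : clim s l -> clim s m -> l = m.
Proof.
move=> hl hm; apply/eqP; rewrite -subr_eq0; apply/eqP/clim_eq0 => e e0.
have h := climD hl (climZ (-1) hm).
have -> : l - m = l + -1 * m by rewrite mulN1r.
by apply: clim_bound h _ => n; rewrite mulN1r subrr Normc.normc0 ltW.
Qed.

Lemma real_clim_geometric (u : nat -> R) (M : R) : (forall n, `|u n| <= M * 2^-1 ^+ n) ->
  exists l : R, forall e : R, 0 < e -> exists n0, forall n, (n0 <= n)%N ->
    `|\sum_(k < n) u k - l| < e.
Proof.
move=> H; have M0 : 0 <= M by have := H 0%N; rewrite expr0 mulr1; apply: le_trans.
have cu : cvgn (series u).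
  apply: (@normed_cvg R R^o u).
  apply: (@series_le_cvg R _ (geometric M 2^-1)) => //.
  - by move=> n /=.
  - by move=> n; rewrite /= mulr_ge0// exprn_ge0.
  - by apply: is_cvg_geometric_series; rewrite ger0_norm// invf_lt1// ltr1n.
exists (limn (series u)) => e e0.
have /(@cvgrPdist_lt _ R^o)/(_ e e0) [n0 _ Hn0] := cu.
exists n0 => n nn; rewrite distrC; have := Hn0 n nn.
by rewrite /series /= big_mkord.
Qed.

Lemma clim_geometric t (M : R) : (forall n, N (t n) <= M * 2^-1 ^+ n) ->
  exists l, clim (fun n => \sum_(k < n) t k) l.
Proof.
move=> H.
have [|l1 H1] := @real_clim_geometric (fun n => complex.Re (t n)) M.
  by move=> n; apply: le_trans (Re_normc _) _.
have [|l2 H2] := @real_clim_geometric (fun n => complex.Im (t n)) M.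
  by move=> n; apply: le_trans (Im_normc _) _.
exists (l1 +i* l2) => e e0; have e2 : 0 < e / 2 by rewrite divr_gt0.
have [n1 {}H1] := H1 _ e2; have [n2 {}H2] := H2 _ e2.
exists (maxn n1 n2) => n; rewrite geq_max => /andP[/H1 h1 /H2 h2].
apply: le_lt_trans (normc_ReIm _) _; rewrite !raddfB /= !raddf_sum; lra.
Qed.

Lemma clim_zero_geometric s (M : R) :
  (forall n, N (s n) <= M * 2^-1 ^+ n) -> clim s 0.
Proof.
move=> H e e0; have M0 : 0 <= M.
  by have := H 0%N; rewrite expr0 mulr1; apply: le_trans; exact: normc_ge0.
have h : geometric M 2^-1 @ \oo --> (0 : R^o).
  by apply: cvg_geometric; rewrite ger0_norm// invf_lt1// ltr1n.
have /(@cvgrPdist_lt _ R^o)/(_ e e0) [n0 _ Hn0] := h.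
exists n0 => n nn; rewrite subr0; apply: le_lt_trans (H n) _.
have := Hn0 n nn; rewrite /= sub0r normrN; apply: le_lt_trans; exact: ler_norm.
Qed.

Definition psum c z n : C := \sum_(k < n) c k * z ^+ k.

Definition pser c z : C := xget 0 [set l | clim (psum c z) l].

Lemma psumS c z n : psum c z n.+1 = psum c z n + c n * z ^+ n.
Proof. by rewrite /psum big_ord_recr. Qed.

(** The coefficients of the termwise derivative. *)
Definition shiftc c n : C := n.+1%:R * c n.+1.

Lemma ltn_2exp (n : nat) : n.+1%:R <= 2 ^+ n :> R.
Proof. by rewrite -natrX ler_nat ltn_expl. Qed.

Section Bounded.
Variables (c : nat -> C) (M K : R).
Hypotheses (K0 : 0 < K) (cK : forall n, N (c n) <= M * K ^+ n).

Let M0 : 0 <= M.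
Proof. by have := cK 0%N; rewrite expr0 mulr1; apply: le_trans; exact: normc_ge0. Qed.

Lemma clim_pser z : N z * K <= 1 / 2 -> clim (psum c z) (pser c z).
Proof.
move=> h; rewrite /pser; case: xgetP => [l _ //|/= H]; exfalso.
have [|l hl] := @clim_geometric (fun k => c k * z ^+ k) M.
  move=> n; rewrite Normc.normcM normcX.
  apply: (@le_trans _ _ (M * K ^+ n * N z ^+ n)).
    by rewrite ler_wpM2r// exprn_ge0// normc_ge0.
  rewrite -mulrA -exprMn ler_wpM2l// lerXn2r ?nnegrE//.
    by rewrite mulr_ge0 ?normc_ge0// ltW.
  by rewrite mulrC (le_trans h)// mul1r.
exact: H l hl.
Qed.

(** The factor n + 1 is absorbed by 2^n, so geometric bounds are stable under differentiation, at
    the price of doubling [K]. *)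
Lemma shiftc_bound n : N (shiftc c n) <= (M * K) * (2 * K) ^+ n.
Proof.
rewrite /shiftc Normc.normcM -(rmorph_nat (real_complex R)) normc_real ger0_norm//.
apply: (@le_trans _ _ (2 ^+ n * (M * K ^+ n.+1))).
  by rewrite ler_pM ?normc_ge0// ltn_2exp.
by rewrite exprMn exprS le_eqVlt; apply/orP; left; apply/eqP; ring.
Qed.

(** The factor [r ^+ 2] on the left stands for r^(k-2) on the right, which would be a negative power
    for k < 2. The induction multiplies the remainder by z + h and adds h^2 k z^(k-1). *)
Lemma monomial_quadratic (z h : C) (r : R) (k : nat) : N z <= r -> N (z + h) <= r ->
  N ((z + h) ^+ k - z ^+ k - h * (k%:R * z ^+ k.-1)) * r ^+ 2
    <= N h ^+ 2 * (k%:R ^+ 2 * r ^+ k).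
Proof.
move=> zr zhr; have r0 : 0 <= r := le_trans (normc_ge0 _) zr.
have h2 : 0 <= N h ^+ 2 by rewrite sqr_ge0.
elim: k => [|k IH].
  by rewrite !expr0 mul0r mulr0 subrr subr0 Normc.normc0 mul0r expr0n /= mul0r mulr0.
have -> : (z + h) ^+ k.+1 - z ^+ k.+1 - h * (k.+1%:R * z ^+ k.+1.-1) =
   (z + h) * ((z + h) ^+ k - z ^+ k - h * (k%:R * z ^+ k.-1)) +
   h ^+ 2 * (k%:R * z ^+ k.-1).
  case: k {IH} => [|k] /=; first by rewrite !expr0 !expr1; ring.
  by rewrite !exprS -!natr1; ring.
apply: (@le_trans _ _ ((r * N ((z + h) ^+ k - z ^+ k - h * (k%:R * z ^+ k.-1)) +
    N h ^+ 2 * (k%:R * N (z ^+ k.-1))) * r ^+ 2)).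
  rewrite ler_wpM2r ?sqr_ge0//; apply: le_trans (ler_normcD _ _) _.
  rewrite !Normc.normcM !normcX -(rmorph_nat (real_complex R) k) normc_real ger0_norm// lerD2r.
  by rewrite ler_wpM2r ?normc_ge0.
rewrite mulrDl -mulrA.
apply: (@le_trans _ _ (r * (N h ^+ 2 * (k%:R ^+ 2 * r ^+ k)) + N h ^+ 2 * (k%:R * r ^+ k.+1))).
  apply: lerD; first by rewrite ler_wpM2l.
  rewrite -[X in X <= _]mulrA ler_wpM2l// -mulrA.
  case: k {IH} => [|k]; first by rewrite !mul0r.
  rewrite ler_wpM2l// normcX -[k.+2]addn2 exprD ler_wpM2r ?sqr_ge0//=.
  by rewrite lerXn2r ?nnegrE ?normc_ge0.
rewrite (_ : _ + _ = N h ^+ 2 * ((k%:R ^+ 2 + k%:R) * r ^+ k.+1)); last by rewrite (exprS r k); ring.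
rewrite ler_wpM2l// ler_wpM2r ?exprn_ge0// -natr1.
have : 0 <= k%:R :> R by []. lra.
Qed.

Lemma is_derive_pser z : N z < 1 / (8 * K) ->
  is_derive z 1 (pser c) (pser (shiftc c) z).
Proof.
(* With [r * K = 1 / 8] and k^2 at most 4^k, the remainder of the k-th term is at most
   [M / r ^+ 2 * N h ^+ 2] times 2^(-k); summing gives the factor 2 in the constant below. *)
set r := 1 / (8 * K) => zr; have r0 : 0 < r by rewrite divr_gt0// mulr_gt0.
have rK : r * K = 1 / 8 by rewrite /r; field; rewrite gt_eqF.
apply: (@is_derive_quadratic _ _ _ _ (2 * M / r ^+ 2) (r - N z)); first by rewrite subr_gt0.
move=> h hr; have zhr : N (z + h) < r.
  by apply: le_lt_trans (ler_normcD _ _) _; lra.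
have ck w : N w < r -> clim (psum c w) (pser c w).
  move=> wr; apply: clim_pser; have : N w * K <= r * K by rewrite ler_wpM2r ?ltW.
  by rewrite rK; lra.
have cs : clim (psum (shiftc c) z) (pser (shiftc c) z).
  have [l hl] : exists l, clim (psum (shiftc c) z) l.
    apply: (@clim_geometric (fun k => shiftc c k * z ^+ k) (M * K)) => n.
    rewrite Normc.normcM normcX.
    apply: le_trans (ler_wpM2r _ (shiftc_bound n)) _; first by rewrite exprn_ge0 ?normc_ge0.
    have K2 := ltW K0.
    rewrite -[X in X <= _]mulrA -exprMn ler_wpM2l ?mulr_ge0//.
    rewrite lerXn2r ?nnegrE ?mulr_ge0 ?normc_ge0//.
    have : N z * K <= r * K by rewrite ler_wpM2r ?ltW.
    by rewrite rK; lra.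
  by rewrite /pser; case: xgetP => // H; case: (H l hl).
(* The sums of [c] run one term further, so that n terms of [shiftc c] are exactly the derivative of
   the truncated polynomial. The estimate is uniform in n and passes to the limit. *)
have L := climD (climD (clim_shift 1 (ck _ zhr)) (climZ (-1) (clim_shift 1 (ck _ zr))))
   (climZ (- h) cs).
have E3 (x y k w : C) : x - y - k * w = x + -1 * y + - k * w by ring.
rewrite E3; apply: clim_bound L _ => n.
have -> : psum c (z + h) (n + 1) + -1 * psum c z (n + 1) + - h * psum (shiftc c) z n =
    \sum_(k < n.+1) c k * ((z + h) ^+ k - z ^+ k - h * (k%:R * z ^+ k.-1)).
  rewrite addn1; elim: n => [|n IH].
    by rewrite /psum !big_ord_recr !big_ord0 /= !expr0; ring.
  rewrite [RHS]big_ord_recr /= -IH !psumS /shiftc /=; ring.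
apply: (@le_trans _ _ (\sum_(k < n.+1) M / r ^+ 2 * N h ^+ 2 * 2^-1 ^+ k)).
  elim: n.+1 => [|k IH]; first by rewrite !big_ord0 Normc.normc0.
  rewrite !big_ord_recr /=; apply: le_trans (ler_normcD _ _) _; apply: lerD => //.
  rewrite Normc.normcM.
  have h1 := monomial_quadratic k (ltW zr) (ltW zhr).
  have r2 : 0 < r ^+ 2 by rewrite exprn_gt0.
  rewrite -ler_pdivlMr// in h1.
  apply: le_trans (ler_pM (normc_ge0 _) (normc_ge0 _) (cK k) h1) _.
  have k2 : k%:R ^+ 2 <= 4 ^+ k :> R.
    have -> : 4 ^+ k = (2 ^+ k) ^+ 2 :> R by rewrite expr2 -exprMn -natrM.
    rewrite lerXn2r ?nnegrE ?exprn_ge0//.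
    by apply: le_trans (ltn_2exp k); rewrite ler_nat.
  have -> : M * K ^+ k * (N h ^+ 2 * (k%:R ^+ 2 * r ^+ k) / r ^+ 2) =
     M / r ^+ 2 * N h ^+ 2 * (k%:R ^+ 2 * (r * K) ^+ k).
    by rewrite [(r * K) ^+ k]exprMn; move: (r ^- 2) => ?; ring.
  have P0 : 0 <= M / r ^+ 2 * N h ^+ 2.
    by apply: mulr_ge0; [apply: divr_ge0 => //; exact: ltW|exact: sqr_ge0].
  rewrite ler_wpM2l//.
  apply: (@le_trans _ _ (4 ^+ k * (r * K) ^+ k)).
    by rewrite ler_wpM2r// exprn_ge0// rK divr_ge0.
  rewrite -exprMn rK (_ : 4 * (1 / 8) = 2^-1)//; by field.
rewrite -mulr_sumr.
have -> : \sum_(i < n.+1) 2^-1 ^+ i = 2 - 2 * 2^-1 ^+ n.+1 :> R.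
  elim: n.+1 => [|k IH]; first by rewrite big_ord0 expr0; ring.
  by rewrite big_ord_recr /= IH exprS; field.
have h0 : 0 <= M / r ^+ 2 * N h ^+ 2.
  by apply: mulr_ge0; [apply: divr_ge0 => //; exact: sqr_ge0|exact: sqr_ge0].
have p0 : 0 <= 2^-1 ^+ n.+1 :> R by rewrite exprn_ge0.
rewrite (_ : 2 * M / r ^+ 2 * N h ^+ 2 = M / r ^+ 2 * N h ^+ 2 * 2); last by ring.
by rewrite ler_wpM2l//; lra.
Qed.

End Bounded.
End PowerSeries.

(** * Existence by Frobenius' recurrence *)

Section HlExists.
Variable R : realType.
Local Notation C := R[i].
Local Notation N := (@Normc.normc R).
Variable p : heun R.
Local Notation a := (he_a p).
Local Notation q := (he_q p).
Local Notation al := (he_alpha p).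
Local Notation be := (he_beta p).
Local Notation ga := (he_gamma p).
Local Notation de := (he_delta p).
Local Notation ep := (he_epsilon p).

(* The Frobenius recurrence is D_n c_(n+1) = B_n c_n - A_n c_(n-1). *)
Let D (n : nat) : C := a * n.+1%:R * (n%:R + ga).
Let B (n : nat) : C :=
  n%:R * ((n%:R - 1 + ga) * (1 + a) + a * de + ep) + q.
Let A (n : nat) : C := (n%:R - 1 + al) * (n%:R - 1 + be).

(** The pair is (c_(n-1), c_n), with c_(-1) = 0, which makes the first step an instance of the
    three-term recurrence. *)
Fixpoint Hl_coef2 (n : nat) : C * C :=
  if n is n'.+1 then
    let: (c0, c1) := Hl_coef2 n' in (c1, (B n' * c1 - A n' * c0) / D n')
  else (0, 1).

Definition Hl_coef n : C := (Hl_coef2 n).2.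

Hypothesis a0 : a != 0.
Hypothesis gaN : forall n : nat, n%:R + ga != 0.

Lemma Hl_coef_rec n : D n.+1 * Hl_coef n.+2 = B n.+1 * Hl_coef n.+1 - A n.+1 * Hl_coef n.
Proof.
have D0 : D n.+1 != 0 by rewrite !mulf_neq0// pnatr_eq0.
rewrite /Hl_coef /=; case: (Hl_coef2 n) => c0 c1 /=.
by rewrite mulrC divfK.
Qed.

Lemma Hl_coef0 : Hl_coef 0 = 1. Proof. by []. Qed.

Lemma Hl_coef1 : D 0 * Hl_coef 1 = q.
Proof.
have D0 : D 0 != 0 by rewrite !mulf_neq0// oner_eq0.
by rewrite /Hl_coef /= mulrC divfK// mulr0 subr0 mulr1 /B mul0r add0r.
Qed.

(** For large n the triangle inequality gives the constant 1/2; the finitely many other n contribute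
    a positive minimum since no n + gamma vanishes. *)
Lemma shifted_normc_ge : exists2 k : R, 0 < k & forall n : nat, k * n.+1%:R <= N (n%:R + ga).
Proof.
have far n : 2 * N ga + 1 <= n%:R -> n.+1%:R / 2 <= N (n%:R + ga) - 0.
  move=> h; have := normcDl (n%:R : C) ga.
  rewrite (_ : N n%:R = n%:R) ?subr0; last first.
    by rewrite -(rmorph_nat (real_complex R)) normc_real ger0_norm.
  rewrite -natr1; lra.
have near_ m : exists2 k : R, 0 < k & forall n, (n < m)%N -> k * n.+1%:R <= N (n%:R + ga).
  elim: m => [|m [k k0 H]]; first by exists 1.
  have nm : 0 < N (m%:R + ga) by rewrite normc_gt0.
  exists (Num.min k (N (m%:R + ga) / m.+1%:R)).
    by rewrite lt_min k0 divr_gt0// ltr0n.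
  move=> n; rewrite ltnS leq_eqVlt => /orP[/eqP->|/H].
    by rewrite -ler_pdivlMr ?ltr0n// ge_min lexx orbT.
  by apply: le_trans; rewrite ler_wpM2r// ge_min lexx.
have [k k0 H] := near_ (Num.bound (2 * N ga + 1)).
exists (Num.min k (1 / 2)); first by rewrite lt_min k0 divr_gt0.
move=> n; have [nm|nm] := ltnP n (Num.bound (2 * N ga + 1)).
  by apply: le_trans (H n nm); rewrite ler_wpM2r// ge_min lexx.
have : n.+1%:R / 2 <= N (n%:R + ga) - 0.
  apply: far; apply: (@le_trans _ _ (Num.bound (2 * N ga + 1))%:R); last by rewrite ler_nat.
  by apply/ltW/archi_boundP; rewrite addr_ge0// mulr_ge0// normc_ge0.
rewrite subr0; apply: le_trans; rewrite mulrC ler_wpM2l//.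
by rewrite ge_min mul1r lexx orbT.
Qed.

Lemma normc_nat (n : nat) : N n%:R = n%:R.
Proof. by rewrite -(rmorph_nat (real_complex R)) normc_real ger0_norm. Qed.

Lemma normc_natB1 (n : nat) : N (n%:R - 1) <= n.+1%:R.
Proof.
by apply: le_trans (ler_normcD _ _) _; rewrite normcNr normc_nat Normc.normc1 natr1.
Qed.

Lemma AB_bound : exists2 k : R, 0 < k & forall n : nat,
  N (A n) <= k * n.+1%:R ^+ 2 /\ N (B n) <= k * n.+1%:R ^+ 2.
Proof.
have g (x : C) := normc_ge0 x.
exists ((1 + N al) * (1 + N be) + ((1 + N ga) * (1 + N a) + N a * N de + N ep + N q)).
  by apply: ltr_wpDr; rewrite ?addr_ge0 ?mulr_ge0 ?addr_ge0// mulr_gt0// ltr_pwDl.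
move=> n; have n1 : 1 <= n.+1%:R :> R by rewrite ler1n.
have E (x : C) : N (n%:R - 1 + x) <= (1 + N x) * n.+1%:R.
  apply: le_trans (ler_normcD _ _) _; rewrite mulrDl mul1r lerD ?normc_natB1//.
  by rewrite ler_peMr.
split.
  rewrite /A Normc.normcM (le_trans (ler_pM (g _) (g _) (E al) (E be)))//.
  rewrite mulrACA -expr2 ler_wpM2r ?sqr_ge0// lerDl.
  by rewrite !addr_ge0 ?mulr_ge0 ?addr_ge0.
have n0 : 0 <= n.+1%:R :> R by [].
have nn : N (n%:R) <= n.+1%:R by rewrite normc_nat ler_nat.
have F (x : R) : 0 <= x -> x <= x * n.+1%:R by move=> x0; rewrite ler_peMr.
rewrite /B; apply: le_trans (ler_normcD _ _) _.
apply: (@le_trans _ _ (((1 + N ga) * (1 + N a) + N a * N de + N ep + N q) * n.+1%:R ^+ 2)); last first.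
  by rewrite ler_wpM2r ?sqr_ge0// lerDr mulr_ge0 ?addr_ge0.
rewrite [leRHS]mulrDl; apply: lerD; last by rewrite ler_peMr// expr2 mulr_ege1.
rewrite Normc.normcM expr2 [leRHS]mulrA [leRHS]mulrC ler_pM//.
apply: le_trans (ler_normcD _ _) _; rewrite [leRHS]mulrDl lerD ?F//.
apply: le_trans (ler_normcD _ _) _; rewrite [leRHS]mulrDl lerD ?Normc.normcM ?F ?mulr_ge0//.
rewrite [leRHS]mulrAC ler_pM ?E//; apply: le_trans (ler_normcD _ _) _.
by rewrite Normc.normc1.
Qed.

Lemma Hl_coef_bound : exists2 K : R, 1 <= K & forall n, N (Hl_coef n) <= 1 * K ^+ n.
Proof.
have [k1 k10 H1] := AB_bound; have [k2 k20 H2] := shifted_normc_ge.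
have na : 0 < N a by rewrite normc_gt0.
(* A_n and B_n are at most k1 (n+1)^2 and D_n is at least |a| k2 (n+1)^2, so one step multiplies the
   bound by at most [K]; as [K] is at least 1, the same K^n bounds both previous coefficients. *)
pose K := Num.max 1 (2 * k1 / (N a * k2)).
have K1 : 1 <= K by rewrite le_max lexx.
have K0 : 0 < K by rewrite (lt_le_trans ltr01).
exists K => // n; rewrite mul1r.
suff : N (Hl_coef2 n).1 <= K ^+ n /\ N (Hl_coef2 n).2 <= K ^+ n by case.
elim: n => [|n [IH1 IH2]]; first by rewrite Normc.normc0 Normc.normc1 expr0 ler01 lexx.
rewrite /=; case: (Hl_coef2 n) IH1 IH2 => c0 c1 /= h0 h1; split.
  by apply: le_trans h1 _; rewrite exprS ler_peMl// exprn_ge0// ltW.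
rewrite Normc.normcM Normc.normcV ler_pdivrMr; last first.
  by rewrite normc_gt0 !mulf_neq0// pnatr_eq0.
have [hA hB] := H1 n.
have n2 : 0 <= n.+1%:R ^+ 2 :> R by rewrite sqr_ge0.
have Kn : 0 <= K ^+ n by rewrite exprn_ge0// ltW.
apply: (@le_trans _ _ (2 * k1 * n.+1%:R ^+ 2 * K ^+ n)).
  apply: le_trans (ler_normcD _ _) _; rewrite normcNr (Normc.normcM (B n)) (Normc.normcM (A n)).
  have e1 := ler_pM (normc_ge0 _) (normc_ge0 _) hA h0.
  have e2 := ler_pM (normc_ge0 _) (normc_ge0 _) hB h1.
  lra.
have e3 : N a * k2 * n.+1%:R ^+ 2 <= N (D n).
  rewrite /D !Normc.normcM normc_nat expr2 -!mulrA ler_pM2l//.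
  by rewrite mulrCA ler_wpM2l.
apply: (@le_trans _ _ (K ^+ n.+1 * (N a * k2 * n.+1%:R ^+ 2))); last first.
  by rewrite ler_wpM2l// exprn_ge0// ltW.
have e4 : 2 * k1 <= K * (N a * k2).
  by rewrite -ler_pdivrMr ?mulr_gt0// le_max lexx orbT.
rewrite (exprS K n) [leRHS](_ : _ = (K * (N a * k2)) * (n.+1%:R ^+ 2 * K ^+ n)); last by ring.
by rewrite -mulrA ler_wpM2r// mulr_ge0.
Qed.

(** The equation, cleared of denominators, is applied to the Taylor polynomial of degree n + 1 and
    its two derivatives: the recurrence cancels every coefficient of degree at most n, leaving an
    exact boundary term. *)
Lemma Hl_remainder z n :
  z * (z - 1) * (z - a) * psum (shiftc (shiftc Hl_coef)) z n
  + (ga * ((z - 1) * (z - a)) + de * (z * (z - a)) + ep * (z * (z - 1)))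
    * psum (shiftc Hl_coef) z n.+1
  + (al * be * z - q) * psum Hl_coef z n.+2
  = A n.+2 * Hl_coef n.+1 * z ^+ n.+2
    - (B n.+1 * Hl_coef n.+1 - A n.+1 * Hl_coef n) * z ^+ n.+1.
Proof.
rewrite -Hl_coef_rec; elim: n => [|n IH].
  rewrite Hl_coef_rec !psumS /psum !big_ord0 /shiftc Hl_coef0.
  have := Hl_coef1; rewrite /D /A /B /he_epsilon => h; rewrite -h; ring.
rewrite psumS (psumS _ _ n.+1) (psumS _ _ n.+2).
have R2 := Hl_coef_rec n.+1.
have A2 : A n.+2 * Hl_coef n.+1 = B n.+2 * Hl_coef n.+2 - D n.+2 * Hl_coef n.+3.
  by rewrite R2; ring.
rewrite A2 in IH.
move: IH; rewrite /shiftc.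
move: (psum _ z n) (psum _ z n.+1) (psum _ z n.+2) => s2 s1 s0 IH.
move/eqP: IH; rewrite -subr_eq0 => /eqP IH.
apply/eqP; rewrite -subr_eq0 -[X in _ == X]IH; apply/eqP.
rewrite /A /B /D !exprS -!natr1 /he_epsilon.
move: (Hl_coef n.+2) (Hl_coef n.+3) (z ^+ n) => c2 c3 w; ring.
Qed.

Lemma Hl_exists : exists u, is_Hl p u.
Proof.
have [K K_1 cK] := Hl_coef_bound.
have K0 : 0 < K by rewrite (lt_le_trans ltr01).
have cK1 := shiftc_bound cK; have K1 : 0 < 2 * K by rewrite mulr_gt0.
have cK2 := shiftc_bound cK1; have K2 : 0 < 2 * (2 * K) by rewrite mulr_gt0.
pose u := pser Hl_coef; pose v := pser (shiftc Hl_coef).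
pose w := pser (shiftc (shiftc Hl_coef)).
(* The radius suits the three bounds K, 2K, 4K of the series and its derivatives, and beats the
   quadratic growth of A_n and B_n: (n+3)^2 is at most 16 * 4^n, and 4/64 is below 1/2. *)
pose r := 1 / (64 * K); have r0 : 0 < r by rewrite divr_gt0// mulr_gt0.
have rlt x : N x < r -> N x * K <= 1 / 64 /\ N x < 1 / (8 * (2 * K)).
  move=> h; have : N x * (64 * K) < 1 by rewrite -ltr_pdivlMr// mulr_gt0.
  by rewrite ltr_pdivlMr ?mulr_gt0// => h1; split; lra.
have du x : N x < r -> is_derive x 1 u (v x).
  move=> /rlt[h _]; apply: (is_derive_pser K0 cK).
  by rewrite ltr_pdivlMr ?mulr_gt0//; lra.
have dv x : N x < r -> is_derive x 1 v (w x).
  by move=> /rlt[_ h]; apply: (is_derive_pser K1 cK1).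
have ode x : N x < r -> x * (x - 1) * (x - a) * w x
    + (ga * ((x - 1) * (x - a)) + de * (x * (x - a)) + ep * (x * (x - 1))) * v x
    + (al * be * x - q) * u x = 0.
  move=> xr; have [h _] := rlt _ xr.
  have L0 : clim (psum Hl_coef x) (u x) by apply: (clim_pser K0 cK); lra.
  have L1 : clim (psum (shiftc Hl_coef) x) (v x).
    by apply: (clim_pser K1 cK1); lra.
  have L2 : clim (psum (shiftc (shiftc Hl_coef)) x) (w x).
    by apply: (clim_pser K2 cK2); lra.
  have L := climD (climD (climZ (x * (x - 1) * (x - a)) L2)
    (climZ (ga * ((x - 1) * (x - a)) + de * (x * (x - a)) + ep * (x * (x - 1))) (clim_shift 1 L1)))
    (climZ (al * be * x - q) (clim_shift 2 L0)).
  apply: clim_unique L _.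
  have [k k0 AB] := AB_bound.
  (* The remainder splits into three terms, each at most 16 k 2^(-n). *)
  apply: (@clim_zero_geometric _ _ (48 * k)) => n.
  rewrite addn1 addn2 Hl_remainder.
  have Nx := normc_ge0 x.
  have xn : N x <= 1.
    have : N x * 1 <= N x * K by rewrite ler_wpM2l.
    lra.
  have n2 : 0 <= k * n.+3%:R ^+ 2 by rewrite mulr_ge0 ?sqr_ge0// ltW.
  have T (y d : C) (i j : nat) : (n <= j)%N -> (j <= i)%N ->
      N y <= k * n.+3%:R ^+ 2 -> N d <= 1 * K ^+ j ->
      N (y * d * x ^+ i) <= 16 * k * 2^-1 ^+ n.
    rewrite mul1r => nj ji hy hd; rewrite -mulrA Normc.normcM.
    have h1 : N (d * x ^+ i) <= (1 / 64) ^+ n.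
      rewrite Normc.normcM normcX.
      apply: (@le_trans _ _ (K ^+ j * N x ^+ j)).
        by rewrite ler_pM ?normc_ge0 ?exprn_ge0// ler_wiXn2l.
      rewrite -exprMn mulrC; apply: (@le_trans _ _ ((1 / 64) ^+ j)).
        by rewrite lerXn2r ?nnegrE ?mulr_ge0 ?divr_ge0 ?(ltW K0)// mulrC.
      by rewrite ler_wiXn2l//; lra.
    apply: le_trans (ler_pM (normc_ge0 _) (normc_ge0 _) hy h1) _.
    have h3 : n.+3%:R <= 4 * 2 ^+ n :> R.
      have := ltn_2exp R n; have : 1 <= 2 ^+ n :> R by rewrite exprn_ege1// ler1n.
      rewrite -!natr1; lra.
    have h4 : n.+3%:R ^+ 2 <= (4 * 2 ^+ n) ^+ 2 :> R.
      by rewrite lerXn2r ?nnegrE ?mulr_ge0 ?exprn_ge0.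
    apply: (@le_trans _ _ (k * (4 * 2 ^+ n) ^+ 2 * (1 / 64) ^+ n)).
      by rewrite ler_wpM2r ?exprn_ge0 ?divr_ge0// ler_wpM2l// ltW.
    have -> : k * (4 * 2 ^+ n) ^+ 2 * (1 / 64) ^+ n = 16 * k * (1 / 16) ^+ n.
      rewrite (_ : (1 / 16) ^+ n = (2 ^+ n) ^+ 2 * (1 / 64) ^+ n :> R); first by ring.
      rewrite -exprM mulnC exprM -exprMn; congr (_ ^+ n); by field.
    have k16 : 0 <= 16 * k by apply: mulr_ge0 => //; exact: ltW.
    rewrite ler_wpM2l//.
    by rewrite lerXn2r ?nnegrE ?divr_ge0//; lra.
  have mono (m : nat) : (m <= n.+3)%N -> k * m%:R ^+ 2 <= k * n.+3%:R ^+ 2.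
    by move=> mn; rewrite ler_pM2l// lerXn2r ?nnegrE ?ler_nat.
  have t1 := T (A n.+2) (Hl_coef n.+1) n.+2 n.+1 (leqnSn _) (leqnSn _)
    (AB n.+2).1 (cK _).
  have t2 := T (B n.+1) (Hl_coef n.+1) n.+1 n.+1 (leqnSn _) (leqnn _)
    (le_trans (AB n.+1).2 (mono _ (leqnSn _))) (cK _).
  have t3 := T (A n.+1) (Hl_coef n) n.+1 n (leqnn _) (leqnSn _)
    (le_trans (AB n.+1).1 (mono _ (leqnSn _))) (cK _).
  rewrite mulrBl; apply: le_trans (ler_normcD _ _) _; rewrite normcNr.
  have := ler_normcD (B n.+1 * Hl_coef n.+1 * x ^+ n.+1) (- (A n.+1 * Hl_coef n * x ^+ n.+1)).
  rewrite normcNr; lra.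
exists u; split.
- by apply/near0_normcP; exists r => // x /du [].
- have L0 : clim (psum Hl_coef 0) (u 0).
    by apply: (clim_pser K0 cK); rewrite Normc.normc0 mul0r divr_ge0.
  apply: (clim_unique (clim_shift 1 L0)) => e e0; exists 0%N => n _.
  rewrite addn1 (_ : psum _ _ _ = 1) ?subrr ?Normc.normc0//.
  elim: n => [|n IH]; rewrite psumS ?expr0 ?mulr1.
    by rewrite /psum big_ord0 add0r Hl_coef0.
  by rewrite IH expr0n /= mulr0 addr0.
have a1 : 0 < Num.min r (Num.min 1 (N a)).
  by rewrite !lt_min r0 ltr01 normc_gt0.
apply/dnear0_normcP; exists (Num.min r (Num.min 1 (N a))) => // x.
rewrite !lt_min => /and3P[xr x1 xa] x0.
have x1' : x - 1 != 0.
  by rewrite subr_eq0; apply: contraTneq x1 => ->; rewrite Normc.normc1 ltxx.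
have xa' : x - a != 0.
  by rewrite subr_eq0; apply: contraTneq xa => ->; rewrite ltxx.
apply: (@solution_solves_at _ p u v (w x)); last first.
- have := ode x xr; rewrite /heun_P /heun_Q => h.
  apply: (mulfI (_ : x * (x - 1) * (x - a) != 0)); first by rewrite !mulf_neq0.
  rewrite mulr0 -[RHS]h; field; by rewrite x0 x1' xa'.
- exact: dv.
apply/near_normcP; exists (r - N x) => [|h hr]; first by rewrite subr_gt0.
by apply: du; apply: le_lt_trans (ler_normcD _ _) _; lra.
Qed.

End HlExists.

Notation hpt := (@Defs.point _).

(** * Exponent differences, Moebius maps and the accessory parameter *)

Section Labels.

Lemma flabelP (P : flabel -> Prop) : P l0 -> P l1 -> P la -> forall d, P d.
Proof.
move=> p0 p1 pa [[|[|[|//]]] h].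
- by rewrite (_ : Ordinal h = l0)//; apply: val_inj.
- by rewrite (_ : Ordinal h = l1)//; apply: val_inj.
- by rewrite (_ : Ordinal h = la)//; apply: val_inj.
Qed.

Lemma flabel_eqE :
  (((l0 == l0) = true) * ((l1 == l1) = true) * ((la == la) = true) *
   ((l0 == l1) = false) * ((l0 == la) = false) * ((l1 == l0) = false) *
   ((l1 == la) = false) * ((la == l0) = false) * ((la == l1) = false))%type.
Proof. by []. Qed.

Lemma big_flabel (V : nmodType) (F : flabel -> V) :
  \sum_d F d = F l0 + F l1 + F la.
Proof.
rewrite 3!big_ord_recl big_ord0 addr0 addrA.
by congr (F _ + F _ + F _); apply: val_inj.
Qed.

Lemma big_label (V : nmodType) (F : label -> V) :
  \sum_l F l = F None + F (Some l0) + F (Some l1) + F (Some la).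
Proof.
rewrite (bigD1 None) //= -!addrA; congr (_ + _); rewrite addrA -(big_flabel (fun d => F (Some d))).
rewrite (reindex_onto Some (odflt l0)) /=; last by case.
by apply: eq_bigl => d; rewrite eqxx.
Qed.

End Labels.

Section Exponents.
Variable R : realType.
Local Notation C := R[i].
Implicit Types (p : heun R) (s t : {perm label}).

Definition expdiff p (l : label) : C :=
  if l is Some d then rho p d else he_beta p - he_alpha p.

Arguments expdiff : simpl never.

(** Fuchs' relation in terms of exponent differences; through it the four differences determine
    alpha, and hence all exponents. *)
Lemma sum_expdiff p : \sum_l expdiff p l = 2 - 2 * he_alpha p.
Proof. by rewrite big_label /expdiff /rho /= /he_epsilon; ring. Qed.

Lemma sum_expdiff_perm p s :
  expdiff p (s None) + expdiff p (s (Some l0)) + expdiff p (s (Some l1)) + expdiff p (s (Some la))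
  = 2 - 2 * he_alpha p.
Proof.
rewrite -(big_label (fun l => expdiff p (s l))) -sum_expdiff.
by apply/esym/reindex_inj; exact: perm_inj.
Qed.

Lemma heun_eq p1 p2 : he_a p1 = he_a p2 -> he_q p1 = he_q p2 ->
  expdiff p1 =1 expdiff p2 -> p1 = p2.
Proof.
move=> ea eq ev; have eal : he_alpha p1 = he_alpha p2.
  have := sum_expdiff p1; rewrite (eq_bigr (expdiff p2)) => [|l _]; last exact: ev.
  rewrite sum_expdiff => /eqP; rewrite (inj_eq (addrI _)) eqr_opp => /eqP.
  by move=> /(mulfI (_ : 2 != 0))->//; rewrite pnatr_eq0.
have ebe : he_beta p1 = he_beta p2.
  by have := ev None; rewrite /expdiff eal => /addIr.
have ega : he_gamma p1 = he_gamma p2.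
  by have := ev (Some l0); rewrite /expdiff /rho /= => /addrI /oppr_inj.
have ede : he_delta p1 = he_delta p2.
  by have := ev (Some l1); rewrite /expdiff /rho /= => /addrI /oppr_inj.
by case: p1 p2 ea eq eal ebe ega ede {ev} => ? ? ? ? ? ? [? ? ? ? ? ?] /= -> -> -> -> -> ->.
Qed.

(** True by construction at 0, 1 and infinity; at [la] it comes from Fuchs' relation, because
    epsilon is defined by the other parameters. *)
Lemma expdiff_perm_exponents s p l : expdiff (perm_exponents s p) l = expdiff p (s^-1%g l).
Proof.
have E l' : (if l' is Some d then rho p d else he_beta p - he_alpha p) = expdiff p l' by [].
have B : he_beta (perm_exponents s p) = expdiff p (s^-1%g None) + he_alpha p.
  by rewrite /perm_exponents /=; case: (s^-1%g None) => [c|] //=; rewrite subrK.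
case: l => [d|]; last by rewrite {1}/expdiff B /= addrK.
elim/flabelP: d; rewrite {1}/expdiff /= /rho /= ?opprB ?[1 + _]addrC ?subrK ?E//.
rewrite /he_epsilon B /= !E; have := sum_expdiff_perm p s^-1%g => h.
rewrite (_ : expdiff p (s^-1%g (Some la)) = 2 - 2 * he_alpha p - expdiff p (s^-1%g None)
  - expdiff p (s^-1%g (Some l0)) - expdiff p (s^-1%g (Some l1))); first by ring.
by rewrite -h; ring.
Qed.

Lemma expdiff_iota_exponents d p l : expdiff (iota_exponents d p) l =
  if (l == Some d) || (l == None) then - expdiff p l else expdiff p l.
Proof.
case: l => [e|]; rewrite /expdiff /=; last by ring.
rewrite (inj_eq Some_inj) orbF.
by elim/flabelP: d; elim/flabelP: e; rewrite /iota_exponents /rho /he_epsilon /= ?flabel_eqE /=; ring.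
Qed.

Lemma expdiff_with_q p q l : expdiff (with_q p q) l = expdiff p l.
Proof. by case: l. Qed.

Definition noninteger (z : C) := forall n : int, z != n%:~R.

Lemma genericE p : generic p <-> [/\ he_a p != 0, he_a p != 1 &
  forall l, noninteger (expdiff p l)].
Proof.
split=> -[a0 a1 H]; split => //.
  case=> [d|] n /=; last by have [_ _ _] := H (- n); rewrite rmorphN /= -eqr_oppLR opprB.
  by have [h1 h2 h3 _] := H n; elim/flabelP: d.
move=> n; split; [exact: H (Some l0) n|exact: H (Some l1) n|exact: H (Some la) n|].
by have := H None (- n); rewrite rmorphN /= -eqr_oppLR opprB.
Qed.

End Exponents.

Arguments expdiff : simpl never.

(** * Moebius maps in homogeneous coordinates and conjugation of invariants *)

Section Mobius.
Variable R : realType.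
Local Notation C := R[i].
Implicit Types (p : heun R) (s t : {perm label}) (a x : C) (X Y : C * C).

Lemma bracket_point_neq0 a (l m : label) : a != 0 -> a != 1 -> l != m ->
  bracket (hpt a l) (hpt a m) != 0.
Proof.
move=> a0 a1; have a1' : 1 - a != 0 by rewrite subr_eq0 eq_sym.
have a1'' : a - 1 != 0 by rewrite subr_eq0.
case: l => [d|]; case: m => [e|] //; last first.
- by rewrite /bracket /= mul0r mulr1 subr0 oner_neq0.
- by rewrite /bracket /= mulr0 mulr1 sub0r oppr_eq0 oner_neq0.
rewrite /bracket /= mulr1 mul1r.
by elim/flabelP: d; elim/flabelP: e; rewrite /fpoint /= ?subr0 ?sub0r ?oppr_eq0 ?oner_neq0.
Qed.

(** This identity and the next three do the field arithmetic over plain variables, in place of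
    brackets that would unfold to coordinates. *)
Lemma frac_sub (A B X1 D E F : C) : X1 != 0 -> F != 0 -> D != 0 ->
  A * B / (X1 * D) - E * B / (F * D) = (A * F - X1 * E) * B / D / (X1 * F).
Proof. by move=> *; field; apply/and3P. Qed.

Lemma frac_solve (w m k X1 Y1 : C) : w != 0 -> m != 0 ->
  w * m * X1 = k * Y1 -> X1 = k / (w * m) * Y1.
Proof. by move=> w0 m0 h; rewrite mulrAC -h; field; rewrite w0 m0. Qed.

Lemma frac_weights (k m w0 w1 wi b0 b1 bi b : C) : k != 0 -> m != 0 -> w0 != 0 ->
  w1 != 0 -> wi != 0 -> bi != 0 -> b != 0 ->
  k / (w0 * m) * b0 * (k / (w1 * wi) * b1) / (k / (wi * m) * bi * (k / (w1 * w0) * b))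
  = b0 * b1 / (bi * b).
Proof.
move=> k0 m0 h0 h1 hi hbi hb; field.
by rewrite !(k0, m0, h0, h1, hi, hbi, hb).
Qed.

Lemma frac_mob_der (n1i n10 n0i w0 w1 wi b1i b0i b10 bi xi : C) :
  n1i != 0 -> n10 != 0 -> n0i != 0 -> w0 != 0 -> w1 != 0 -> wi != 0 ->
  b10 != 0 -> bi != 0 -> xi != 0 -> let k := n1i * n10 * n0i in
  k / (w1 * wi) * b1i * (k / (w0 * wi) * b0i) / (k / (w1 * w0) * b10)
    / (k / (wi * (xi * n10)) * bi) ^+ 2 * (n1i * n0i / n10 / xi ^+ 2)
  = b1i * b0i / b10 / bi ^+ 2.
Proof.
move=> h1 h2 h3 h4 h5 h6 h7 h8 h9 k; rewrite /k; field.
by rewrite !(h1, h2, h3, h4, h5, h6, h7, h8, h9).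
Qed.

Definition ordinary a x : Prop := forall l, bracket (x, 1) (hpt a l) != 0.

Lemma ordinaryP a x : ordinary a x <-> [/\ x != 0, x != 1 & x != a].
Proof.
rewrite /ordinary; split=> [H|[x0 x1 xa] [d|]].
- have h d : x != fpoint a d by have := H (Some d); rewrite /bracket /= mulr1 mul1r subr_eq0.
  by split; [have := h l0|have := h l1|have := h la].
- by rewrite /bracket /= mulr1 mul1r subr_eq0; elim/flabelP: d.
- by rewrite /bracket /= mulr0 mulr1 sub0r oppr_eq0 oner_neq0.
Qed.

Section Map.
Variables (a : C) (s : {perm label}).
Hypotheses (a0 : a != 0) (a1 : a != 1).
Let Z l := hpt a (s^-1%g l).
Let Z0 := Z (Some l0).
Let Z1 := Z (Some l1).
Let Zi := Z None.

Definition mob_a : C := mobius a s (Z (Some la)).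
(** The constant D in phi X - phi Y = D [X,Y] / ([X,Zi] [Y,Zi]), and therefore in phi' = D /
    [x,Zi]^2. *)
Definition mob_D : C := bracket Z1 Zi * bracket Z0 Zi / bracket Z1 Z0.

Let neq l m : l != m -> bracket (Z l) (Z m) != 0.
Proof. by move=> lm; apply: bracket_point_neq0 => //; rewrite (inj_eq perm_inj). Qed.

Let n10 : bracket Z1 Z0 != 0. Proof. exact: neq. Qed.
Let n1i : bracket Z1 Zi != 0. Proof. exact: neq. Qed.
Let n0i : bracket Z0 Zi != 0. Proof. exact: neq. Qed.

Lemma mob_D_neq0 : mob_D != 0.
Proof. by rewrite /mob_D !mulf_neq0 ?invr_eq0. Qed.

Let mobiusE X : mobius a s X = bracket X Z0 * bracket Z1 Zi / (bracket X Zi * bracket Z1 Z0).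
Proof. by []. Qed.

Lemma fpoint_mob_a e : fpoint mob_a e = mobius a s (Z (Some e)).
Proof.
elim/flabelP: e => //; rewrite mobiusE.
  by rewrite (_ : bracket (Z _) Z0 = 0) ?mul0r// /bracket mulrC subrr.
by rewrite -/Z1 [X in X / _]mulrC divff// mulf_neq0.
Qed.

Lemma mobius_sub X Y : bracket X Zi != 0 -> bracket Y Zi != 0 ->
  mobius a s X - mobius a s Y = mob_D * bracket X Y / (bracket X Zi * bracket Y Zi).
Proof.
move=> xi yi; rewrite !mobiusE /mob_D.
have P : bracket X Z0 * bracket Y Zi - bracket X Zi * bracket Y Z0
  = bracket X Y * bracket Z0 Zi by rewrite /bracket; ring.
rewrite frac_sub// P; ring.
Qed.

Lemma bracket_fpoint x d : bracket (x, 1) (hpt mob_a (Some d)) = x - fpoint mob_a d.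
Proof. by rewrite /bracket /= mulr1 mul1r. Qed.

Lemma mobius_fpoint X e : bracket X Zi != 0 ->
  mobius a s X - fpoint mob_a e =
  mob_D * bracket X (Z (Some e)) / (bracket X Zi * bracket (Z (Some e)) Zi).
Proof. by move=> xi; rewrite fpoint_mob_a mobius_sub//; exact: neq. Qed.

Lemma mob_a_neq0 : mob_a != 0.
Proof.
have := @mobius_fpoint (Z (Some la)) l0 (neq _); rewrite /= subr0 -/mob_a => ->//.
by rewrite !(mulf_neq0, invr_eq0, mob_D_neq0, neq).
Qed.

Lemma mob_a_neq1 : mob_a != 1.
Proof.
have := @mobius_fpoint (Z (Some la)) l1 (neq _); rewrite -/mob_a -subr_eq0 => ->//.
by rewrite !(mulf_neq0, invr_eq0, mob_D_neq0, neq).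
Qed.

Lemma ordinary_mobius x : ordinary a x -> ordinary mob_a (mobius a s (x, 1)).
Proof.
move=> ox [e|]; last by rewrite /bracket /= mulr0 mulr1 sub0r oppr_eq0 oner_neq0.
rewrite bracket_fpoint mobius_fpoint; last exact: ox.
by rewrite !(mulf_neq0, invr_eq0, mob_D_neq0, neq)//; exact: ox.
Qed.

(* The linear map on homogeneous coordinates inducing the Moebius map. *)
Let M X : C * C := (bracket X Z0 * bracket Z1 Zi, bracket X Zi * bracket Z1 Z0).
Let kappa : C := bracket Z1 Zi * bracket Z1 Z0 * bracket Z0 Zi.

Let bracketM X Y : bracket (M X) (M Y) = kappa * bracket X Y.
Proof. by rewrite /M /kappa /bracket /=; ring. Qed.

(** The linear map sends the old representative of the point moved to [l] to this multiple of the
    new one. *)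
Let weight l : C := if l is Some e then (M (Z l)).2 else (M (Z l)).1.

Let weight_neq0 l : weight l != 0.
Proof.
by case: l => [e|] /=; rewrite mulf_neq0//; exact: neq.
Qed.

Let point_weight l :
  (weight l * (hpt mob_a l).1, weight l * (hpt mob_a l).2) = M (Z l).
Proof.
case: l => [e|] /=; rewrite ?mulr1 ?mulr0.
  rewrite fpoint_mob_a mobiusE /M; congr (_, _).
  by rewrite mulrC divfK// mulf_neq0//; exact: neq.
by congr (_, _); rewrite /bracket [X in _ - X]mulrC subrr mul0r.
Qed.

Lemma bracket_point_mob l m :
  bracket (hpt mob_a l) (hpt mob_a m) =
  kappa / (weight l * weight m) * bracket (Z l) (Z m).
Proof.
have h : weight l * weight m * bracket (hpt mob_a l) (hpt mob_a m) =
    kappa * bracket (Z l) (Z m).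
  by rewrite -bracketM -!point_weight /bracket /=; ring.
exact: frac_solve h.
Qed.

Lemma bracket_mobius_point x l : bracket (x, 1) Zi != 0 ->
  bracket (mobius a s (x, 1), 1) (hpt mob_a l) =
  kappa / (weight l * (bracket (x, 1) Zi * bracket Z1 Z0)) * bracket (x, 1) (Z l).
Proof.
move=> xi; set w := bracket (x, 1) Zi * bracket Z1 Z0.
have w0 : w != 0 by rewrite mulf_neq0.
have e : M (x, 1) = (w * mobius a s (x, 1), w).
  by rewrite mobiusE /M -/w [w * _]mulrC divfK.
have h : weight l * w * bracket (mobius a s (x, 1), 1) (hpt mob_a l) =
    kappa * bracket (x, 1) (Z l).
  by rewrite -bracketM -point_weight e /bracket /=; ring.
exact: frac_solve h.
Qed.

(** A Moebius map normalized by three points is a cross ratio: the determinant [kappa] and the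
    weights cancel from it. *)
Lemma mobius_comp t x : bracket (x, 1) Zi != 0 ->
  bracket (x, 1) (hpt a ((s * t)^-1%g None)) != 0 ->
  mobius mob_a t (mobius a s (x, 1), 1) = mobius a (s * t)%g (x, 1).
Proof.
move=> xi xti; rewrite {1}/mobius !bracket_point_mob !bracket_mobius_point//.
rewrite /mobius invMg !permM; apply: frac_weights => //.
- by rewrite /kappa !mulf_neq0.
- by rewrite mulf_neq0.
- by move: xti; rewrite invMg permM.
- by apply: neq; rewrite (inj_eq perm_inj).
Qed.

Lemma mobius_point_comp t :
  mobius mob_a t (hpt mob_a (t^-1%g (Some la))) =
  mobius a (s * t)%g (hpt a ((s * t)^-1%g (Some la))).
Proof.
rewrite /mobius !bracket_point_mob invMg !permM.
rewrite ![weight (t^-1%g (Some la)) * _]mulrC; apply: frac_weights => //.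
- by rewrite /kappa !mulf_neq0.
- by apply: neq; rewrite (inj_eq perm_inj).
- by apply: neq; rewrite (inj_eq perm_inj).
Qed.

Definition mob_der x : C := mob_D / bracket (x, 1) Zi ^+ 2.

Lemma mob_der_neq0 x : bracket (x, 1) Zi != 0 -> mob_der x != 0.
Proof. by move=> h; rewrite mulf_neq0 ?mob_D_neq0// invr_eq0 expf_neq0. Qed.

(** The chain rule, obtained as an identity between brackets without differentiating. *)
Lemma mob_der_compE t x : bracket (x, 1) Zi != 0 ->
  bracket (x, 1) (hpt a ((s * t)^-1%g None)) != 0 ->
  bracket (hpt mob_a (t^-1%g (Some l1))) (hpt mob_a (t^-1%g None)) *
  bracket (hpt mob_a (t^-1%g (Some l0))) (hpt mob_a (t^-1%g None)) /
  bracket (hpt mob_a (t^-1%g (Some l1))) (hpt mob_a (t^-1%g (Some l0))) /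
  bracket (mobius a s (x, 1), 1) (hpt mob_a (t^-1%g None)) ^+ 2 * mob_der x
  = bracket (hpt a ((s * t)^-1%g (Some l1))) (hpt a ((s * t)^-1%g None)) *
    bracket (hpt a ((s * t)^-1%g (Some l0))) (hpt a ((s * t)^-1%g None)) /
    bracket (hpt a ((s * t)^-1%g (Some l1))) (hpt a ((s * t)^-1%g (Some l0))) /
    bracket (x, 1) (hpt a ((s * t)^-1%g None)) ^+ 2.
Proof.
move=> xi xti; rewrite !bracket_point_mob !bracket_mobius_point// invMg !permM.
rewrite /mob_der /mob_D /kappa; apply: frac_mob_der => //.
- by apply: neq; rewrite (inj_eq perm_inj).
- by move: xti; rewrite invMg permM.
Qed.

End Map.

Lemma mob_der_comp a s t x : a != 0 -> a != 1 ->
  bracket (x, 1) (hpt a (s^-1%g None)) != 0 ->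
  bracket (x, 1) (hpt a ((s * t)^-1%g None)) != 0 ->
  mob_der (mob_a a s) t (mobius a s (x, 1)) * mob_der a s x = mob_der a (s * t)%g x.
Proof. by move=> a0 a1 xi xti; exact: mob_der_compE. Qed.

(** 1 / (x - z_l) in homogeneous form, so that infinity gives 0 without a separate case. *)
Definition pole a x l : C := (hpt a l).2 / bracket (x, 1) (hpt a l).

Lemma poleE a x d : pole a x (Some d) = (x - fpoint a d)^-1.
Proof. by rewrite /pole /bracket /= mulr1 !mul1r. Qed.

Lemma pole_None a x : pole a x None = 0.
Proof. by rewrite /pole mul0r. Qed.

(* The invariant Q - P'/2 - P^2/4. *)
Definition heun_I p x : C := heun_Q p x
  + (\sum_d (1 - expdiff p (Some d)) * pole (he_a p) x (Some d) ^+ 2) / 2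
  - heun_P p x ^+ 2 / 4.

Lemma heun_P_pole p x :
  heun_P p x = \sum_d (1 - expdiff p (Some d)) * pole (he_a p) x (Some d).
Proof.
rewrite big_flabel !poleE /heun_P /expdiff /rho /fpoint /= subr0.
by rewrite !opprB ![1 + _]addrC !subrK.
Qed.

Lemma heun_IE a q al be ga de x : heun_I (Heun a q al be ga de) x =
  (al * be * x - q) / (x * (x - 1) * (x - a))
  + (ga / x ^+ 2 + de / (x - 1) ^+ 2 + (al + be - ga - de + 1) / (x - a) ^+ 2) / 2
  - (ga / x + de / (x - 1) + (al + be - ga - de + 1) / (x - a)) ^+ 2 / 4.
Proof.
rewrite /heun_I big_flabel !poleE /heun_P /heun_Q /expdiff /rho /he_epsilon /fpoint /= subr0.
by rewrite !opprB ![1 + (_ - 1)]addrC !subrK !exprVn.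
Qed.

Definition heun_conj p s p' : Prop := forall x, ordinary (he_a p) x ->
  heun_I p x = mob_der (he_a p) s x ^+ 2 * heun_I p' (Pmap s p x).

Lemma conjugate_iota d p : exists q,
  forall x, ordinary (he_a p) x -> heun_I (with_q (iota_exponents d p) q) x = heun_I p x.
Proof.
case: p => a q al be ga de.
(* Splitting off (x - z_d)^rho_d adds rho_d / (x - z_d) times the other two terms of P to Q; the
   list gives minus the constant coefficient of the numerator over x (x-1) (x-a), up to the factor
   rho_d. *)
exists (q + rho (Heun a q al be ga de) d *
  [:: de * a + (al + be - ga - de + 1); ga * a; ga]`_d) => x /ordinaryP[/= x0 x1 xa].
have x1' : x - 1 != 0 by rewrite subr_eq0.
have xa' : x - a != 0 by rewrite subr_eq0.
elim/flabelP: d; rewrite /with_q /iota_exponents /rho /he_epsilon /= ?flabel_eqE /= !heun_IE; field;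
  by rewrite x0 x1' xa'.
Qed.

(* The transpositions below generate the permutations of the labels; the
   values of q are found by comparing residues of the invariants. *)
Lemma conjugate_swap01 p : he_a p != 0 -> he_a p != 1 ->
  let s := tperm (Some l0) (Some l1) in exists q, heun_conj p s (with_q (perm_exponents s p) q).
Proof.
case: p => a q al be ga de /= a0 a1; set s := tperm _ _.
have s0 : s^-1%g (Some l0) = Some l1 by rewrite tpermV tpermL.
have s1 : s^-1%g (Some l1) = Some l0 by rewrite tpermV tpermR.
have sa : s^-1%g (Some la) = Some la by rewrite tpermV tpermD.
have si : s^-1%g None = None by rewrite tpermV tpermD.
exists (al * be - q) => x /ordinaryP[/= x0 x1 xa].
have x1' : x - 1 != 0 by rewrite subr_eq0.
have xa' : x - a != 0 by rewrite subr_eq0.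
have y1' : 1 - x != 0 by rewrite subr_eq0 eq_sym.
have ya' : 1 - x - (1 - a) != 0.
  by rewrite (_ : _ - _ = - (x - a)) ?oppr_eq0//; ring.
have Px : Pmap s (Heun a q al be ga de) x = 1 - x.
  rewrite /Pmap /mobius s0 s1 si /bracket /= /fpoint /=; by field.
rewrite Px /with_q /perm_exponents s0 s1 sa si /rho /he_epsilon /=.
rewrite /mob_der /mob_D s0 s1 si.
have -> : mobius a s (hpt a (Some la)) = 1 - a.
  rewrite /mobius s0 s1 si /bracket /= /fpoint /=; by field.
rewrite !heun_IE /bracket /= /fpoint /=; field.
by rewrite x0 x1' xa' y1' ya' addrAC subrr sub0r oppr_eq0 x0.
Qed.

Lemma conjugate_swap0a p : he_a p != 0 -> he_a p != 1 ->
  let s := tperm (Some l0) (Some la) in exists q, heun_conj p s (with_q (perm_exponents s p) q).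
Proof.
case: p => a q al be ga de /= a0 a1; set s := tperm _ _.
have s0 : s^-1%g (Some l0) = Some la by rewrite tpermV tpermL.
have s1 : s^-1%g (Some l1) = Some l1 by rewrite tpermV tpermD.
have sa : s^-1%g (Some la) = Some l0 by rewrite tpermV tpermR.
have si : s^-1%g None = None by rewrite tpermV tpermD.
exists ((q - al * be * a) / (1 - a)) => x /ordinaryP[/= x0 x1 xa].
have x1' : x - 1 != 0 by rewrite subr_eq0.
have xa' : x - a != 0 by rewrite subr_eq0.
have y1' : 1 - a != 0 by rewrite subr_eq0 eq_sym.
have y2' : a - 1 != 0 by rewrite subr_eq0.
have Px : Pmap s (Heun a q al be ga de) x = (x - a) / (1 - a).
  rewrite /Pmap /mobius s0 s1 si /bracket /= /fpoint /=; field; by rewrite y1'.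
rewrite Px /with_q /perm_exponents s0 s1 sa si /rho /he_epsilon /=.
rewrite /mob_der /mob_D s0 s1 si.
have -> : mobius a s (hpt a (Some l0)) = a / (a - 1).
  rewrite /mobius s0 s1 si /bracket /= /fpoint /=; field; by rewrite ?y1' ?y2'.
have E1 : (x - a) / (1 - a) - 1 = (x - 1) / (1 - a) by field.
have E2 : (x - a) / (1 - a) - a / (a - 1) = x / (1 - a) by field; rewrite ?y1' ?y2'.
rewrite !heun_IE E1 E2 /bracket /= /fpoint /=; field.
by rewrite ?x0 ?x1' ?xa' ?y1' ?y2'.
Qed.

Lemma conjugate_swap0i p : he_a p != 0 -> he_a p != 1 ->
  let s := tperm (Some l0) None in exists q, heun_conj p s (with_q (perm_exponents s p) q).
Proof.
case: p => a q al be ga de /= a0 a1; set s := tperm _ _.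
have s0 : s^-1%g (Some l0) = None by rewrite tpermV tpermL.
have s1 : s^-1%g (Some l1) = Some l1 by rewrite tpermV tpermD.
have sa : s^-1%g (Some la) = Some la by rewrite tpermV tpermD.
have si : s^-1%g None = Some l0 by rewrite tpermV tpermR.
exists ((q + al * (1 + al - ga) * (1 + a) - al * de * a - al * (al + be - ga - de + 1)) / a).
move=> x /ordinaryP[/= x0 x1 xa].
have x1' : x - 1 != 0 by rewrite subr_eq0.
have xa' : x - a != 0 by rewrite subr_eq0.
have y1' : 1 - x != 0 by rewrite subr_eq0 eq_sym.
have ya' : a - x != 0 by rewrite subr_eq0 eq_sym.
have Px : Pmap s (Heun a q al be ga de) x = x^-1.
  rewrite /Pmap /mobius s0 s1 si /bracket /= /fpoint /=; by field.
rewrite Px /with_q /perm_exponents s0 s1 sa si /rho /he_epsilon /=.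
rewrite /mob_der /mob_D s0 s1 si.
have -> : mobius a s (hpt a (Some la)) = a^-1.
  rewrite /mobius s0 s1 si /bracket /= /fpoint /=; by field.
have E1 : x^-1 - 1 = (1 - x) / x by field.
have E2 : x^-1 - a^-1 = (a - x) / (a * x) by field; rewrite a0 x0.
rewrite !heun_IE E1 E2 /bracket /= /fpoint /=; field.
by rewrite a0 x0 x1' xa' y1' ya'.
Qed.

Lemma with_q_eq p1 p2 : he_a p1 = he_a p2 -> expdiff p1 =1 expdiff p2 ->
  p1 = with_q p2 (he_q p1).
Proof.
by move=> ea ev; apply: heun_eq => // l; rewrite expdiff_with_q ev.
Qed.

Lemma ordinary_exists a : exists x, ordinary a x.
Proof.
have [a2|a2] := eqVneq a 2; [exists 3|exists 2]; apply/ordinaryP.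
  by rewrite a2 pnatr_eq0 pnatr_eq1 (eqr_nat C 3 2).
by rewrite [2 == a]eq_sym a2 pnatr_eq0 pnatr_eq1.
Qed.

Lemma heun_I_with_q p q x :
  heun_I (with_q p q) x - heun_I p x =
  (he_q p - q) / (x * (x - 1) * (x - he_a p)).
Proof.
by rewrite /heun_I /heun_P /heun_Q /with_q /he_epsilon /=; ring.
Qed.

(** The invariant is affine in q with nonzero slope, so its value at a single ordinary point pins
    q. *)
Lemma heun_I_q_inj p q1 q2 x : ordinary (he_a p) x ->
  heun_I (with_q p q1) x = heun_I (with_q p q2) x -> q1 = q2.
Proof.
move=> /ordinaryP[x0 x1 xa] /eqP.
have := heun_I_with_q p q1 x; have := heun_I_with_q p q2 x.
move=> h2 h1; rewrite -(inj_eq (addIr (- heun_I p x))) h1 h2.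
rewrite (inj_eq (mulIf _)) ?invr_eq0 ?mulf_neq0 ?subr_eq0//.
by rewrite (inj_eq (addrI _)) eqr_opp => /eqP.
Qed.

Lemma conjugate_comp s t p p1 p2 : he_a p != 0 -> he_a p != 1 ->
  he_a p1 = mob_a (he_a p) s ->
  heun_conj p s p1 -> heun_conj p1 t p2 -> heun_conj p (s * t)%g p2.
Proof.
move=> a0 a1 ea c1 c2 x ox; rewrite c1// c2; last first.
  by rewrite ea; exact: ordinary_mobius.
rewrite /Pmap ea -[in RHS]mobius_comp//; try exact: ox.
by rewrite -mob_der_comp//; try exact: ox; ring.
Qed.

Lemma mob_a_comp a s t : a != 0 -> a != 1 ->
  mob_a (mob_a a s) t = mob_a a (s * t)%g.
Proof.
by move=> a0 a1; exact: mobius_point_comp.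
Qed.

Lemma conjugate_exists s p : he_a p != 0 -> he_a p != 1 ->
  exists q, heun_conj p s (with_q (perm_exponents s p) q).
Proof.
(* Quantifying over all equations makes this set closed under products: the second factor is applied
   to the equation already transformed by the first. *)
pose G : {set {perm label}} := [set s | `[< forall p, he_a p != 0 -> he_a p != 1 ->
  exists q, heun_conj p s (with_q (perm_exponents s p) q) >] ]%SET.
suff : s \in G by rewrite inE => /asboolP; apply.
have GM : {in G &, forall s t, (s * t)%g \in G}.
  move=> s1 s2; rewrite !inE => /asboolP H1 /asboolP H2; apply/asboolP => p0 a0 a1.
  have [q1 c1] := H1 p0 a0 a1; set p1 := with_q _ q1 in c1.
  have ea : he_a p1 = mob_a (he_a p0) s1 by [].
  have [||q2 c2] := H2 p1; rewrite ?ea ?mob_a_neq0 ?mob_a_neq1//.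
  exists q2; have := conjugate_comp a0 a1 ea c1 c2.
  rewrite (_ : with_q (perm_exponents s2 p1) q2 = with_q (perm_exponents (s1 * s2)%g p0) q2)//.
  apply: heun_eq => //; first exact: mob_a_comp.
  by move=> l; rewrite !expdiff_with_q !expdiff_perm_exponents expdiff_with_q expdiff_perm_exponents invMg permM.
have G0 (l : label) : l != Some l0 -> tperm (Some l0) l \in G.
  case: l => [d|_]; last by rewrite inE; apply/asboolP => p0; exact: conjugate_swap0i.
  elim/flabelP: d => // _; rewrite inE; apply/asboolP => p0.
    exact: conjugate_swap01.
  exact: conjugate_swap0a.
have Gt (l m : label) : l != m -> tperm l m \in G.
  move=> lm; have [l_0|l_0] := eqVneq l (Some l0).
    by rewrite l_0; apply: G0; rewrite -l_0 eq_sym.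
  have [m_0|m_0] := eqVneq m (Some l0); first by rewrite m_0 tpermC; exact: G0.
  have <- : (tperm (Some l0) l ^ tperm (Some l0) m)%g = tperm l m.
    by rewrite tpermJ tpermL tpermD 1?eq_sym// tpermC.
  by rewrite conjgE tpermV !GM// G0.
have [ts -> dts] := prod_tpermP s.
have G1 : 1%g \in G.
  by rewrite -(mulgV (tperm (Some l0) None)) tpermV GM// G0.
elim: ts dts => [|[l m] ts IH] /=; first by rewrite big_nil.
by move=> /andP[lm /IH h]; rewrite big_cons GM// Gt.
Qed.

End Mobius.

(** * Transformation of solutions *)

Section Transfer.
Variable R : realType.
Local Notation C := R[i].
Local Notation N := (@Normc.normc R).
Implicit Types (p : heun R) (s : {perm label}) (a x y z : C) (f g u v : C -> C).

Lemma is_deriveDC (f g : C -> C) x b c : is_derive x 1 f b ->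
  is_derive x 1 g c -> is_derive x 1 (fun t => f t + g t) (b + c).
Proof. exact: is_deriveD. Qed.

Lemma is_derive_bracket (Z : C * C) x :
  is_derive x 1 (fun t => bracket (t, 1) Z) Z.2.
Proof.
apply: (@is_derive_affine_eq _ _ _ (- Z.1)) => t.
by rewrite /bracket /=; ring.
Qed.

Lemma ordinary_near a x : ordinary a x -> \forall y \near x, ordinary a y.
Proof.
move=> /ordinaryP[x0 x1 xa].
have H z : x != z -> \forall y \near x, y != z.
  move=> xz; have nz : 0 < N (x - z) by rewrite normc_gt0 subr_eq0.
  apply/near_normcP; exists (N (x - z)) => // h hr.
  apply: contraTneq hr => e; rewrite -leNgt (_ : x - z = - h); last first.
    by rewrite -e opprD addrA subrr sub0r.
  by rewrite normcNr.
apply: filterS3 (H _ x0) (H _ x1) (H _ xa) => y y0 y1 ya.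
by apply/ordinaryP.
Qed.

Lemma is_derive_pole a l x : ordinary a x ->
  is_derive x 1 (fun t => pole a t l) (- pole a x l ^+ 2).
Proof.
move=> ox; rewrite /pole.
have A1 := @is_deriveVC _ (fun t => bracket (t, 1) (hpt a l)) x _ (ox l)
  (is_derive_bracket (hpt a l) x).
apply: eq_is_derive (is_deriveMC (is_derive_cst (hpt a l).2 x 1) A1).
rewrite mul0r addr0 expr_div_n mulNr mulrN; congr (- _).
by rewrite mulrA -expr2.
Qed.

Section Fixed.
Variables (a : C) (s : {perm label}).
Hypotheses (a0 : a != 0) (a1 : a != 1).
Let i := s^-1%g None.

Lemma is_derive_mobius x : bracket (x, 1) (hpt a i) != 0 ->
  is_derive x 1 (fun t => mobius a s (t, 1)) (mob_der a s x).
Proof.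
move=> xi; rewrite /mobius.
set Z0 := hpt a _; set Z1 := hpt a _; set Zi := hpt a _.
have n10 : bracket Z1 Z0 != 0 by apply: bracket_point_neq0 => //; rewrite (inj_eq perm_inj).
rewrite /i -/Zi in xi.
have D1 := is_deriveMC (is_derive_bracket Z0 x) (is_derive_cst (bracket Z1 Zi) x 1).
have D2 := is_deriveMC (is_derive_bracket Zi x) (is_derive_cst (bracket Z1 Z0) x 1).
have xi0 : bracket (x, 1) Zi * bracket Z1 Z0 != 0 by rewrite mulf_neq0.
have D3 := is_deriveMC D1 (@is_deriveVC _
  (fun t => bracket (t, 1) Zi * cst (bracket Z1 Z0) t) x _ xi0 D2).
apply: eq_is_derive D3.
rewrite /mob_der /mob_D -/Z0 -/Z1 -/Zi /cst !mulr0 !add0r.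
have P : Z0.2 * bracket (x, 1) Zi - bracket (x, 1) Z0 * Zi.2 = bracket Z0 Zi.
  by rewrite /bracket /=; ring.
by rewrite -P; move: (bracket (x, 1) Zi) (bracket Z1 Z0) n10 xi {P D1 D2 xi0} => b b' h1 h2; field; rewrite h1 h2.
Qed.

Lemma is_derive_mob_der x : ordinary a x ->
  is_derive x 1 (mob_der a s) (- 2 * pole a x i * mob_der a s x).
Proof.
move=> ox; have xi : bracket (x, 1) (hpt a i) != 0 := ox _.
have D1 := is_deriveMC (is_derive_bracket (hpt a i) x) (is_derive_bracket (hpt a i) x).
have xi0 : bracket (x, 1) (hpt a i) * bracket (x, 1) (hpt a i) != 0 by rewrite mulf_neq0.
have D3 := is_deriveMC (is_derive_cst (mob_D a s) x 1) (@is_deriveVC _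
  (fun t => bracket (t, 1) (hpt a i) * bracket (t, 1) (hpt a i)) x _ xi0 D1).
apply: eq_is_derive (is_derive_near _ D3).
  rewrite /mob_der /pole -/i /cst.
  by move: (bracket (x, 1) (hpt a i)) xi {xi0 D1 D3} => b h2; field.
apply: nearC_all => t; by rewrite /mob_der expr2.
Qed.

(** Both sides are the logarithmic derivative of phi(x) - e', a constant multiple of (x - s^-1 e) /
    (x - s^-1 oo). *)
Lemma mob_der_pole x (e : flabel) : ordinary a x ->
  mob_der a s x * pole (mob_a a s) (mobius a s (x, 1)) (Some e)
  = pole a x (s^-1%g (Some e)) - pole a x i.
Proof.
move=> ox; have xi : bracket (x, 1) (hpt a i) != 0 := ox _.
rewrite poleE mobius_fpoint// -/i.
have ei : bracket (hpt a (s^-1%g (Some e))) (hpt a i) != 0.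
  by apply: bracket_point_neq0 => //; rewrite (inj_eq perm_inj).
have xe : bracket (x, 1) (hpt a (s^-1%g (Some e))) != 0 := ox _.
have D0 := mob_D_neq0 s a0 a1.
rewrite /mob_der /pole -/i.
have P : (hpt a (s^-1%g (Some e))).2 * bracket (x, 1) (hpt a i)
   - (hpt a i).2 * bracket (x, 1) (hpt a (s^-1%g (Some e)))
   = bracket (hpt a (s^-1%g (Some e))) (hpt a i).
  by rewrite /bracket /=; ring.
transitivity (bracket (hpt a (s^-1%g (Some e))) (hpt a i)
   / (bracket (x, 1) (hpt a i) * bracket (x, 1) (hpt a (s^-1%g (Some e))))).
  move: (bracket (x, 1) (hpt a i)) xi (bracket (hpt a (s^-1%g (Some e))) (hpt a i)) ei {P} => b hb b' hb'.
  by move: (bracket _ _) xe (mob_D a s) D0 => b'' hb'' D D0; field; rewrite hb hb' hb'' D0.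
rewrite -P.
by move: (bracket (x, 1) (hpt a i)) xi (bracket (x, 1) _) xe {P} => b hb b' hb'; field; rewrite hb hb'.
Qed.

End Fixed.

Section Coefficients.
Variables (p p' : heun R) (s : {perm label}) (c : flabel -> C).
Hypotheses (a0 : he_a p != 0) (a1 : he_a p != 1) (ea : he_a p' = mob_a (he_a p) s).
Local Notation a := (he_a p).
Let i := s^-1%g None.
Let phi := Pmap s p.

(* Equality of the coefficients of y_l = 1 / (x - z_l) (where y_oo = 0) in
   2 L + P + phi''/phi' = phi' P'(phi), for L = sum_d c_d y_d. *)
Definition log_derivative_condition : Prop := forall g : label -> C, g None = 0 ->
  \sum_d (2 * c d + (1 - expdiff p (Some d))) * g (Some d) - 2 * g i
  = \sum_e (1 - expdiff p' (Some e)) * (g (s^-1%g (Some e)) - g i).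

Hypothesis Hc : log_derivative_condition.
Hypothesis Hconj : heun_conj p s p'.

(** The logarithmic derivative of the factor A. The transport of solutions uses nothing else about A
    than A' = L A and, in one direction, A nonzero, so it holds for every branch. *)
Definition logder x : C := \sum_d c d * pole a x (Some d).
Definition logder' x : C := - \sum_d c d * pole a x (Some d) ^+ 2.

Lemma is_derive_logder x : ordinary a x -> is_derive x 1 logder (logder' x).
Proof.
move=> ox; rewrite /logder'.
have D d : is_derive x 1 (fun t => c d * pole a t (Some d)) (- (c d * pole a x (Some d) ^+ 2)).
  apply: eq_is_derive (is_deriveMC (is_derive_cst (c d) x 1) (is_derive_pole (Some d) ox)).
  by rewrite mul0r addr0 mulrN.
have D3 := is_deriveD (is_deriveD (D l0) (D l1)) (D la).
apply: eq_is_derive (is_derive_near _ D3); last first.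
  by apply: nearC_all => t; rewrite /logder big_flabel.
by rewrite big_flabel; move: (c l0 * _) (c l1 * _) (c la * _) => *; ring.
Qed.

Lemma mob_der_heun_P x : ordinary a x ->
  mob_der a s x * heun_P p' (phi x) = 2 * logder x + heun_P p x - 2 * pole a x i.
Proof.
move=> ox; rewrite !heun_P_pole mulr_sumr ea.
under eq_bigr => e _ do rewrite mulrCA mob_der_pole//.
rewrite -(Hc (pole_None a x)); congr (_ - _).
by rewrite /logder mulr_sumr -big_split /=; apply: eq_bigr => d _; ring.
Qed.

(** The coefficient condition is used here with the squared poles for [g]: the same coefficients
    govern the derivative of the relation between P and P', since the derivative of a pole is minus
    its square. *)
Lemma mob_der_sqr_poles x : ordinary a x ->
  mob_der a s x ^+ 2 * (\sum_e (1 - expdiff p' (Some e)) * pole (mob_a a s) (phi x) (Some e) ^+ 2)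
  = - 2 * logder' x + \sum_d (1 - expdiff p (Some d)) * pole a x (Some d) ^+ 2
    - 2 * pole a x i ^+ 2 - 2 * pole a x i * (mob_der a s x * heun_P p' (phi x)).
Proof.
move=> ox; have g0 : (fun l => pole a x l ^+ 2) None = 0 by rewrite pole_None expr0n.
have h2 := @Hc (fun l => pole a x l ^+ 2) g0; rewrite /= in h2.
have E1 : mob_der a s x * heun_P p' (phi x) =
   \sum_e (1 - expdiff p' (Some e)) * (pole a x (s^-1%g (Some e)) - pole a x i).
  by rewrite heun_P_pole mulr_sumr ea; apply: eq_bigr => e _; rewrite mulrCA mob_der_pole.
have -> : - 2 * logder' x + \sum_d (1 - expdiff p (Some d)) * pole a x (Some d) ^+ 2
    - 2 * pole a x i ^+ 2 = \sum_e (1 - expdiff p' (Some e)) *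
      (pole a x (s^-1%g (Some e)) ^+ 2 - pole a x i ^+ 2).
  rewrite -h2; congr (_ - _); rewrite /logder' mulrNN mulr_sumr -big_split /=.
  by apply: eq_bigr => d _; ring.
rewrite E1 [2 * _ * \sum_e _]mulr_sumr -sumrB [LHS]mulr_sumr; apply: eq_bigr => e _.
rewrite mulrCA -exprMn mob_der_pole//; move: (pole a x _) (pole a x i) => ? ?; ring.
Qed.

(** No residues are compared: the equality of invariants is solved for Q' once the relations for P'
    and its poles are inserted. *)
Lemma mob_der_heun_Q x : ordinary a x ->
  mob_der a s x ^+ 2 * heun_Q p' (phi x) =
  logder' x + logder x ^+ 2 + heun_P p x * logder x + heun_Q p x.
Proof.
move=> ox; have := Hconj ox; rewrite /heun_I -/phi ea.
move: (mob_der_sqr_poles ox) (mob_der_heun_P ox).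
move: (\sum_d _) (\sum_d _) (logder x) (logder' x) (pole a x i) (mob_der a s x).
move: (heun_P p x) (heun_Q p x) (heun_Q p' _) (heun_P p' _).
move=> P Q Q' P' S S' L L' y m hS hP h.
have -> : m ^+ 2 * Q' = m ^+ 2 * (Q' + S' / 2 - P' ^+ 2 / 4) - m ^+ 2 * S' / 2
  + (m * P') ^+ 2 / 4 by field.
by rewrite -h hS hP; field.
Qed.

Section Operator.
Variables (A v v1 v2 : C -> C) (x0 : C).
Hypotheses (ox0 : ordinary a x0)
  (dA : \forall x \near x0, is_derive (x : C) 1 A (logder x * A x))
  (dv : \forall y \near phi x0, is_derive (y : C) 1 v (v1 y))
  (dv1 : \forall y \near phi x0, is_derive (y : C) 1 v1 (v2 y)).

Let u t := A t * v (phi t).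
Let u1 t := A t * (logder t * v (phi t) + mob_der a s t * v1 (phi t)).
Let u2 t := A t * ((logder' t + logder t ^+ 2) * v (phi t)
   + (2 * logder t - 2 * pole a t i) * mob_der a s t * v1 (phi t)
   + mob_der a s t ^+ 2 * v2 (phi t)).

Let cont_phi : {for x0, continuous phi}.
Proof. exact: is_derive_cont (is_derive_mobius a0 a1 (ox0 (s^-1%g None))). Qed.

Lemma near_derive_transfer : \forall x \near x0,
  is_derive (x : C) 1 u (u1 x) /\ is_derive (x : C) 1 u1 (u2 x).
Proof.
have dv' : \forall x \near x0, is_derive (phi x) 1 v (v1 (phi x)) := cont_phi dv.
have dv1' : \forall x \near x0, is_derive (phi x) 1 v1 (v2 (phi x)) := cont_phi dv1.
have oN := ordinary_near ox0.
apply: nearC_imp (nearC_and (nearC_and dv' dv1') (nearC_and dA oN)).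
move=> x [[hv hv1] [hA ox]].
have dphi := is_derive_mobius a0 a1 (ox (s^-1%g None)).
have c1 := @is_derive_compC _ v phi x _ _ hv dphi.
have c2 := @is_derive_compC _ v1 phi x _ _ hv1 dphi.
have E (b0 b1 m l w : C) : b0 * (b1 * m) + l * b0 * w = b0 * (l * w + m * b1) by ring.
split; first by apply: eq_is_derive (is_deriveMC hA c1); exact: E.
have g1 := is_deriveMC (is_derive_logder ox) c1.
have g2 := is_deriveMC (is_derive_mob_der s ox) c2.
apply: eq_is_derive (is_deriveMC hA (is_deriveDC g1 g2)).
rewrite /u2 -/i.
move: (A x) (logder x) (logder' x) (mob_der a s x) (pole a x i) (v (phi x)) (v1 (phi x)) (v2 (phi x)).
by move=> *; ring.
Qed.

(** The two operators differ by the factor A phi'^2, which gives one direction of the correspondence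
    at once and, as the factor is nonzero, the other. *)
Lemma transfer_operator x : ordinary a x ->
  u2 x + heun_P p x * u1 x + heun_Q p x * u x =
  A x * mob_der a s x ^+ 2 *
    (v2 (phi x) + heun_P p' (phi x) * v1 (phi x) + heun_Q p' (phi x) * v (phi x)).
Proof.
move=> ox; have hP := mob_der_heun_P ox; have hQ := mob_der_heun_Q ox.
rewrite /u /u1 /u2; move: hP hQ.
move: (A x) (logder x) (logder' x) (mob_der a s x) (pole a x i) (v (phi x)) (v1 (phi x)) (v2 (phi x)).
move: (heun_P p x) (heun_Q p x) (heun_P p' _) (heun_Q p' _) => P Q P' Q' A_ L L' m y w w1 w2 hP hQ.
have -> : A_ * m ^+ 2 * (w2 + P' * w1 + Q' * w) =
  A_ * (m ^+ 2 * w2 + m * (m * P') * w1 + (m ^+ 2 * Q') * w) by ring.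
by rewrite hP hQ; ring.
Qed.

End Operator.
End Coefficients.
End Transfer.

(** * Correspondence of solutions in both directions *)

Section Transforms.
Variable R : realType.
Local Notation C := R[i].
Local Notation N := (@Normc.normc R).
Implicit Types (p : heun R) (s : {perm label}) (a x y z : C) (f g u v : C -> C).

Lemma is_derive_unique f x b c : is_derive x 1 f b -> is_derive x 1 f c -> b = c.
Proof. by move=> /is_derive_derive1 <- /is_derive_derive1 <-. Qed.

Lemma mobius1 a x : mobius a 1 (x, 1) = x.
Proof. by rewrite /mobius invg1 !perm1 /bracket /= /fpoint /=; field. Qed.

Lemma mob_a1 a : mob_a a 1 = a.
Proof. by rewrite /mob_a invg1 perm1 /= mobius1. Qed.

Lemma mob_der1 a x : mob_der a 1 x = 1.
Proof. by rewrite /mob_der /mob_D invg1 !perm1 /bracket /= /fpoint /=; field. Qed.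

Lemma mobiusK a s x : a != 0 -> a != 1 -> ordinary a x ->
  mobius (mob_a a s) s^-1%g (mobius a s (x, 1), 1) = x.
Proof.
by move=> a0 a1 ox; rewrite mobius_comp// mulgV mobius1.
Qed.

Lemma mob_aK a s : a != 0 -> a != 1 -> mob_a (mob_a a s) s^-1%g = a.
Proof. by move=> a0 a1; rewrite mob_a_comp// mulgV mob_a1. Qed.

Lemma mobiusVK a s y : a != 0 -> a != 1 -> ordinary (mob_a a s) y ->
  mobius a s (mobius (mob_a a s) s^-1%g (y, 1), 1) = y.
Proof.
move=> a0 a1 oy; have := @mobiusK _ s^-1%g _ (mob_a_neq0 s a0 a1) (mob_a_neq1 s a0 a1) oy.
by rewrite mob_aK// invgK.
Qed.

Lemma near_solves_derive p u x0 : (\forall x \near x0, solves_at p u x) ->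
  exists u1 u2 : C -> C, \forall x \near x0, solution p u u1 u2 x.
Proof.
move=> H; exists (derive1 u), (derive1 (derive1 u)).
by apply: nearC_imp H => x; exact: solves_at_solution.
Qed.

Lemma near_solution_solves p u (u1 u2 : C -> C) x0 :
  (\forall x \near x0, solution p u u1 u2 x) -> \forall x \near x0, solves_at p u x.
Proof.
move=> H; apply: nearC_imp (near_nearby H) => x Hx.
have [d1 d2 e] := nbhs_singleton Hx.
apply: (@solution_solves_at _ p u u1 (u2 x)) => //.
by apply: nearC_imp Hx => y [].
Qed.

Section TransformsOf.
Variables (p p' : heun R) (s : {perm label}) (c : flabel -> C).
Hypotheses (a0 : he_a p != 0) (a1 : he_a p != 1) (ea : he_a p' = mob_a (he_a p) s).
Hypothesis Hc : log_derivative_condition p p' s c.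
Hypothesis Hconj : heun_conj p s p'.
Local Notation a := (he_a p).
Let phi := Pmap s p.

Section Forward.
Variables (A v : C -> C) (x0 : C).
Hypotheses (ox0 : ordinary a x0)
  (dA : \forall x \near x0, is_derive (x : C) 1 A (logder p c x * A x)).

Lemma near_solves_transfer : (\forall y \near phi x0, solves_at p' v y) ->
  \forall x \near x0, solves_at p (fun t => A t * v (phi t)) x.
Proof.
move=> /near_solves_derive[v1 [v2 V]].
have dv : \forall y \near phi x0, is_derive (y : C) 1 v (v1 y).
  by apply: nearC_imp V => y [].
have dv1 : \forall y \near phi x0, is_derive (y : C) 1 v1 (v2 y).
  by apply: nearC_imp V => y [].
have T := near_derive_transfer a0 a1 ox0 dA dv dv1.
have cont_phi : {for x0, continuous phi} := is_derive_cont (is_derive_mobius a0 a1 (ox0 (s^-1%g None))).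
have V' : \forall x \near x0, solution p' v v1 v2 (phi x) := cont_phi _ V.
apply: near_solution_solves.
apply: nearC_imp (nearC_and T (nearC_and V' (ordinary_near ox0))).
move=> x [[d1 d2] [[_ _ e] ox]]; split; [exact: d1|exact: d2|].
by rewrite (transfer_operator a0 a1 ea Hc Hconj) // e mulr0.
Qed.

End Forward.

Section Backward.
Variables (A v : C -> C) (x0 : C).
Hypotheses (ox0 : ordinary a x0) (A0 : forall x, A x != 0)
  (dA : \forall x \near x0, is_derive (x : C) 1 A (logder p c x * A x)).

Let psi y := mobius (he_a p') s^-1%g (y, 1).
Let y0 := phi x0.

Let oy0 : ordinary (he_a p') y0.
Proof. by rewrite ea; exact: ordinary_mobius. Qed.

Let psi_y0 : psi y0 = x0.
Proof. by rewrite /psi ea; exact: mobiusK. Qed.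

Let a'0 : he_a p' != 0. Proof. by rewrite ea mob_a_neq0. Qed.
Let a'1 : he_a p' != 1. Proof. by rewrite ea mob_a_neq1. Qed.

(** Only differentiability of [v] is recovered here, from v = (u / A) o psi with psi inverse to phi;
    the equation for [v] needs it first. *)
Lemma near_pullback_derive (u u1 u2 : C -> C) :
  (forall t, u t = A t * v (phi t)) ->
  (\forall x \near x0, is_derive (x : C) 1 u (u1 x)) ->
  (\forall x \near x0, is_derive (x : C) 1 u1 (u2 x)) ->
  exists v1 v2, (\forall y \near y0, is_derive (y : C) 1 v (v1 y)) /\
                (\forall y \near y0, is_derive (y : C) 1 v1 (v2 y)).
Proof.
move=> uE du du1.
pose L := logder p c; pose L' := logder' p c.
pose r x := u x / A x.
pose r1 x := u1 x / A x - L x * (u x / A x).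
pose r2 x := (u2 x / A x - L x * (u1 x / A x)) - (L x * r1 x + L' x * r x).
have dr : \forall x \near x0, is_derive (x : C) 1 r (r1 x) /\ is_derive (x : C) 1 r1 (r2 x).
  apply: nearC_imp (nearC_and (nearC_and du du1) (nearC_and dA (ordinary_near ox0))).
  move=> x [[d1 d2] [hA ox]].
  have E (b b1 A_ l : C) : A_ != 0 ->
      b * (- (l * A_) / A_ ^+ 2) + b1 * A_^-1 = b1 / A_ - l * (b / A_).
    by move=> h; field.
  have e1 : is_derive x 1 r (r1 x).
    by apply: eq_is_derive (is_deriveMC d1 (is_deriveVC (A0 x) hA)); exact: E.
  have e2 : is_derive x 1 (fun t => u1 t / A t) (u2 x / A x - L x * (u1 x / A x)).
    by apply: eq_is_derive (is_deriveMC d2 (is_deriveVC (A0 x) hA)); exact: E.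
  split; first exact: e1.
  exact: is_deriveBC e2 (is_deriveMC (is_derive_logder c ox) e1).
have dpsi y (oy : ordinary (he_a p') y) := is_derive_mobius a'0 a'1 (oy (s^-1^-1%g None)).
have cont_psi : {for y0, continuous psi} := is_derive_cont (dpsi _ oy0).
have dr' : \forall y \near y0, is_derive (psi y) 1 r (r1 (psi y)) /\ is_derive (psi y) 1 r1 (r2 (psi y)).
  have dr2 : \forall x \near psi y0, is_derive (x : C) 1 r (r1 x) /\ is_derive (x : C) 1 r1 (r2 x).
    by rewrite psi_y0.
  exact: cont_psi _ dr2.
pose m y := mob_der (he_a p') s^-1%g y.
pose m' y := - 2 * pole (he_a p') y (s^-1^-1%g None) * m y.
have oN := ordinary_near oy0.
exists (fun y => r1 (psi y) * m y), (fun y => r1 (psi y) * m' y + r2 (psi y) * m y * m y).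
have vE : \forall y \near y0, r (psi y) = v y.
  apply: nearC_imp oN => y oy; rewrite /r uE mulrC mulKf//.
  by congr v; rewrite /psi ea; apply: mobiusVK => //; rewrite -ea.
split.
  apply: nearC_imp (nearC_and dr' (nearC_and oN (near_nearby vE))).
  move=> y [[d1 _] [oy vy]]; apply: is_derive_near vy _.
  exact: is_derive_compC d1 (dpsi _ oy).
apply: nearC_imp (nearC_and dr' oN) => y [[_ d2] oy].
apply: is_deriveMC; first exact: (is_derive_compC d2 (dpsi _ oy)).
exact: is_derive_mob_der.
Qed.

Lemma near_solves_pullback :
  (\forall x \near x0, solves_at p (fun t => A t * v (phi t)) x) ->
  \forall y \near y0, solves_at p' v y.
Proof.
move=> /near_solves_derive[w1 [w2 W]].
have dw : \forall x \near x0, is_derive (x : C) 1 (fun t => A t * v (phi t)) (w1 x).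
  by apply: nearC_imp W => y [].
have dw1 : \forall x \near x0, is_derive (x : C) 1 w1 (w2 x).
  by apply: nearC_imp W => y [].
have [v1 [v2 [dv dv1]]] := near_pullback_derive (fun t => erefl) dw dw1.
have T := near_derive_transfer a0 a1 ox0 dA dv dv1.
have S : \forall x \near x0,
    v2 (phi x) + heun_P p' (phi x) * v1 (phi x) + heun_Q p' (phi x) * v (phi x) = 0.
  apply: nearC_imp (nearC_and (nearC_and (near_nearby T) (near_nearby W)) (ordinary_near ox0)).
  move=> x [[Tx Wx] ox].
  have [d1 d2] := nbhs_singleton Tx; have [_ e2 e] := nbhs_singleton Wx.
  have E1 := is_derive_unique d1 (let: And3 d _ _ := nbhs_singleton Wx in d).
  have E2 : \forall y \near x, w1 y = A y * (logder p c y * v (phi y) + mob_der a s y * v1 (phi y)).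
    by apply: nearC_imp (nearC_and Tx Wx) => y [[h1 _] [h2 _ _]]; exact: is_derive_unique h2 h1.
  have E3 := is_derive_unique (is_derive_near E2 e2) d2.
  have := transfer_operator a0 a1 ea Hc Hconj A v v1 v2 ox.
  rewrite -E3 E1 e => /esym/eqP.
  rewrite mulf_eq0 (negPf (mulf_neq0 (A0 x) _)) /= => [/eqP//|].
  by rewrite expf_neq0// mob_der_neq0//; exact: ox.
have cont_psi : {for y0, continuous psi} := is_derive_cont (is_derive_mobius a'0 a'1 (oy0 (s^-1^-1%g None))).
have S' : \forall y \near y0, v2 (phi (psi y)) + heun_P p' (phi (psi y)) * v1 (phi (psi y))
    + heun_Q p' (phi (psi y)) * v (phi (psi y)) = 0.
  have S2 : \forall x \near psi y0, v2 (phi x) + heun_P p' (phi x) * v1 (phi x)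
      + heun_Q p' (phi x) * v (phi x) = 0 by rewrite psi_y0.
  exact: cont_psi _ S2.
apply: (@near_solution_solves _ _ v1 v2).
apply: nearC_imp (nearC_and (nearC_and dv dv1) (nearC_and S' (ordinary_near oy0))).
move=> y [[d1 d2] [e oy]]; split; [exact: d1|exact: d2|].
have E : phi (psi y) = y by rewrite /psi /phi /Pmap ea; apply: mobiusVK => //; rewrite -ea.
by move: e; rewrite E.
Qed.

End Backward.

Lemma transforms_of (A : C -> C -> C) : (forall x0 x, A x0 x != 0) ->
  (forall x0, ordinary a x0 ->
    \forall x \near x0, is_derive (x : C) 1 (A x0) (logder p c x * A x0 x)) ->
  transforms p p' phi A.
Proof.
move=> A0 dA x0 h0 h1 ha v.
have ox : ordinary a x0 by apply/ordinaryP.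
split=> H.
  exact: near_solves_transfer ox (dA _ ox) H.
exact: near_solves_pullback ox (A0 x0) (dA _ ox) H.
Qed.

End TransformsOf.

(** The exponents of A_g as in [expo], but read off the original equation, so that they are
    available before the accessory parameter of [perm_act] has been identified. *)
Definition coef (h : {set flabel}) s p (d : flabel) : C :=
  match s (Some d) with
  | Some e => if e \in h then expdiff p (s^-1%g (Some e)) else 0
  | None => - (he_alpha p + \sum_(e in h) expdiff p (s^-1%g (Some e)))
  end.

Lemma sum_infinity s (F : label -> C) : F None = 0 ->
  \sum_d (if s (Some d) == None then F (Some d) else 0) = F (s^-1%g None).
Proof.
move=> F0; transitivity (\sum_l (if s l == None then F l else 0)).
  by rewrite big_label big_flabel F0 if_same add0r.
rewrite (bigD1 (s^-1%g None)) //= permKV eqxx big1 ?addr0// => l ln.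
by rewrite ifF//; apply: contra_neqF ln => /eqP <-; rewrite permK.
Qed.

Lemma log_derivative_conditionP (h : {set flabel}) s p p' :
  (forall e, expdiff p' (Some e) =
    if e \in h then - expdiff p (s^-1%g (Some e)) else expdiff p (s^-1%g (Some e))) ->
  log_derivative_condition p p' s (coef h s p).
Proof.
move=> v' i g g0; rewrite {}/i.
(* The weight at infinity collects the subtracted terms, so that the right-hand side becomes one sum
   over all labels, which [s] reindexes. *)
pose w (l : label) : C := if l is Some e then 1 - expdiff p' (Some e)
  else - \sum_e (1 - expdiff p' (Some e)).
transitivity (\sum_l w l * g (s^-1%g l)); last first.
  rewrite (big_label (fun l => w l * g (s^-1%g l))) !big_flabel /w big_flabel; ring.
have -> : \sum_l w l * g (s^-1%g l) = \sum_d w (s (Some d)) * g (Some d).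
  rewrite (reindex_inj (@perm_inj _ s)) (eq_bigr (fun l => w (s l) * g l)).
    by rewrite big_label big_flabel g0 mulr0 add0r.
  by move=> l _; rewrite permK.
rewrite -(sum_infinity s g0) mulr_sumr -sumrB; apply: eq_bigr => d _.
rewrite /coef; case sd : (s (Some d)) => [e|] /=.
  have sd' : s^-1%g (Some e) = Some d by rewrite -sd permK.
  rewrite mulr0 subr0 v' sd'; case: ifP => _; ring.
have sd' : s^-1%g None = Some d by rewrite -sd permK.
have E : \sum_e (1 - expdiff p' (Some e)) = 3 - \sum_e expdiff p (s^-1%g (Some e))
    + 2 * \sum_(e in h) expdiff p (s^-1%g (Some e)).
  rewrite [X in 2 * X]big_mkcond /= mulr_sumr -[3](_ : \sum_(e : flabel) 1 = 3); last first.
    by rewrite big_flabel; ring.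
  rewrite -sumrB -big_split /=; apply: eq_bigr => e _; rewrite v'.
  by case: ifP => _; ring.
(* For the point sent to infinity the coefficients match only through Fuchs' relation. *)
have := sum_expdiff_perm p s^-1%g; rewrite sd' => h2.
rewrite E big_flabel; move: h2.
move: (expdiff p (Some d)) (expdiff p (s^-1%g (Some l0))) (expdiff p (s^-1%g (Some l1))) (expdiff p (s^-1%g (Some la))).
move: (\sum_(e in h) _) (g (Some d)) => S G v v0 v1 va h2.
have -> : v0 + v1 + va = 2 - 2 * he_alpha p - v by rewrite -h2; ring.
ring.
Qed.

End Transforms.

Notation hact := (@Defs.act _).

(** * The actions on parameter tuples *)

Section Actions.
Variable R : realType.
Local Notation C := R[i].
Local Notation N := (@Normc.normc R).
Implicit Types (p : heun R) (s : {perm label}) (a x y z : C) (f g u v : C -> C).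

Lemma is_derive_cpow_comp (r : C -> C) (m c x : C) :
  is_derive x 1 r (m * r x) -> slit (r x) ->
  is_derive x 1 (fun t => cpow (r t) c) (c * m * cpow (r x) c).
Proof.
move=> dr sr; have r0 := slit_neq0 sr.
apply: eq_is_derive (@is_derive_compC _ (fun z => cpow z c) r x _ _ (is_derive_cpow c sr) dr).
by move: (cpow (r x) c) => w; field.
Qed.

Lemma near_slit (r : C -> C) x0 : {for x0, continuous r} -> slit (r x0) ->
  \forall x \near x0, slit (r x).
Proof. by move=> cr sr; exact: cr _ (slit_near sr). Qed.

Lemma logder_perm s p x :
  logder p (coef finset.set0 s p) x = - he_alpha p * pole (he_a p) x (s^-1%g None).
Proof.
have g0 : - he_alpha p * pole (he_a p) x None = 0 by rewrite pole_None mulr0.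
rewrite -(@sum_infinity _ s (fun l => - he_alpha p * pole (he_a p) x l) g0).
apply: eq_bigr => d _; rewrite /coef.
case: (s (Some d)) => [e|]; first by rewrite finset.in_set0 mul0r.
by rewrite eqxx big_set0 addr0.
Qed.

Lemma near_derive_perm_factor s p x0 : he_a p != 0 -> he_a p != 1 ->
  ordinary (he_a p) x0 -> \forall x \near x0, is_derive (x : C) 1 (perm_factor s p x0)
    (logder p (coef finset.set0 s p) x * perm_factor s p x0 x).
Proof.
move=> a0 a1 ox0; have oN := ordinary_near ox0.
have [si|si] := eqVneq (s None) None.
  apply: nearC_all => x; have si' : s^-1%g None = None by rewrite -{1}si permK.
  rewrite logder_perm si' pole_None mulr0 mul0r.
  rewrite (_ : perm_factor s p x0 = cst 1); first exact: is_derive_cst.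
  by apply/funext => y; rewrite /perm_factor si eqxx.
set i := s^-1%g None; set a := he_a p; set b := fun x => bracket (x, 1) (hpt a i).
have iN : None != i by apply: contra_neq si => e; rewrite [in LHS]e permKV.
have Ni : bracket (hpt a None) (hpt a i) != 0 by apply: bracket_point_neq0.
(* x' - P_s(oo) is a constant over [b x]; the quotient is 1 at [x0], hence off the branch cut
   nearby. *)
pose r x := b x0 / b x.
have E x : ordinary a x -> perm_factor s p x0 x = cpow (r x) (he_alpha p).
  move=> ox; rewrite /perm_factor (negPf si) /Pmap -/a.
  have Ex y : ordinary a y -> mobius a s (y, 1) - mobius a s (1, 0) =
      - mob_D a s / (b y * bracket (hpt a None) (hpt a i)).
    move=> oy; rewrite mobius_sub//.
    by rewrite [bracket (y, 1) (1, 0)]/bracket /= mulr0 sub0r mulr1 mulrN1.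
  suff Q : (mobius a s (x, 1) - mobius a s (1, 0)) /
      (mobius a s (x0, 1) - mobius a s (1, 0)) = r x by rewrite /= Q.
  rewrite !Ex// /r; have := mob_D_neq0 s a0 a1; rewrite -/a.
  have h1 : b x != 0 := ox _; have h2 : b x0 != 0 := ox0 _.
  move: (mob_D a s) (b x) (b x0) h1 h2 (bracket _ _) Ni => D b1 b2 h1 h2 n n0 D0.
  by field; rewrite h1 h2 n0 D0.
have dr x : ordinary a x -> is_derive x 1 r (- pole a x i * r x).
  move=> ox; have bx : b x != 0 := ox _.
  apply: eq_is_derive (is_deriveMC (is_derive_cst (b x0) x 1)
    (@is_deriveVC _ b x _ bx (is_derive_bracket (hpt a i) x))).
  by rewrite /r /pole -/(b x) /cst; move: (b x) (b x0) bx => b1 b2 h; field.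
have cr : {for x0, continuous r} := is_derive_cont (dr _ ox0).
have sr : \forall x \near x0, slit (r x).
  by apply: near_slit cr _; rewrite /r divff ?slit1//; exact: ox0.
apply: nearC_imp (nearC_and (near_nearby oN) sr) => x [oxN sx].
have ox := nbhs_singleton oxN.
apply: (@is_derive_near _ (fun t => cpow (r t) (he_alpha p))).
  by apply: nearC_imp oxN => y oy; rewrite E.
rewrite (E x ox) logder_perm.
apply: eq_is_derive (is_derive_cpow_comp (he_alpha p) (dr _ ox) sx).
by rewrite -/i -/a mulNr mulrN.
Qed.

Lemma perm_factor_neq0 s p x0 x : perm_factor s p x0 x != 0.
Proof. by rewrite /perm_factor; case: ifP => _; rewrite ?oner_neq0 ?cpow_neq0. Qed.

Lemma is_derive_ratio (z k x : C) : x != z ->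
  is_derive x 1 (fun t => (t - z) / k) ((x - z)^-1 * ((x - z) / k)).
Proof.
move=> xz; rewrite mulrA mulVf ?subr_eq0// mul1r.
by apply: (@is_derive_affine_eq _ _ _ (- z / k)) => t; ring.
Qed.

Lemma near_derive_iota_factor d p x0 : ordinary (he_a p) x0 ->
  \forall x \near x0, is_derive (x : C) 1 (iota_factor d p x0)
    (logder p (coef [set d]%SET 1 p) x * iota_factor d p x0 x).
Proof.
move=> ox0; have oN := ordinary_near ox0; set z := fpoint (he_a p) d.
have neq x : ordinary (he_a p) x -> x != z.
  by move=> /(_ (Some d)); rewrite /bracket /= mulr1 mul1r subr_eq0.
have L x : logder p (coef [set d]%SET 1 p) x = rho p d * (x - z)^-1.
  rewrite /logder (bigD1 d)//= big1 ?addr0 => [|e ed].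
    by rewrite /coef perm1 finset.in_set1 eqxx invg1 perm1 poleE.
  by rewrite /coef perm1 finset.in_set1 (negPf ed) mul0r.
have dr x : ordinary (he_a p) x -> is_derive x 1 (fun t => (t - z) / (x0 - z))
     ((x - z)^-1 * ((x - z) / (x0 - z))).
  by move=> ox; apply: is_derive_ratio; exact: neq.
have sr : \forall x \near x0, slit ((x - z) / (x0 - z)).
  apply: (@near_slit (fun t => (t - z) / (x0 - z))).
    exact: is_derive_cont (dr _ ox0).
  by rewrite divff ?slit1// subr_eq0 neq.
apply: nearC_imp (nearC_and oN sr) => x [ox sx]; rewrite L.
exact: (@is_derive_cpow_comp (fun t => (t - z) / (x0 - z)) _ (rho p d) _ (dr _ ox) sx).
Qed.

Lemma is_Hl_Hl p : generic p -> is_Hl p (Hl p).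
Proof.
move=> [a0 _ H]; rewrite /Hl; case: xgetP => [u _ //|/= no].
have [|u hu] := @Hl_exists R p a0; last by case: (no u hu).
move=> n; have [h _ _ _] := H n.+1; apply: contra_neq h => h.
have -> : he_gamma p = - n%:R by apply/eqP; rewrite -addr_eq0 addrC h.
by rewrite opprK -pmulrn -natr1 addrC.
Qed.

Lemma dnear_nearby (P : set C) : (\forall y \near (0 : C)^', P y) ->
  \forall y \near (0 : C)^', \forall z \near y, P z.
Proof.
move=> /dnear0_normcP[r r0 H]; apply/dnear0_normcP; exists r => // y yr y0.
have y0' : 0 < N y by rewrite normc_gt0.
apply/near_normcP; exists (Num.min (N y) (r - N y)) => [|h].
  by rewrite lt_min y0' subr_gt0.
rewrite lt_min => /andP[h1 h2]; apply: H.
  by apply: le_lt_trans (ler_normcD _ _) _; lra.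
apply: contraTneq h1 => e; rewrite -leNgt (_ : y = - h) ?normcNr//.
by apply/eqP; rewrite -subr_eq0 opprK e.
Qed.

Lemma dnearC_and (P Q : set C) : (\forall y \near (0 : C)^', P y) ->
  (\forall y \near (0 : C)^', Q y) -> \forall y \near (0 : C)^', P y /\ Q y.
Proof.
move=> /dnear0_normcP[r r0 H] /dnear0_normcP[d d0 H']; apply/dnear0_normcP.
exists (Num.min r d) => [|h]; first by rewrite lt_min r0.
by rewrite lt_min => /andP[h1 h2] h0; split; [exact: H|exact: H'].
Qed.

Lemma dnearC_imp (P Q : set C) : (forall y, P y -> Q y) ->
  (\forall y \near (0 : C)^', P y) -> \forall y \near (0 : C)^', Q y.
Proof.
move=> PQ /dnear0_normcP[r r0 H]; apply/dnear0_normcP; exists r => // h hr h0.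
exact/PQ/H.
Qed.

Lemma nearC_dnear (P : set C) : (\forall y \near (0 : C), P y) ->
  \forall y \near (0 : C)^', P y.
Proof.
by move=> /near0_normcP[r r0 H]; apply/dnear0_normcP; exists r => // h hr _; exact: H.
Qed.

Lemma dnearC_neq0 : \forall y \near (0 : C)^', y != 0.
Proof. by apply/dnear0_normcP; exists 1. Qed.

Lemma dnearC_ex (P : set C) : (\forall y \near (0 : C)^', P y) -> exists y, P y.
Proof.
move=> /dnear0_normcP[r r0 H]; exists ((r / 2)%:C); apply: H.
  by rewrite normc_real gtr0_norm ?divr_gt0//; lra.
by rewrite -normc_gt0 normc_real gtr0_norm divr_gt0.
Qed.

Lemma near0_ordinary a : a != 0 -> \forall x \near (0 : C)^', ordinary a x.
Proof.
move=> a0; apply/dnear0_normcP; exists (Num.min 1 (N a)).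
  by rewrite lt_min ltr01 normc_gt0.
move=> x; rewrite lt_min => /andP[x1 xa] x0; apply/ordinaryP; split => //.
  by apply: contraTneq x1 => ->; rewrite Normc.normc1 ltxx.
by apply: contraTneq xa => ->; rewrite ltxx.
Qed.

Lemma Hl_near_neq0 p : generic p -> \forall x \near (0 : C), Hl p x != 0.
Proof.
move=> /is_Hl_Hl [d h1 _]; have d0 := nbhs_singleton d.
have c0 := is_derive_cont (derivable_derive1 d0).
have /near0_normcP[r r0 H] := (continuous_normcP (Hl p) 0).1 c0 1 ltr01.
apply/near0_normcP; exists r => // x xr; have := H x xr; rewrite h1.
by apply: contraTneq => ->; rewrite sub0r normcNr Normc.normc1 ltxx.
Qed.

(** The local Heun function for [q1] is carried to [p] and back to a solution for [q2]; at a point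
    where it is nonzero, subtracting the two equations gives q1 = q2. A nonvanishing solution is
    needed, as [transforms] only speaks about solutions. *)
Lemma transforms_q_inj p p' q1 q2 (phi : C -> C) (A : C -> C -> C) :
  generic (with_q p' q1) ->
  (forall y, ordinary (he_a p') y -> exists2 x, ordinary (he_a p) x & phi x = y) ->
  transforms p (with_q p' q1) phi A -> transforms p (with_q p' q2) phi A -> q1 = q2.
Proof.
move=> gen surj T1 T2; have [_ _ S] := is_Hl_Hl gen.
have [a0 _ _] := gen; set v := Hl _ in S.
have [y [[Sy v0] oy]] := dnearC_ex (dnearC_and (dnearC_and (dnear_nearby S)
   (nearC_dnear (Hl_near_neq0 gen))) (near0_ordinary a0)).
have [x /ordinaryP[h0 h1 ha] xy] := surj y oy.
have S2 : \forall z \near y, solves_at (with_q p' q2) v z.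
  by rewrite -xy; apply/(T2 x h0 h1 ha); apply/(T1 x h0 h1 ha); rewrite xy.
have [_ _ e1] := nbhs_singleton Sy; have [_ _ e2] := nbhs_singleton S2.
move: e1; rewrite -{}e2 => /addrI /eqP; rewrite (inj_eq (mulIf v0)).
move: oy => /ordinaryP[/= y0 y1 ya].
rewrite (inj_eq (mulIf _)) ?invr_eq0 ?mulf_neq0 ?subr_eq0//.
by rewrite (inj_eq (addrI _)) eqr_opp => /eqP.
Qed.

Lemma nonintegerN z : noninteger z -> noninteger (- z).
Proof. by move=> H n; rewrite eqr_oppLR -rmorphN; exact: H. Qed.

Lemma perm_act_spec s p : generic p ->
  [/\ he_a (perm_act s p) = mob_a (he_a p) s,
      forall l, expdiff (perm_act s p) l = expdiff p (s^-1%g l),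
      heun_conj p s (perm_act s p) & generic (perm_act s p)].
Proof.
move=> gen; have [a0 a1 Hv] := (genericE p).1 gen.
have gq q : generic (with_q (perm_exponents s p) q).
  apply/genericE; split; [exact: mob_a_neq0|exact: mob_a_neq1|move=> l].
  by rewrite expdiff_with_q expdiff_perm_exponents; exact: Hv.
have [q cq] := conjugate_exists s a0 a1.
suff -> : perm_act s p = with_q (perm_exponents s p) q.
  split => //; first by move=> l; rewrite expdiff_with_q expdiff_perm_exponents.
rewrite /perm_act /set_q; congr with_q.
have T : transforms p (with_q (perm_exponents s p) q) (Pmap s p) (perm_factor s p).
  apply: (@transforms_of _ _ _ s (coef finset.set0 s p)) => //.
  - apply: log_derivative_conditionP => e.
    by rewrite finset.in_set0 expdiff_with_q expdiff_perm_exponents.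
  - by move=> x0 x; exact: perm_factor_neq0.
  - by move=> x0; exact: near_derive_perm_factor.
case: xgetP => [q' _ /= T'|/= no]; last by case: (no q T).
apply: (transforms_q_inj _ _ T' T); first exact: gq.
move=> y oy; exists (mobius (mob_a (he_a p) s) s^-1%g (y, 1)).
  have := @ordinary_mobius _ _ s^-1%g (mob_a_neq0 s a0 a1) (mob_a_neq1 s a0 a1) y oy.
  by rewrite mob_aK.
exact: mobiusVK.
Qed.

Lemma iota_act_spec d p : generic p ->
  [/\ he_a (iota_act d p) = he_a p,
      forall l, expdiff (iota_act d p) l =
        if (l == Some d) || (l == None) then - expdiff p l else expdiff p l,
      heun_conj p 1 (iota_act d p) & generic (iota_act d p)].
Proof.
move=> gen; have [a0 a1 Hv] := (genericE p).1 gen.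
have gq q : generic (with_q (iota_exponents d p) q).
  apply/genericE; split; [exact: a0|exact: a1|move=> l].
  rewrite expdiff_with_q expdiff_iota_exponents; case: ifP => _; last exact: Hv.
  exact/nonintegerN/Hv.
have [q cq0] := conjugate_iota d p.
have cq : heun_conj p 1 (with_q (iota_exponents d p) q).
  by move=> x ox; rewrite mob_der1 expr1n mul1r /Pmap mobius1 cq0.
suff -> : iota_act d p = with_q (iota_exponents d p) q.
  by split => // l; rewrite expdiff_with_q expdiff_iota_exponents.
rewrite /iota_act /set_q; congr with_q.
have P1 : Pmap 1 p = id by apply/funext => x; exact: mobius1.
have T : transforms p (with_q (iota_exponents d p) q) id (iota_factor d p).
  rewrite -P1; apply: (@transforms_of _ _ _ 1 (coef [set d]%SET 1 p)) => //.
  - by rewrite mob_a1.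
  - apply: log_derivative_conditionP => e.
    by rewrite finset.in_set1 expdiff_with_q expdiff_iota_exponents invg1 perm1 (inj_eq Some_inj) orbF.
  - by move=> x0 x; exact: cpow_neq0.
  - by move=> x0; exact: near_derive_iota_factor.
case: xgetP => [q' _ /= T'|/= no]; last by case: (no q T).
apply: (transforms_q_inj _ _ T' T); first exact: gq.
by move=> y oy; exists y.
Qed.

(** Every iota_d flips the sign at d and at infinity, so the sign at infinity is the parity of the
    subset and the total is even. *)
Definition sgn (g : gasym) (l : label) : bool :=
  if l is Some e then e \in g.1 else odd #|g.1|.

Lemma foldr_iota_spec (r : seq flabel) p s p1 : uniq r -> generic p1 ->
  he_a p != 0 -> he_a p != 1 ->
  he_a p1 = mob_a (he_a p) s -> heun_conj p s p1 ->
  let p2 := foldr (@iota_act R) p1 r in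
  [/\ he_a p2 = mob_a (he_a p) s,
      forall l, expdiff p2 l = if (if l is Some e then e \in r else odd (size r))
                          then - expdiff p1 l else expdiff p1 l,
      heun_conj p s p2 & generic p2].
Proof.
move=> ur gen1 a0 a1 ea cj; elim: r ur => [_|d r IH /= /andP[dr ur]] /=.
  by split => // -[].
have [e1 e2 e3 e4] := IH ur; have [f1 f2 f3 f4] := iota_act_spec d e4.
split; [exact: e1| |by have := conjugate_comp a0 a1 e1 e3 f3; rewrite mulg1|exact: f4].
case=> [e|]; rewrite f2 e2 /=; last by case: ifP => _; rewrite ?opprK.
rewrite (inj_eq Some_inj) orbF in_cons; have [->|//] := eqVneq e d.
by rewrite (negPf dr).
Qed.

Lemma act_spec (g : gasym) p : generic p ->
  [/\ he_a (hact g p) = mob_a (he_a p) g.2,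
      forall l, expdiff (hact g p) l =
        if sgn g l then - expdiff p (g.2^-1%g l) else expdiff p (g.2^-1%g l),
      heun_conj p g.2 (hact g p) & generic (hact g p)].
Proof.
move=> gen; have [a0 a1 _] := gen; have [e1 e2 e3 e4] := perm_act_spec g.2 gen.
have [f1 f2 f3 f4] := foldr_iota_spec (enum_uniq (mem g.1)) e4 a0 a1 e1 e3.
split => //; case=> [e|]; rewrite /Defs.act f2 e2 /sgn.
  by rewrite mem_enum.
by rewrite -cardE.
Qed.

(** This is how two actions are shown to agree without computing accessory parameters: being
    conjugate to the same equation by the same map, both have the same invariant. *)
Lemma heun_conj_inj p s p1 p2 : he_a p != 0 -> he_a p != 1 ->
  he_a p1 = mob_a (he_a p) s -> he_a p2 = mob_a (he_a p) s ->
  expdiff p1 =1 expdiff p2 -> heun_conj p s p1 -> heun_conj p s p2 -> p1 = p2.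
Proof.
move=> a0 a1 e1 e2 ev c1 c2.
have [x ox] := ordinary_exists (he_a p).
have p1E := with_q_eq (etrans e1 (esym e2)) ev.
have p2E : p2 = with_q p2 (he_q p2) by case: (p2).
have m0 : mob_der (he_a p) s x ^+ 2 != 0.
  by rewrite expf_neq0// mob_der_neq0//; exact: ox.
have := c2 x ox; rewrite (c1 x ox) => /(mulfI m0); rewrite p1E {2}p2E => /heun_I_q_inj h.
rewrite p1E h -?p2E//; rewrite e2; exact: ordinary_mobius.
Qed.

Lemma expoE (g : gasym) p : generic p -> expo g p = coef g.1 g.2 p.
Proof.
move=> gen; have [_ ev _ _] := perm_act_spec g.2 gen.
have E e : rho (perm_act g.2 p) e = expdiff p (g.2^-1%g (Some e)) by rewrite -ev.
apply/funext => d; rewrite /expo /coef; case: (g.2 (Some d)) => [e|].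
  by rewrite E.
by congr (- (_ + _)); apply: eq_bigr => e _; rewrite E.
Qed.

End Actions.

(** * The local solutions and the equivalent expressions for Hl *)

Section LocalSolutions.
Variable R : realType.
Local Notation C := R[i].
Local Notation N := (@Normc.normc R).
Implicit Types (p : heun R) (s : {perm label}) (a x y z : C) (u v : C -> C) (g : gasym).

Lemma is_derive_prod (I : finType) (P : pred I) (f : I -> C -> C) (m : I -> C) x :
  (forall i, P i -> is_derive x 1 (f i) (m i * f i x)) ->
  is_derive x 1 (fun t => \prod_(i | P i) f i t)
    ((\sum_(i | P i) m i) * \prod_(i | P i) f i x).
Proof.
move=> H; elim: (index_enum I) => [|i r IH].
  rewrite !big_nil mul0r.
  rewrite (_ : (fun t => _) = cst 1); first exact: is_derive_cst.
  by apply/funext => t; rewrite big_nil.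
rewrite !big_cons; case: ifP => Pi.
  have D := is_deriveMC (H i Pi) IH.
  rewrite (_ : (fun t => \prod_(j <- i :: r | P j) f j t) =
    (fun t => f i t * \prod_(j <- r | P j) f j t)); last first.
    by apply/funext => t; rewrite big_cons Pi.
  apply: eq_is_derive D; move: (\sum_(_ <- _ | _) _) (\prod_(_ <- _ | _) _) => *; ring.
rewrite (_ : (fun t => \prod_(j <- i :: r | P j) f j t) =
  (fun t => \prod_(j <- r | P j) f j t)); first exact: IH.
by apply/funext => t; rewrite big_cons Pi.
Qed.

Lemma logderE p c x : logder p c x = \sum_d c d / (x - fpoint (he_a p) d).
Proof. by apply: eq_bigr => d _; rewrite poleE. Qed.

Lemma is_derive_prod_cpow a (c : flabel -> C) b x :
  (forall d, d != b -> N (x - fpoint a b) < N (fpoint a b - fpoint a d)) ->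
  is_derive x 1
    (fun t => \prod_(d | d != b) cpow ((t - fpoint a d) / (fpoint a b - fpoint a d)) (c d))
    ((\sum_(d | d != b) c d / (x - fpoint a d))
     * \prod_(d | d != b) cpow ((x - fpoint a d) / (fpoint a b - fpoint a d)) (c d)).
Proof.
set z := fpoint a => hd; apply: is_derive_prod => d db.
have nn := hd d db.
have n0 : 0 < N (z b - z d) := le_lt_trans (normc_ge0 _) nn.
have zz : z b - z d != 0 by rewrite -normc_gt0.
have sd : slit ((x - z d) / (z b - z d)).
  have -> : (x - z d) / (z b - z d) = 1 - (z b - x) / (z b - z d) by field.
  apply: slit_1B; rewrite Normc.normcM Normc.normcV ltr_pdivrMr// mul1r.
  by rewrite -normcNr opprB.
have xd : x != z d.
  by apply: contraTneq (slit_neq0 sd) => ->; rewrite subrr mul0r eqxx.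
exact: (@is_derive_cpow_comp _ (fun t => (t - z d) / (z b - z d)) _ (c d) _
  (is_derive_ratio _ xd) sd).
Qed.

(** With exponent 0 at the base point the power there is constantly 1 and has no branch cut; this
    case includes the base point itself. The distance condition keeps the other ratios in the unit
    disc around 1. *)
Lemma is_derive_prefactor_finite g p b x : g.2^-1%g (Some l0) = Some b ->
  (slit (x - fpoint (he_a p) b) \/ expo g p b = 0) ->
  (forall d, d != b -> N (x - fpoint (he_a p) b)
                       < N (fpoint (he_a p) b - fpoint (he_a p) d)) ->
  is_derive x 1 (prefactor g p) (logder p (expo g p) x * prefactor g p x).
Proof.
move=> gb hb hd; set z := fpoint (he_a p) in hb hd *; set c := expo g p in hb *.
rewrite (_ : prefactor g p = fun x => cpow (x - z b) (c b)
   * \prod_(d | d != b) cpow ((x - z d) / (z b - z d)) (c d)); last first.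
  by apply/funext => t; rewrite /prefactor gb.
have D1 : is_derive x 1 (fun t => cpow (t - z b) (c b))
    (c b / (x - z b) * cpow (x - z b) (c b)).
  case: hb => [sb|->].
    apply: (@is_derive_cpow_comp _ (fun t => t - z b)) => //.
    rewrite mulVf ?slit_neq0//.
    by apply: (@is_derive_affine_eq _ _ _ (- z b)) => t; ring.
  rewrite !mul0r (_ : (fun t => _) = cst 1); first exact: is_derive_cst.
  by apply/funext => t; rewrite cpow0r.
have D3 := is_derive_prod_cpow c hd.
apply: eq_is_derive (is_deriveMC D1 D3).
have -> : logder p c x = c b / (x - z b) + \sum_(d | d != b) c d / (x - z d).
  by rewrite logderE (bigD1 b).
by move: (\sum_(_ | _) _) (\prod_(_ | _) _) (cpow _ (c b)) (c b / _) => *; ring.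
Qed.

Lemma is_derive_inv x : x != 0 -> is_derive x 1 (fun t : C => t^-1) (- x^-1 * x^-1).
Proof.
move=> x0; apply: eq_is_derive (@is_deriveVC _ id x 1 x0 (is_derive_id x 1)).
by rewrite /=; field.
Qed.

Lemma is_derive_prefactor_infinite g p x : g.2^-1%g (Some l0) = None ->
  slit x^-1 -> (forall d, N (fpoint (he_a p) d / x) < 1) ->
  is_derive x 1 (prefactor g p) (logder p (expo g p) x * prefactor g p x).
Proof.
move=> gb sx hd; set z := fpoint (he_a p) in hd *; set c := expo g p.
rewrite (_ : prefactor g p = fun x => cpow x^-1 (- \sum_d c d)
   * \prod_d cpow (1 - z d / x) (c d)); last first.
  by apply/funext => t; rewrite /prefactor gb.
have x0 : x != 0 by rewrite -invr_eq0 slit_neq0.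
have D0 := is_derive_inv x0.
have D1 := @is_derive_cpow_comp _ (fun t => t^-1) _ (- \sum_d c d) _ D0 sx.
have nx d : x - z d != 0.
  have := slit_neq0 (slit_1B (hd d)); apply: contraNneq => e.
  by rewrite -(subr0_eq e) divff// subrr.
have D2 d : true -> is_derive x 1 (fun t => cpow (1 - z d / t) (c d))
    (c d * ((x - z d)^-1 - x^-1) * cpow (1 - z d / x) (c d)).
  move=> _; apply: (@is_derive_cpow_comp _ (fun t => 1 - z d / t)); last exact: slit_1B.
  have D4 := @is_deriveMC _ (cst (z d)) (fun t => t^-1) x _ _ (is_derive_cst (z d) x 1) D0.
  have D5 := @is_deriveBC _ (cst 1) (fun t => z d / t) x _ _ (is_derive_cst (1 : C) x 1) D4.
  by apply: eq_is_derive D5; rewrite /cst; field; rewrite x0 nx.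
have D3 := is_derive_prod D2.
apply: eq_is_derive (is_deriveMC D1 D3).
have -> : \sum_d c d * ((x - z d)^-1 - x^-1) = logder p c x - (\sum_d c d) * x^-1.
  by rewrite logderE mulr_suml -sumrB; apply: eq_bigr => d _; rewrite mulrBr.
by move: (\sum_(_ | _) _) (logder _ _ _) (\prod_(_ | _) _) (cpow _ _) => *; ring.
Qed.

Lemma all_flabel_near (P : flabel -> C -> Prop) :
  (forall d, \forall t \near (0 : C)^', P d t) ->
  \forall t \near (0 : C)^', forall d, P d t.
Proof.
move=> H; apply: dnearC_imp (dnearC_and (H l0) (dnearC_and (H l1) (H la))).
by move=> t [h0 [h1 ha]] d; elim/flabelP: d.
Qed.

Lemma all_flabel_nearC (P : flabel -> C -> Prop) x :
  (forall d, \forall t \near x, P d t) -> \forall t \near x, forall d, P d t.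
Proof.
move=> H; apply: nearC_imp (nearC_and (H l0) (nearC_and (H l1) (H la))).
by move=> t [h0 [h1 ha]] d; elim/flabelP: d.
Qed.

Lemma near_normc_lt x z (r : R) : N (x - z) < r -> \forall y \near x, N (y - z) < r.
Proof.
move=> h; apply/near_normcP; exists (r - N (x - z)) => [|k hk]; first by rewrite subr_gt0.
by rewrite addrAC; apply: le_lt_trans (ler_normcD _ _) _; lra.
Qed.

Section Base.
Variables (g : gasym) (p : heun R).
Hypothesis gen : generic p.
Local Notation a := (he_a p).
Let a0 : a != 0. Proof. by have [] := gen. Qed.
Let a1 : a != 1. Proof. by have [] := gen. Qed.
Let s := g.2.
Let phi := Pmap s p.
Let i := s^-1%g None.

Lemma fpoint_inj d e : d != e -> 0 < N (fpoint a d - fpoint a e).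
Proof.
move=> de; rewrite normc_gt0.
have := @bracket_point_neq0 _ a (Some d) (Some e) a0 a1.
by rewrite (inj_eq Some_inj) /bracket /= mulr1 mul1r; apply.
Qed.

Lemma base_ordinary : \forall t \near (0 : C)^', ordinary a (base_chart g p t).
Proof.
rewrite /base_chart; case gb : (g.2^-1%g (Some l0)) => [b|].
  have H d : \forall t \near (0 : C)^', fpoint a b + t != fpoint a d.
    have [<-|db] := eqVneq b d.
      apply: dnearC_imp (@dnearC_neq0 R) => t t0.
      by rewrite -subr_eq0 addrAC subrr add0r.
    apply/dnear0_normcP; exists (N (fpoint a b - fpoint a d)); first exact: fpoint_inj.
    move=> t h _; apply: contraTneq h => e; rewrite -leNgt (_ : _ - _ = - t) ?normcNr//.
    by rewrite -e opprD addrA subrr sub0r.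
  apply: dnearC_imp (all_flabel_near H) => t ht.
  by apply/ordinaryP; split; [exact: (ht l0)|exact: (ht l1)|exact: (ht la)].
apply/dnear0_normcP; exists (Num.min 1 (N a)^-1).
  by rewrite lt_min ltr01 invr_gt0 normc_gt0.
move=> t; rewrite lt_min => /andP[t1 ta] t0; apply/ordinaryP; split.
- by rewrite invr_eq0.
- by apply: contraTneq t1 => /(congr1 GRing.inv); rewrite invrK invr1 => ->; rewrite Normc.normc1 ltxx.
- by apply: contraTneq ta => <-; rewrite Normc.normcV invrK ltxx.
Qed.

Lemma mobius_base0 b : s^-1%g (Some l0) = Some b -> phi (fpoint a b) = 0.
Proof.
move=> sb; rewrite /phi /Pmap /mobius sb /bracket /= mulr1 mul1r subrr.
by rewrite !mul0r.
Qed.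

Lemma base_phi (r : R) : 0 < r ->
  \forall t \near (0 : C)^', N (phi (base_chart g p t)) < r.
Proof.
move=> r0; rewrite /base_chart; case gb : (g.2^-1%g (Some l0)) => [b|].
  have ib : Some b != i by rewrite /i -gb (inj_eq perm_inj).
  have Zb : bracket (fpoint a b, 1) (hpt a i) != 0 by apply: (@bracket_point_neq0 _ a (Some b)).
  have c0 := is_derive_cont (is_derive_mobius a0 a1 Zb).
  have /near_normcP[d d0 H] := (continuous_normcP _ _).1 c0 r r0.
  apply/dnear0_normcP; exists d => // t td _.
  by have := H t td; rewrite -/phi; have := mobius_base0 gb; rewrite /phi /Pmap => ->; rewrite subr0.
case si : i => [c|]; last by have /perm_inj := etrans si (esym gb).
set z := fpoint a c.
pose k := bracket (hpt a (s^-1%g (Some l1))) (hpt a i) /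
          bracket (hpt a (s^-1%g (Some l1))) (hpt a (s^-1%g (Some l0))).
(* In the coordinate t = 1 / x the map is visibly small near infinity. *)
have E t : t != 0 -> N (z * t) < 1 -> phi t^-1 = - k * t / (1 - z * t).
  move=> t0 /slit_1B/slit_neq0 zt; rewrite /phi /Pmap /mobius -/i -/s gb /k gb.
  rewrite [bracket (t^-1, 1) (hpt a None)]/bracket /= mulr0 sub0r mulr1.
  rewrite si [bracket (t^-1, 1) (hpt a (Some c))]/bracket /= mulr1 mul1r -/z.
  have n0 : bracket (hpt a (s^-1%g (Some l1))) (1, 0) != 0.
    by rewrite -[(1, 0)]/(hpt a None) -gb; apply: bracket_point_neq0 => //; rewrite (inj_eq perm_inj).
  rewrite /=; move: (bracket _ (1, 0)) n0 (bracket _ _) => b1 n0 b2.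
  have t1 : t^-1 - z != 0.
    by rewrite (_ : t^-1 - z = (1 - z * t) / t) ?mulf_neq0 ?invr_eq0//; field.
  have -> : t^-1 - z = (1 - z * t) / t by field.
  by field; rewrite zt n0 t0.
have k1 : 0 < 2 * N k + 1 by rewrite ltr_wpDl ?mulr_ge0 ?normc_ge0.
have z1 : 0 < 2 * N z + 1 by rewrite ltr_wpDl ?mulr_ge0 ?normc_ge0.
apply/dnear0_normcP; exists (Num.min (r / (2 * N k + 1)) (1 / (2 * N z + 1))).
  by rewrite lt_min !divr_gt0.
move=> t; rewrite lt_min !ltr_pdivlMr// => /andP[h1 h2] t0.
have Nt : 0 < N t by rewrite normc_gt0.
have zt : N (z * t) < 1 / 2 by rewrite Normc.normcM; lra.
rewrite E//; last by lra.
rewrite Normc.normcM Normc.normcV Normc.normcM normcNr.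
have w : 1 / 2 < N (1 - z * t).
  have := normcDl 1 (- (z * t)); rewrite normcNr Normc.normc1; lra.
rewrite ltr_pdivrMr; last by lra.
have : r / 2 < r * N (1 - z * t) by rewrite ltr_pM2l//; lra.
lra.
Qed.

(** The first alternative serves all local solutions, the second those that are analytic at a finite
    base point, where the full punctured neighbourhood is needed to compare with Hl. *)
Lemma near_solves_U : \forall t \near (0 : C)^',
  (slit t \/ exists2 b, g.2^-1%g (Some l0) = Some b & expo g p b = 0) ->
  solves_at p (U g p) (base_chart g p t).
Proof.
have [e1 e2 e3 e4] := act_spec g gen; set p' := hact g p in e1 e2 e3 e4.
have [_ _ S] := is_Hl_Hl e4.
have /dnear0_normcP[r r0 Sr] := dnear_nearby S.
have Hc : log_derivative_condition p p' s (expo g p).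
  rewrite expoE//; apply: log_derivative_conditionP => e; rewrite e2 /sgn.
  by case: ifP.
have oB := base_ordinary.
suff D : \forall t \near (0 : C)^',
    (slit t \/ exists2 b, g.2^-1%g (Some l0) = Some b & expo g p b = 0) ->
    \forall x \near base_chart g p t,
      is_derive (x : C) 1 (prefactor g p) (logder p (expo g p) x * prefactor g p x).
  apply: dnearC_imp (dnearC_and D (dnearC_and oB (base_phi r0))).
  move=> t [Dt [ot pt]] ht.
  have oy : ordinary (he_a p') (phi (base_chart g p t)).
    by rewrite e1; exact: ordinary_mobius.
  have y0 : phi (base_chart g p t) != 0 by move: oy => /ordinaryP[].
  have V := Sr _ pt y0.
  have := near_solves_transfer a0 a1 e1 Hc e3 ot (Dt ht) V.
  exact: nbhs_singleton.
rewrite /base_chart; case gb : (g.2^-1%g (Some l0)) => [b|].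
  have H d : \forall t \near (0 : C)^', d != b -> N t < N (fpoint a b - fpoint a d).
    have [->|db] := eqVneq d b.
      by apply/dnear0_normcP; exists 1 => // t _ _; rewrite eqxx.
    apply/dnear0_normcP; exists (N (fpoint a b - fpoint a d)) => //.
    by apply: fpoint_inj; rewrite eq_sym.
  apply: dnearC_imp (all_flabel_near H) => t ht hs.
  set z := fpoint a b; have zt : z + t - z = t by rewrite addrAC subrr add0r.
  have n1 : \forall x \near (z + t), forall d, d != b -> N (x - z) < N (z - fpoint a d).
    apply: all_flabel_nearC => d; have [->|db] := eqVneq d b.
      by apply: nearC_all => x /=; rewrite ?eqxx.
    have := @near_normc_lt (z + t) z (N (z - fpoint a d)); rewrite zt => /(_ (ht d db)).
    by apply: nearC_imp.
  have n2 : \forall x \near (z + t), slit (x - z) \/ expo g p b = 0.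
    case: hs => [st|[b' [<-] e]]; last by apply: nearC_all => x; right.
    have := @near_slit _ (fun x => x - z) (z + t); rewrite zt => H2.
    apply: nearC_imp (H2 _ st) => [x|]; first by left.
    exact: is_derive_cont (@is_derive_affine_eq _ (fun x => x - z) 1 (- z) (z + t) (fun x => congr1 (fun y => y - z) (esym (mul1r x)))).
  apply: nearC_imp (nearC_and n1 n2) => x [h1 h2].
  exact: is_derive_prefactor_finite gb h2 h1.
have H d : \forall t \near (0 : C)^', N (fpoint a d * t) < 1.
  have z1 : 0 < N (fpoint a d) + 1 by rewrite ltr_wpDl ?normc_ge0.
  apply/dnear0_normcP; exists (1 / (N (fpoint a d) + 1)); first by rewrite divr_gt0.
  move=> t; rewrite ltr_pdivlMr// => ht _; rewrite Normc.normcM mulrC.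
  by apply: le_lt_trans ht; rewrite ler_wpM2l ?normc_ge0// lerDl.
apply: dnearC_imp (dnearC_and (all_flabel_near H) (@dnearC_neq0 R)) => t [ht t0].
case=> [st|[b' //]].
have ti0 : t^-1 != 0 by rewrite invr_eq0.
have cinv := is_derive_inv ti0.
have n1 : \forall x \near t^-1, slit x^-1.
  by apply: (near_slit (is_derive_cont cinv)); rewrite invrK.
have n2 : \forall x \near t^-1, forall d, N (fpoint a d / x) < 1.
  apply: all_flabel_nearC => d.
  have cd := is_derive_cont (is_deriveMC (is_derive_cst (fpoint a d) t^-1 1) cinv).
  have h : \forall y \near fpoint a d / t^-1, N (y - 0) < 1.
    by apply: near_normc_lt; rewrite subr0 invrK; exact: ht.
  by apply: nearC_imp (cd _ h) => x; rewrite /= subr0.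
apply: nearC_imp (nearC_and n1 n2) => x [h1 h2].
exact: is_derive_prefactor_infinite gb h1 h2.
Qed.

Lemma local_solutionP : local_solution g p.
Proof.
have [_ _ _ e4] := act_spec g gen; split; first exact: is_Hl_Hl.
by apply: dnearC_imp near_solves_U => t H st; apply: H; left.
Qed.

End Base.
End LocalSolutions.

(** * Which local solutions equal the local Heun function *)

Section Equivalence.
Variable R : realType.
Local Notation C := R[i].
Local Notation N := (@Normc.normc R).
Implicit Types (p : heun R) (s : {perm label}) (a x y z : C) (u v : C -> C) (g : gasym).

Lemma near_comp (f : C -> C) (P : set C) x : {for x, continuous f} ->
  (\forall y \near f x, P y) -> \forall y \near x, P (f y).
Proof. by move=> cf; apply: cf. Qed.

Lemma near_neq0 (f : C -> C) x : {for x, continuous f} -> f x != 0 ->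
  \forall y \near x, f y != 0.
Proof.
move=> /continuous_normcP cf fx.
apply: nearC_imp (cf _ (etrans (normc_gt0 _) fx)) => y.
by apply: contraTneq => ->; rewrite sub0r normcNr ltxx.
Qed.

Lemma eq0_along_reals (f : C -> C) : {for 0, continuous f} ->
  (\forall t \near (0 : C), forall r : R, 0 < r -> t = r%:C -> f t = 0) -> f 0 = 0.
Proof.
move=> cf h; apply/eqP/negPn/negP => f0.
have /near0_normcP[r r0 H] := nearC_and (near_neq0 cf f0) h.
have r2 : 0 < r / 2 by rewrite divr_gt0.
have [|n0 n1] := H (r / 2)%:C.
  by rewrite normc_real gtr0_norm//; lra.
by move: n0; rewrite (n1 _ r2 erefl) eqxx.
Qed.

Lemma clog_real (t : R) : 0 < t -> clog t%:C = (ln t)%:C.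
Proof.
move=> t0; have st : slit t%:C by rewrite slitE normc_real gtr0_norm//= addr_gt0.
by rewrite /clog cargE// normc_real gtr0_norm//= mul0r atan0 mulr0.
Qed.

Lemma clog_imaginary (t : R) : 0 < t -> clog ('i * t%:C) = ln t +i* (pi / 2).
Proof.
move=> t0; have E : 'i * t%:C = 0 +i* t by rewrite /GRing.mul /= !mul0r !mul1r subr0 add0r.
have nE : N (0 +i* t) = t by rewrite /= expr0n add0r sqrtr_sqr gtr0_norm.
have st : slit (0 +i* t) by rewrite slitE nE addr0.
rewrite E /clog cargE// nE /= addr0 divff ?gt_eqF// atan1.
by congr (_ +i* _); lra.
Qed.

Section BaseAtZero.
Variables (g : gasym) (p : heun R).
Hypotheses (gen : generic p) (gb : g.2^-1%g (Some l0) = Some l0).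
Local Notation a := (he_a p).
Let a0 : a != 0. Proof. by have [] := gen. Qed.
Let a1 : a != 1. Proof. by have [] := gen. Qed.
Let H x := Hl (hact g p) (Pmap g.2 p x).

Let bracket0 : bracket (0, 1) (hpt a (g.2^-1%g None)) != 0.
Proof. by apply: (@bracket_point_neq0 _ a (Some l0)); rewrite // -gb (inj_eq perm_inj). Qed.

Lemma near_bracket0 :
  \forall x \near (0 : C), bracket (x, 1) (hpt a (g.2^-1%g None)) != 0.
Proof. exact: near_neq0 (is_derive_cont (is_derive_bracket _ 0)) bracket0. Qed.

Lemma Pmap_at0 : Pmap g.2 p 0 = 0.
Proof. exact: mobius_base0 gb. Qed.

Lemma continuous_Pmap0 : {for 0, continuous (Pmap g.2 p)}.
Proof. exact: is_derive_cont (is_derive_mobius a0 a1 bracket0). Qed.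

Lemma near_derive_Hl_Pmap : \forall x \near (0 : C), exists m, is_derive (x : C) 1 H m.
Proof.
have [_ _ _ g'] := act_spec g gen; have [dH _ _] := is_Hl_Hl g'.
have {}dH : \forall y \near Pmap g.2 p 0, derivable (Hl (hact g p)) y 1 by rewrite Pmap_at0.
have nH := near_comp continuous_Pmap0 dH.
apply: nearC_imp (nearC_and near_bracket0 nH) => x [bx dx].
have dm : is_derive (x : C) 1 (Pmap g.2 p) (mob_der a g.2 x) := is_derive_mobius a0 a1 bx.
exists (((Hl (hact g p))^`()%classic (Pmap g.2 p x)) * mob_der a g.2 x).
exact: (@is_derive_compC _ (Hl (hact g p)) (Pmap g.2 p) x _ _ (derivable_derive1 dx) dm).
Qed.

Lemma Hl_Pmap0 : H 0 = 1.
Proof. by have [_ _ _ /is_Hl_Hl[_ h _]] := act_spec g gen; rewrite /H Pmap_at0. Qed.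

Lemma near0_base x0 : x0 = 0 -> \forall x \near x0, forall d, d != l0 ->
  N (x - fpoint a l0) < N (fpoint a l0 - fpoint a d).
Proof.
move=> ->; apply: all_flabel_nearC => d; have [->|dl] := eqVneq d l0.
  by apply: nearC_all => x /=; rewrite ?eqxx.
have h : \forall x \near (0 : C), N (x - fpoint a l0) < N (fpoint a l0 - fpoint a d).
  by apply: near_normc_lt; rewrite subr0 Normc.normc0 fpoint_inj// eq_sym.
by apply: nearC_imp h.
Qed.

Lemma base_ratio0 d : d != l0 -> (0 - fpoint a d) / (fpoint a l0 - fpoint a d) = 1.
Proof.
move=> dl; have h : 0 < N (fpoint a l0 - fpoint a d) by rewrite fpoint_inj// eq_sym.
by apply: divff; rewrite -normc_gt0.
Qed.

Lemma U_is_Hl : l0 \notin g.1 -> is_Hl p (U g p).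
Proof.
move=> hl; have c0 : expo g p l0 = 0.
  by rewrite /expo -{1}gb permKV (negPf hl).
split.
- apply: nearC_imp (nearC_and near_derive_Hl_Pmap (near0_base erefl)) => x [[m dm] hx].
  by have [] := is_deriveMC (is_derive_prefactor_finite gb (or_intror c0) hx) dm.
- rewrite /U -/(H 0) Hl_Pmap0 mulr1 /prefactor gb c0 cpow0r mul1r big1// => d dl.
  by rewrite base_ratio0 ?cpow1.
- apply: dnearC_imp (near_solves_U g gen) => t /(_ (or_intror _)).
  rewrite /base_chart gb [fpoint a l0]/(0 : C) add0r; apply.
  by exists l0.
Qed.

Lemma U_equivalent : l0 \notin g.1 -> equivalent g p.
Proof.
move=> hl; split=> //; have [_ _ h] := gen.
apply: Hl_unique (U_is_Hl hl) (is_Hl_Hl gen) => [n|]; last exact: a0.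
by have [] := h n.
Qed.

(* Along the positive reals and along i times them, x ^ rho tends to 1 if U_g
   = Hl, which makes i ^ rho equal to 1. *)
Lemma U_not_equivalent : l0 \in g.1 -> ~ equivalent g p.
Proof.
move=> hl [_ E].
have [_ _ vg] := (genericE p).1 gen.
have [_ ev _ _] := perm_act_spec g.2 gen.
(* An opaque name for the imaginary unit, a plain variable for [ring] and [field]; [jE] restores its
   value where that matters. *)
have [j jE] : exists j : C, j = 'i%C by exists 'i%C.
set r := expo g p l0; have rE : r = expdiff p (Some l0).
  have gl : g.2 (Some l0) = Some l0 by rewrite -{1}gb permKV.
  by have := ev (Some l0); rewrite gb /r /expo gl hl => <-.
set c := expo g p in r rE; pose G x := (\prod_(d | d != l0)
  cpow ((x - fpoint a d) / (fpoint a l0 - fpoint a d)) (c d)) * H x.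
have G0 : G 0 = 1.
  rewrite /G Hl_Pmap0 mulr1 big1// => d dl.
  by rewrite base_ratio0 ?cpow1.
have [m dG] : exists m, is_derive (0 : C) 1 G m.
  have [m dm] := nbhs_singleton near_derive_Hl_Pmap.
  have D := is_derive_prod_cpow c (nbhs_singleton (near0_base (erefl 0))).
  by eexists; exact: (is_deriveMC D dm).
have [dh h0 _] := is_Hl_Hl gen; have df := derivable_derive1 (nbhs_singleton dh).
set f := Hl p in E h0 df.
set K := cexp (r * (j * (pi / 2)%:C)).
have di : is_derive (0 : C) 1 (fun x : C => j * x) j.
  by apply: (@is_derive_affine_eq _ _ j 0) => x; rewrite addr0.
have i0 : j * 0 = 0 :> C by rewrite mulr0.
have dfi : is_derive (j * 0 : C) 1 f (f^`()%classic 0) by rewrite i0.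
have dGi : is_derive (j * 0 : C) 1 G m by rewrite i0.
have D1 := is_deriveMC (@is_derive_compC _ f (fun x : C => j * x) 0 _ _ dfi di) dG.
have D2 := is_deriveMC df (@is_derive_compC _ G (fun x : C => j * x) 0 _ _ dGi di).
have D3 := @is_deriveMC _ (cst K) _ 0 _ _ (is_derive_cst K (0 : C) 1) D2.
(* As f = x^r G and (i t)^r = K t^r for t > 0, this difference vanishes on positive reals.
   Cross-multiplication eliminates t^r, leaving a function continuous at 0 with value 1 - K
   there. *)
have D4 := @is_deriveBC _ (fun x => f (j * x) * G x) (fun x => K * (f x * G (j * x)))
  0 _ _ D1 D3.
suff K1 : K = 1.
  (* r i pi / 2 = 2 pi i n would make the exponent r the integer 4n. *)
  have [n en] := cexp_eq1 K1; have := vg (Some l0) (4 * n).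
  rewrite -rE; move/negP; apply; apply/eqP.
  have pi0 : (pi : R)%:C != 0 by rewrite (inj_eq (@complexI R)) gt_eqF ?pi_gt0.
  have ii : j * j = -1 :> C by rewrite jE -expr2 sqr_i.
  have i0' : j != 0 :> C.
    apply/eqP => e; have := ii; rewrite [X in X * _]e mul0r => /eqP.
  by rewrite eq_sym oppr_eq0 oner_eq0.
  have eE : (0 +i* (n%:~R * pi *+ 2) : C) = j * ((n%:~R * pi *+ 2 : R)%:C).
    by rewrite jE /GRing.mul /= !mul0r !mul1r subr0 add0r.
  have e1 : (n%:~R * pi *+ 2 : R)%:C = 2 * (n%:~R * (pi : R)%:C) :> C.
    by rewrite rmorphMn rmorphM /= rmorph_int mulr_natl.
  have e2 : (pi / 2 : R)%:C = (pi : R)%:C / 2 :> C.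
    by rewrite rmorphM /= fmorphV rmorph_nat.
  move: en; rewrite eE e1 e2; move: (pi%:C) pi0 => q q0 e.
  apply: (mulIf q0); apply: (mulfI i0'); rewrite rmorphM /=.
  have -> : j * (r * q) = 2 * (r * (j * (q / 2))) by field.
  have -> : (4 : int)%:~R = 4 :> C by rewrite -pmulrn.
  rewrite e; ring.
have := @eq0_along_reals _ (is_derive_cont D4); rewrite i0 h0 G0 !mulr1.
suff h : \forall t \near (0 : C), forall q : R, 0 < q -> t = q%:C ->
   f (j * t) * G t - K * (f t * G (j * t)) = 0.
  by move=> /(_ h) /eqP; rewrite subr_eq0 eq_sym => /eqP.
have ci := is_derive_cont di.
have Ei : \forall x \near (j * 0 : C), U g p x = f x by rewrite i0.
apply: nearC_imp (nearC_and E (ci _ Ei)) => t /= [e1 e2] q q0 tq.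
have UG x : U g p x = cpow x r * G x.
  by rewrite /U /prefactor gb /G /H mulrA [fpoint a l0]/(0 : C) subr0.
rewrite -e1 -e2 !UG tq.
have -> : cpow (j * q%:C) r = K * cpow q%:C r.
  rewrite /cpow jE clog_imaginary// clog_real// /K jE -cexpD -mulrDr.
  by congr (cexp (r * _)); rewrite /GRing.mul /GRing.add /= !mul0r !mul1r subr0 !addr0 !add0r.
move: (cpow _ _) (G q%:C) (G _) => *; ring.
Qed.

End BaseAtZero.

Lemma equivalentE g p : generic p ->
  equivalent g p <-> (l0 \notin g.1) && (g.2 (Some l0) == Some l0).
Proof.
move=> gen; split=> [e|/andP[h /eqP e]]; last first.
  by apply: U_equivalent => //; rewrite -{1}e permK.
have [gb _] := e; rewrite -{1}gb permKV eqxx andbT.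
by apply/negP => h; exact: U_not_equivalent gen gb h e.
Qed.

End Equivalence.

(** * Group structure *)

(* [gcomp g1 g2] acts as g1 followed by g2. *)
Definition gcomp (g1 g2 : gasym) : gasym :=
  ([set e | sgn g2 (Some e) (+) sgn g1 (g2.2^-1%g (Some e))]%SET, (g1.2 * g2.2)%g).

Lemma big_addb_label (f : label -> bool) :
  \big[addb/false]_l f l = f None (+) odd #|[set e | f (Some e)]%SET|.
Proof.
rewrite (bigD1 None)//=; congr (_ (+) _).
rewrite (reindex_omap Some id) //=; last by case.
rewrite -sum1_card (big_morph odd oddD (erefl : odd 0 = false)) [RHS]big_mkcond /=.
by apply: eq_big => [e|e _]; rewrite ?eqxx// finset.in_set; case: (f _).
Qed.

Lemma big_addb_sgn g : \big[addb/false]_l sgn g l = false.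
Proof.
rewrite big_addb_label /=; have -> : [set e | e \in g.1]%SET = g.1.
  by apply/finset.setP => e; rewrite finset.in_set.
by rewrite addbb.
Qed.

(** Evenness forces the sign at infinity, so nothing is lost by keeping only the finite labels. *)
Lemma sgn_even (f : label -> bool) (s : {perm label}) :
  \big[addb/false]_l f l = false -> sgn ([set e | f (Some e)]%SET, s) =1 f.
Proof.
rewrite big_addb_label => h [e|] /=; first by rewrite finset.in_set.
by case: (f None) h => /=; case: (odd _).
Qed.

Lemma sgn_gcomp g1 g2 l : sgn (gcomp g1 g2) l = sgn g2 l (+) sgn g1 (g2.2^-1%g l).
Proof.
have e : \big[addb/false]_l (sgn g2 l (+) sgn g1 (g2.2^-1%g l)) = false.
  rewrite big_split /= big_addb_sgn /=.
  by rewrite -[RHS](big_addb_sgn g1) [RHS](reindex_perm g2.2^-1%g).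
exact: sgn_even e l.
Qed.

Lemma sgn_inj g k : g.2 = k.2 -> sgn g =1 sgn k -> g = k.
Proof.
case: g k => [h s] [h' s'] /= <- e; congr (_, _); apply/finset.setP => d.
exact: e (Some d).
Qed.

Lemma sgn1 (s : {perm label}) l : sgn (finset.set0, s) l = false.
Proof. by case: l => [e|] /=; rewrite ?finset.in_set0 ?cards0. Qed.

Section Composition.
Variable R : realType.
Local Notation C := R[i].
Implicit Types (p : heun R) (g k : gasym) (x y : C).

Lemma act_comp g1 g2 p : generic p -> hact (gcomp g1 g2) p = hact g2 (hact g1 p).
Proof.
move=> gen; have [a0 a1 _] := gen.
have [e1 e2 e3 e4] := act_spec (gcomp g1 g2) gen.
have [f1 f2 f3 f4] := act_spec g1 gen; have [h1 h2 h3 _] := act_spec g2 f4.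
apply: (heun_conj_inj a0 a1 e1 _ _ e3 (conjugate_comp a0 a1 f1 f3 h3)).
  by rewrite h1 f1 mob_a_comp.
move=> l; rewrite e2 h2 f2 sgn_gcomp /= invMg permM.
by case: (sgn g2 l); case: (sgn g1 _) => //=; rewrite opprK.
Qed.

Lemma act1 p : generic p -> hact gasym1 p = p.
Proof.
move=> gen; have [a0 a1 _] := gen; have [e1 e2 e3 _] := act_spec gasym1 gen.
apply: (heun_conj_inj a0 a1 e1 _ _ e3); rewrite ?mob_a1//.
  by move=> l; rewrite e2 sgn1 invg1 perm1.
by move=> x _; rewrite mob_der1 expr1n mul1r /Pmap mobius1.
Qed.

Lemma expression1 p : generic p -> expression gasym1 p = (fun=> 0, p, id).
Proof.
move=> gen; rewrite /expression act1//; congr (_, _, _); apply/funext => x.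
  by rewrite /expo perm1 finset.in_set0.
exact: mobius1.
Qed.

Lemma noninteger_inv n : noninteger (n.+2%:R^-1 : C).
Proof.
move=> m; apply/negP => /eqP e.
have : (m * n.+2%:Z)%:~R = 1%:~R :> C by rewrite intrM -e -pmulrn mulVf// pnatr_eq0.
move=> /intr_inj/(congr1 absz); rewrite abszM /= => /eqP.
by rewrite muln_eq1 andbF.
Qed.

(** Exponent differences 1/2, 1/3, 1/4, 1/5 are non-integers with distinct absolute values, so a
    signed permutation can be read off from its effect on them. *)
Definition witness_den (l : label) : nat := if l is Some e then e.+2 else 5.

Lemma witness_den_inj : injective witness_den.
Proof.
case=> [e|] [e'|] //= h; first by case: h => /val_inj ->.
  by have := ltn_ord e; case: h => ->.
by have := ltn_ord e'; case: h => <-.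
Qed.

Lemma generic_witness : exists2 p : heun R, generic p &
  forall l, expdiff p l = (witness_den l)%:R^-1.
Proof.
pose s : C := 2^-1 + 3^-1 + 4^-1 + 5^-1.
(* Forced by Fuchs' relation. *)
pose al : C := 1 - s / 2.
have v l : expdiff (Heun 2 0 al (al + 5^-1) (1 - 2^-1) (1 - 3^-1)) l = (witness_den l)%:R^-1.
  case: l => [d|]; last by rewrite /expdiff /=; ring.
  elim/flabelP: d; rewrite /expdiff /rho /=; [ring|ring|].
  by rewrite /he_epsilon /= /al /s; field.
exists (Heun 2 0 al (al + 5^-1) (1 - 2^-1) (1 - 3^-1)) => //.
apply/genericE; split => [||l]; rewrite ?v /=.
- by rewrite pnatr_eq0.
- by rewrite (eqr_nat _ 2 1).
- by case: l => [e|]; exact: noninteger_inv.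
Qed.

Lemma signed_inv_inj (b c : bool) (m n : nat) : (0 < m)%N -> (0 < n)%N ->
  (if b then - m%:R^-1 else m%:R^-1) = (if c then - n%:R^-1 else n%:R^-1 :> C) ->
  b = c /\ m = n.
Proof.
move=> m0 n0; have m1 : 0 < m%:R^-1 :> C by rewrite invr_gt0 ltr0n.
have n1 : 0 < n%:R^-1 :> C by rewrite invr_gt0 ltr0n.
have inj : m%:R^-1 = n%:R^-1 :> C -> m = n by move=> /invr_inj /eqP; rewrite eqr_nat => /eqP.
have no : m%:R^-1 + n%:R^-1 <> 0 :> C by move=> e; have := addr_gt0 m1 n1; rewrite e ltxx.
case: b; case: c => /=; first by move=> /oppr_inj/inj.
- by move=> e; case: no; rewrite -e subrr.
- by move=> e; case: no; rewrite e addNr.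
- by move/inj.
Qed.

(** One equation separating all elements yields the uniqueness halves of both composition laws and
    the distinctness of the expressions. *)
Lemma act_witness : exists2 p : heun R, generic p & injective (fun g => hact g p).
Proof.
have [p gen v] := generic_witness; exists p => // g k e.
have [_ eg _ _] := act_spec g gen; have [_ ek _ _] := act_spec k gen.
have w0 l : (0 < witness_den l)%N by case: l.
have H l : sgn g l = sgn k l /\ g.2^-1%g l = k.2^-1%g l.
  have := eg l; rewrite e ek !v => /(signed_inv_inj (w0 _) (w0 _))[-> h].
  by split=> //; exact/esym/witness_den_inj.
apply: sgn_inj => [|l]; last by case: (H l).
by apply: invg_inj; apply/permP => l; case: (H l).
Qed.

Lemma is_product_gcomp g1 g2 : @is_product R g1 g2 (gcomp g2 g1).
Proof.
move=> k; split=> [h|-> p gen]; last exact: act_comp.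
have [p gen inj] := act_witness; apply: inj => /=.
by rewrite h// act_comp.
Qed.

Lemma expression_neq g1 g2 : g1 != g2 ->
  exists p : heun R, generic p /\ expression g1 p <> expression g2 p.
Proof.
move=> ne; have [p gen inj] := act_witness; exists p; split=> // -[_ e _].
by move/eqP: ne; apply; exact: inj.
Qed.

End Composition.

(** * The transformation group of Hl and its composition law *)

Definition Hl_group : {set gasym} :=
  [set g : gasym | (l0 \notin g.1) && (g.2 (Some l0) == Some l0)]%SET.

Lemma Hl_groupP (g : gasym) : reflect (l0 \notin g.1 /\ g.2^-1%g (Some l0) = Some l0) (g \in Hl_group).
Proof.
rewrite finset.in_set; apply: (iffP andP) => -[h e]; split=> //.
  by rewrite -{1}(eqP e) permK.
by rewrite -{1}e permKV.
Qed.

Lemma gcomp_Hl_group g1 g2 : g1 \in Hl_group -> g2 \in Hl_group -> gcomp g1 g2 \in Hl_group.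
Proof.
move=> /Hl_groupP[h1 e1] /Hl_groupP[h2 e2]; apply/Hl_groupP; split.
  by have := sgn_gcomp g1 g2 (Some l0); rewrite e2 /= (negPf h1) (negPf h2) /= => ->.
by rewrite /= invMg permM e2.
Qed.

Lemma is_successive_gcomp (R : realType) g1 g2 : g1 \in Hl_group -> g2 \in Hl_group ->
  @is_successive R g1 g2 (gcomp g1 g2).
Proof.
move=> E1 E2 k; split=> [h|->{k} p gen].
  have [p gen inj] := act_witness R; apply: inj => /=.
  by have [-> _] := h p gen; rewrite act_comp.
split; first exact: act_comp.
have Ek := gcomp_Hl_group E1 E2.
have [k1 gbk] := Hl_groupP _ Ek; have [h1 gb1] := Hl_groupP _ E1.
have [h2 gb2] := Hl_groupP _ E2; have [a0 a1 _] := gen.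
have [ea _ _ gen1] := act_spec g1 gen; have [_ _ _ genk] := act_spec (gcomp g1 g2) gen.
have [_ Uk] := U_equivalent gen gbk k1; have [_ U1] := U_equivalent gen gb1 h1.
have [_ U2] := U_equivalent gen1 gb2 h2.
have M0 : \forall x \near (0 : R[i]),
    Pmap (gcomp g1 g2).2 p x = Pmap g2.2 (hact g1 p) (Pmap g1.2 p x).
  apply: nearC_imp (nearC_and (near_bracket0 gen gb1) (near_bracket0 gen gbk)).
  by move=> x [b1 b2]; rewrite /Pmap ea mobius_comp.
(* Rewriting Hl in one step or in two gives the same function; cancelling this common nonzero factor
   proves the equality of prefactors without comparing branches. *)
have N0 : \forall x \near (0 : R[i]), Hl (hact (gcomp g1 g2) p) (Pmap (gcomp g1 g2).2 p x) != 0.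
  have H : \forall y \near Pmap (gcomp g1 g2).2 p 0, Hl (hact (gcomp g1 g2) p) y != 0.
    by rewrite (Pmap_at0 p gbk); exact: Hl_near_neq0.
  exact: near_comp (continuous_Pmap0 gen gbk) H.
have N2 : \forall x \near (0 : R[i]),
    U g2 (hact g1 p) (Pmap g1.2 p x) = Hl (hact g1 p) (Pmap g1.2 p x).
  have H : \forall y \near Pmap g1.2 p 0, U g2 (hact g1 p) y = Hl (hact g1 p) y.
    by rewrite (Pmap_at0 p gb1).
  exact: near_comp (continuous_Pmap0 gen gb1) H.
apply: nearC_imp (nearC_and (nearC_and M0 N0) (nearC_and N2 (nearC_and Uk U1))).
move=> x [[m n0] [u2 [uk u1]]]; split=> //; apply: (mulIf n0).
rewrite -[LHS]/(U (gcomp g1 g2) p x) uk -u1 /U -u2 /U -mulrA.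
by rewrite m act_comp.
Qed.

(** The required isomorphisms start from the concrete group, whereas the natural maps end there; the
    default [x0] is never reached on [D]. *)
Lemma is_iso_inverse (gT : finGroupType) (T : finType) (D : {set gT}) (E : {set T})
    (prod : T -> T -> T -> Prop) (theta : T -> gT) (x0 : T) :
  {in E &, injective theta} -> (theta @: E)%SET = D ->
  (forall g1 g2, g1 \in E -> g2 \in E ->
     exists g, [/\ g \in E, theta g = (theta g1 * theta g2)%g & prod g1 g2 g]) ->
  exists phi, is_iso D E prod phi.
Proof.
move=> inj <- hom; pose phi w := odflt x0 [pick g in E | theta g == w].
have phiK g : g \in E -> phi (theta g) = g.
  move=> gE; rewrite /phi; case: pickP => [k /andP[kE /eqP]|/(_ g)] /=.
    exact: inj.
  by rewrite gE eqxx.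
exists phi; split.
- by move=> _ _ /imsetP[g gE ->] /imsetP[k kE ->]; rewrite !phiK// => ->.
- apply/finset.setP => g; apply/imsetP/idP => [[_ /imsetP[k kE ->] ->]|gE].
    by rewrite phiK.
  by exists (theta g); rewrite ?phiK// imset_f.
- move=> _ _ /imsetP[g gE ->] /imsetP[k kE ->]; have [m [mE <- h]] := hom g k gE kE.
  by rewrite !phiK.
Qed.

(** * Identification with the even-signed permutations *)

Definition label_of_ord (i : 'I_4) : label := unlift ord0 i.
Definition ord_of_label (l : label) : 'I_4 := oapp (lift ord0) ord0 l.

Lemma label_of_ordK : cancel label_of_ord ord_of_label.
Proof. by move=> i; rewrite /label_of_ord; case: unliftP => [j|] ->. Qed.

Lemma ord_of_labelK : cancel ord_of_label label_of_ord.
Proof. by case=> [e|] /=; rewrite /label_of_ord ?liftK ?unlift_none. Qed.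

Section SignedPermutation.
Variable g : gasym.

(** The inverse of sigma appears because exponent differences are pulled back; it makes the map
    respect the order of factors, as permutation products apply the left factor first. *)
Definition signed_fun (x : 'I_4 * bool) : 'I_4 * bool :=
  (ord_of_label (g.2^-1%g (label_of_ord x.1)), x.2 (+) sgn g (label_of_ord x.1)).

Lemma signed_fun_inj : injective signed_fun.
Proof.
move=> [i b] [j c] [] /(can_inj ord_of_labelK)/perm_inj/(can_inj label_of_ordK) /= ->.
by move/addIb => ->.
Qed.

Definition signed_perm : {perm 'I_4 * bool} := perm signed_fun_inj.

End SignedPermutation.

Lemma signed_perm_inj : injective signed_perm.
Proof.
move=> g k /permP e; have H l : g.2^-1%g l = k.2^-1%g l /\ sgn g l = sgn k l.
  have E := e (ord_of_label l, false).
  rewrite !permE /signed_fun /= ord_of_labelK in E.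
  by split; [exact: (can_inj ord_of_labelK (congr1 fst E))|exact: (congr1 snd E)].
apply: sgn_inj => [|l]; last by case: (H l).
by apply: invg_inj; apply/permP => l; case: (H l).
Qed.

Lemma signed_perm_gcomp g1 g2 :
  signed_perm (gcomp g2 g1) = (signed_perm g1 * signed_perm g2)%g.
Proof.
apply/permP => -[i b]; rewrite permM !permE /signed_fun /= ord_of_labelK.
by rewrite invMg permM sgn_gcomp addbA.
Qed.

Lemma even_signedP (w : {perm 'I_4 * bool}) : reflect
  ((forall i b, w (i, ~~ b) = ((w (i, b)).1, ~~ (w (i, b)).2)) /\
   \big[addb/false]_l ~~ (w (ord_of_label l, true)).2 = false)
  (w \in even_signed 'I_4).
Proof.
have E : odd #|[set i | ~~ (w (i, true)).2]%SET|
    = \big[addb/false]_l ~~ (w (ord_of_label l, true)).2.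
  rewrite -sum1_card (big_morph odd oddD (erefl : odd 0 = false)) big_mkcond /=.
  rewrite (reindex ord_of_label); last by exists label_of_ord => x _; rewrite ?ord_of_labelK ?label_of_ordK.
  by apply: eq_bigr => l _; rewrite finset.in_set; case: ifP.
rewrite finset.in_set E; apply: (iffP andP) => -[h1 h2]; split.
- by move=> i b; apply/eqP; move/forallP/(_ i)/forallP/(_ b): h1.
- exact: negbTE.
- by apply/forallP => i; apply/forallP => b; rewrite h1.
- by rewrite h2.
Qed.

Lemma signed_perm_image : (signed_perm @: [set: gasym])%SET = even_signed 'I_4.
Proof.
apply/finset.setP => w; apply/imsetP/even_signedP => [[g _ ->]|[hw ev]].
  split=> [i b|]; first by rewrite !permE /signed_fun /= addNb.
  rewrite -[RHS](big_addb_sgn g); apply: eq_bigr => l _.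
  by rewrite permE /signed_fun /= ord_of_labelK negbK.
pose t (l : label) := label_of_ord (w (ord_of_label l, true)).1.
have t_inj : injective t.
  move=> l m /(can_inj label_of_ordK) e; apply: (can_inj ord_of_labelK).
  (* If the signs differ, commutation with the sign change would identify the images of +l and
     -m. *)
  have [es|es] := eqVneq (w (ord_of_label l, true)).2 (w (ord_of_label m, true)).2.
    have : w (ord_of_label l, true) = w (ord_of_label m, true).
      by rewrite [LHS]surjective_pairing [RHS]surjective_pairing e es.
    by move=> /perm_inj[].
  have : w (ord_of_label l, true) = w (ord_of_label m, ~~ true).
    by rewrite hw [LHS]surjective_pairing e; congr (_, _); case: (_).2 es; case: (_).2.
  by move=> /perm_inj[].
pose g : gasym := ([set e | ~~ (w (ord_of_label (Some e), true)).2]%SET, (perm t_inj)^-1%g).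
exists g => //; apply/permP => -[i b]; rewrite permE /signed_fun /= invgK permE /t.
have sg := @sgn_even (fun l => ~~ (w (ord_of_label l, true)).2) (perm t_inj)^-1%g ev.
rewrite /= in sg; rewrite sg !label_of_ordK.
case: b; first by rewrite /= negbK -surjective_pairing.
by have := hw i true => /= ->.
Qed.

(* Hl_group acts on the four sets of labels that have even cardinality and do
   not contain 0, each determined by its trace on the finite labels. *)
Definition code (i : 'I_4) : {set flabel} :=
  [set e | (e == l1) && odd i || (e == la) && (2 <= i)%N]%SET.
Definition decode (h : {set flabel}) : 'I_4 := inord ((l1 \in h) + (la \in h).*2).

Lemma codeK : cancel code decode.
Proof.
by move=> i; apply: ord_inj; rewrite /decode !finset.in_set inordK; case: i => [[|[|[|[|]]]]].
Qed.

Lemma decodeK (h : {set flabel}) : l0 \notin h -> code (decode h) = h.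
Proof.
move=> h0; apply/finset.setP => e; rewrite finset.in_set /decode inordK; last first.
  by case: (l1 \in h); case: (la \in h).
elim/flabelP: e; first by rewrite (negPf h0).
  by case: (l1 \in h); case: (la \in h).
by case: (l1 \in h); case: (la \in h).
Qed.

Lemma code_l0 i : l0 \notin code i.
Proof. by rewrite finset.in_set. Qed.

(** Viewing [h] as a pure sign change, this is the affine map that permutes the labels by sigma and
    then adds the signs of [g] modulo 2. *)
Definition sact (g : gasym) (h : {set flabel}) : {set flabel} := (gcomp (h, 1%g) g).1.

Lemma sgn_sact g h l : sgn (sact g h, 1%g) l = sgn g l (+) sgn (h, 1%g) (g.2^-1%g l).
Proof. exact: (sgn_gcomp (h, 1%g) g l). Qed.

Lemma set_sgn (h h' : {set flabel}) : sgn (h, 1%g) =1 sgn (h', 1%g) -> h = h'.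
Proof. by move=> e; have [] := @sgn_inj (h, 1%g) (h', 1%g) erefl e. Qed.

Lemma sact_gcomp g1 g2 h : sact (gcomp g1 g2) h = sact g2 (sact g1 h).
Proof.
by apply: set_sgn => l; rewrite !sgn_sact sgn_gcomp /= invMg permM addbA.
Qed.

Lemma sact_inj g : injective (sact g).
Proof.
move=> h h' e; apply: set_sgn => l.
have := sgn_sact g h (g.2 l); rewrite e sgn_sact permK.
by move/addbI => ->.
Qed.

Lemma sact_l0 g (h : {set flabel}) : g \in Hl_group -> l0 \notin h -> l0 \notin sact g h.
Proof.
move=> /Hl_groupP[h1 e1] h0; have := sgn_sact g h (Some l0).
by rewrite e1 /= (negPf h1) (negPf h0) /= => ->.
Qed.

(** The empty set reveals the signs. The singletons of 1 and a, completed by infinity to even sets,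
    then reveal the permutation: a label is determined by its membership in {1, oo} and {a, oo}. *)
Lemma sact_faithful (g k : gasym) :
  (forall h : {set flabel}, l0 \notin h -> sact g h = sact k h) -> g = k.
Proof.
move=> H; have S (h : {set flabel}) l : l0 \notin h ->
    sgn g l (+) sgn (h, 1%g) (g.2^-1%g l) = sgn k l (+) sgn (h, 1%g) (k.2^-1%g l).
  by move=> h0; rewrite -!sgn_sact H.
have S0 l : sgn g l = sgn k l.
  by have := S finset.set0 l; rewrite !sgn1 !addbF; apply; rewrite finset.in_set0.
apply: sgn_inj => //; apply: invg_inj; apply/permP => l.
have T d : d != l0 -> sgn ([set d]%SET, 1%g) (g.2^-1%g l) = sgn ([set d]%SET, 1%g) (k.2^-1%g l).
  move=> dl; have := S [set d]%SET l; rewrite S0 finset.in_set1 eq_sym => /(_ dl).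
  by move/addbI.
have := T l1 erefl; have := T la erefl.
case: (g.2^-1%g l) => [d|]; case: (k.2^-1%g l) => [e|] //=;
  rewrite ?cards1 ?finset.in_set1.
- by elim/flabelP: d; elim/flabelP: e.
- by elim/flabelP: d.
- by elim/flabelP: e.
Qed.

Lemma sact_perm_inj g : g \in Hl_group -> injective (fun i => decode (sact g (code i))).
Proof.
move=> gE i j /(congr1 code); rewrite !decodeK ?sact_l0 ?code_l0// => /sact_inj.
by move/(can_inj codeK).
Qed.

(** Injectivity is available only for [g] in [Hl_group]; choosing the permutation makes the map
    total. *)
Definition sact_perm (g : gasym) : 'S_4 :=
  odflt 1%g [pick s : 'S_4 | [forall i, s i == decode (sact g (code i))]].

Lemma sact_permE g i : g \in Hl_group -> sact_perm g i = decode (sact g (code i)).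
Proof.
move=> gE; rewrite /sact_perm; case: pickP => [s /forallP/(_ i)/eqP //|].
by move=> /(_ (perm (sact_perm_inj gE)))/forallP[] j; rewrite permE.
Qed.

Lemma sact_perm_faithful : {in Hl_group &, injective sact_perm}.
Proof.
move=> g k gE kE e; apply: sact_faithful => h h0.
have := congr1 (fun s : 'S_4 => code (s (decode h))) e.
by rewrite !sact_permE// !decodeK ?sact_l0.
Qed.

Lemma sact_perm_gcomp g1 g2 : g1 \in Hl_group -> g2 \in Hl_group ->
  sact_perm (gcomp g1 g2) = (sact_perm g1 * sact_perm g2)%g.
Proof.
move=> E1 E2; apply/permP => i; rewrite permM !sact_permE ?gcomp_Hl_group//.
by rewrite decodeK ?sact_gcomp// sact_l0 ?code_l0.
Qed.

Lemma card_perm_label : #|{perm label}| = 24%N.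
Proof.
have -> : #|{perm label}| = #|perm_on [set: label]%SET|.
  by apply: eq_card => s; rewrite !inE; apply/esym/fintype.subsetP => x; rewrite !inE.
by rewrite card_perm cardsT card_option card_ord.
Qed.

Lemma card_gasym : #|[set: gasym]%SET| = 192%N.
Proof.
rewrite cardsT card_prod card_perm_label -cardsT -powersetT card_powerset cardsT.
by rewrite card_ord.
Qed.

Lemma card_Hl_group : #|Hl_group| = 24%N.
Proof.
have -> : Hl_group = finset.setX (powerset (~: [set l0]))
    [set s : {perm label} | s (Some l0) == Some l0]%SET.
  apply/finset.setP => -[h s]; rewrite !finset.in_set /=; congr (_ && _).
  by rewrite finset.subsetC finset.sub1set finset.in_setC.
rewrite cardsX card_powerset cardsC1 card_ord.
have -> : #|[set s : {perm label} | s (Some l0) == Some l0]%SET|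
    = #|perm_on (~: [set (Some l0 : label)])%SET|.
  apply: eq_card => s; rewrite finset.in_set; apply/eqP/fintype.subsetP => [e x|H].
    by rewrite !inE; apply: contraNneq => ->; rewrite e.
  apply/eqP; have := H (Some l0); rewrite !inE eqxx /=.
  by case: eqP => // _ /(_ isT).
by rewrite card_perm cardsC1 card_option card_ord.
Qed.

(** Surjectivity by counting: an injective map between sets of 24 elements. *)
Lemma sact_perm_image : (sact_perm @: Hl_group)%SET = [set: 'S_4]%SET.
Proof.
apply/eqP; rewrite eqEcard finset.subsetT /= card_in_imset ?card_Hl_group; last first.
  exact: sact_perm_faithful.
by rewrite cardsT card_Sn.
Qed.

Theorem mainTheorem2 (R : realType) :
  (exists phi : {perm 'I_4 * bool} -> gasym,
     is_iso (even_signed 'I_4) [set: gasym]%SET (@is_product R) phi) /\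
  [/\ #|[set: gasym]%SET| = 192%N,
      forall (g : gasym) (p : heun R), generic p -> local_solution g p &
      forall g1 g2 : gasym, g1 != g2 ->
        exists p : heun R, generic p /\ expression g1 p <> expression g2 p] /\
  exists E : {set gasym},
    [/\ #|E| = 24%N,
        forall (g : gasym) (p : heun R), generic p ->
          (g \in E <-> equivalent g p),
        gasym1 \in E /\
        (forall p : heun R, generic p ->
           expression gasym1 p = (fun=> 0, p, id)) &
        exists psi : 'S_4 -> gasym,
          is_iso [set: 'S_4]%SET E (@is_successive R) psi].

Proof.
split; [|split; [split|]].
- apply: (@is_iso_inverse _ _ _ _ _ signed_perm gasym1).
  + exact: in2W signed_perm_inj.
  + exact: signed_perm_image.
  + move=> g1 g2 _ _; exists (gcomp g2 g1); split=> //.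
      exact: signed_perm_gcomp.
    exact: is_product_gcomp.
- exact: card_gasym.
- by move=> g p; exact: local_solutionP.
- exact: expression_neq.
exists Hl_group; split.
- exact: card_Hl_group.
- by move=> g p gen; rewrite finset.in_set; apply: iff_sym; exact: equivalentE.
- split; first by apply/Hl_groupP; rewrite finset.in_set0 invg1 perm1.
  exact: expression1.
- apply: (@is_iso_inverse _ _ _ _ _ sact_perm gasym1).
  + exact: sact_perm_faithful.
  + exact: sact_perm_image.
  + move=> g1 g2 E1 E2; exists (gcomp g1 g2); split.
    * exact: gcomp_Hl_group.
    * exact: sact_perm_gcomp.
    * exact: is_successive_gcomp.
Qed.
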